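(* Let $\Psi$ be a stationary point process on $\mathbb{R}^d$ with intensity $\alpha\ge1$. Write $F(0):=F(\mathbb{Z}^d,\Psi,0)$. Assume that for some $\gamma\in(0,1]$ $$\sum_{w\in\mathbb{Z}^d}\|w\|^{\gamma d}\,\alpha_{\|w\|^{\gamma d},\|w\|^{\gamma d}}(\|w\|)<\infty\quad\text{and}\quad\sum_{w\in\mathbb{Z}^d}\mathbb{P}\big(F(0)\not\subset B(0,\|w\|^{\gamma})\big)<\infty.$$ Then the point process $\Psi_0^\tau:=\{x\in\Psi:\tau(\mathbb{Z}^d,\Psi,x)\neq\infty\}$ is hyperuniform.
   Context: $\mathbf{N}$ is the space of locally finite subsets $\varphi$ of $\mathbb{R}^d$, with the $\sigma$-field generated by the maps $\varphi\mapsto\varphi(B):=\mathrm{card}(\varphi\cap B)$, $B$ Borel. A point process is a random element of $\mathbf{N}$; it is stationary if $\Psi+x$ has the same distribution as $\Psi$ for all $x\in\mathbb{R}^d$, and then its intensity is $\alpha:=\mathbb{E}\Psi([0,1]^d)$. $\|\cdot\|$ is the Euclidean norm, $\lambda_d$ is Lebesgue measure, and $B(z,r)$ is the closed ball with centre $z$ and radius $r$. Hyperuniformity. A point process $\Psi'$ is hyperuniform if $\lim_{r\to\infty}\mathrm{Var}(\Psi'(rW))/\lambda_d(rW)=0$ for every convex compact set $W\subset\mathbb{R}^d$ with $\lambda_d(W)>0$. Mixing coefficient. $\alpha_{p,q}(s):=\sup|\mathrm{Cov}(f(\Psi\cap A),g(\Psi\cap B))|$, the supremum over all measurable $\{0,1\}$-valued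 functions $f,g$ on $\mathbf{N}$ and Borel sets $A,B\subset\mathbb{R}^d$ with $\lambda_d(A)\le p$, $\lambda_d(B)\le q$, and $d(A,B):=\inf_{x\in A,y\in B}\|x-y\|\ge s$. Matching. Let $\varphi,\psi\in\mathbf{N}$. A point $p\in\varphi$ prefers $x\in\psi$ to $y\in\psi$ if $\|x-p\|<\|y-p\|$, or if $\|x-p\|=\|y-p\|$ and $x$ is lexicographically strictly smaller than $y$. A point $x\in\psi$ prefers $p\in\varphi$ to $q\in\varphi$ if $\|p-x\|<\|q-x\|$, or if $\|p-x\|=\|q-x\|$ and $p$ is lexicographically strictly greater than $q$. The mutual nearest neighbour matching $\tau(\varphi,\psi,\cdot)$ is defined as follows: put $\varphi_0:=\varphi$, $\psi_0:=\psi$. Given $\varphi_n,\psi_n$, for each pair $(p,x)\in\varphi_n\times\psi_n$ such that $p$ prefers $x$ to all other points of $\psi_n$ and $x$ prefers $p$ to all other points of $\varphi_n$, set $\tau(\varphi,\psi,p):=x$ and $\tau(\varphi,\psi,x):=p$; let $\varphi_{n+1}\subset\varphi_n$, $\psi_{n+1}\subset\psi_n$ be the points not matched in this step. Points of $\varphi_\infty:=\bigcap_n\varphi_n$ and $\psi_\infty:=\bigcap_n\psi_n$ are never matched and get $\tau(\varphi,\psi,x):=\infty$. For $x\notin\varphi\cup\psi$ put $\tau(\varphi,\psi,x):=x$. Matching flower. For $n\ge2$, a sequence $(z_1,\dots,z_n)$ is a descending chain in $(\varphi,\psi)$ if $z_i\in\varphi$ for odd $i$, $z_i\in\psi$ for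 even $i$, and $z_i$ prefers $z_{i+1}$ to $z_{i-1}$ for $2\le i\le n-1$. For $z\in\varphi$ with $\tau(\varphi,\psi,z)\neq\infty$, a competing chain for $z$ is a descending chain $c=(z_1,\dots,z_n)$ with $z_1=z$ such that $z_2$ equals $\tau(\varphi,\psi,z)$ or is preferred by $z$ to $\tau(\varphi,\psi,z)$; put $F_c:=B(z_1,\|z_1-z_2\|)\cup\bigcup_{i=2}^nB(z_i,\|z_i-z_{i-1}\|)$. The matching flower is $F(\varphi,\psi,z):=\bigcup_cF_c$, the union over all competing chains $c$ for $z$. If $\tau(\varphi,\psi,z)=\infty$, then $F(\varphi,\psi,z):=\mathbb{R}^d$. *)

(* Defs.v *)
From HB Require Import structures.
From mathcomp Require Import all_boot all_order all_algebra.
From mathcomp Require Import all_classical all_reals all_analysis measurable_realfun.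

Set Implicit Arguments.
Unset Strict Implicit.
Unset Printing Implicit Defensive.
Import Order.TTheory GRing.Theory Num.Theory.
Import numFieldNormedType.Exports.
Local Open Scope classical_set_scope.
Local Open Scope ring_scope.

Definition borel_display : measure_display. Proof. exact: default_measure_display. Qed.

Section borel.
Context {R : realType} {d : nat}.

Definition borel_rV : set (set 'rV[R]_d) := <<s [set U | open U] >>.

Let borel0 : borel_rV set0. Proof. exact: sigma_algebra0. Qed.
Let borelC A : borel_rV A -> borel_rV (~` A). Proof. exact: sigma_algebraC. Qed.
Let borelU (F : (set 'rV[R]_d)^nat) :
  (forall i, borel_rV (F i)) -> borel_rV (\bigcup_i F i).
Proof. exact: sigma_algebra_bigcup. Qed.

HB.instance Definition _ :=
  @isMeasurable.Build borel_display 'rV[R]_d borel_rV borel0 borelC borelU.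

Lemma open_measurable_rV (U : set 'rV[R]_d) : open U -> measurable U.
Proof. by move=> oU; apply: sub_sigma_algebra. Qed.

Lemma measurable_coord (i : 'I_d) :
  measurable_fun [set: 'rV[R]_d] (fun v => v ord0 i).
Proof.
apply: (measurability _ (RGenOpens.measurableE R)).
move=> _ [_ [a [b ->] <-]]; rewrite setTI; apply: open_measurable_rV.
have /continuousP := @coord_continuous R 1 d ord0 i.
by apply; exact: interval_open.
Qed.

Lemma measurable_fun_rV d' (T : measurableType d') (f : T -> 'rV[R]_d) :
  (forall i, measurable_fun setT (fun t => f t ord0 i)) ->
  measurable_fun setT f.
Proof.
move=> mf; apply: (measurability [set U : set (matrix R 1 d) | open U] erefl).
move=> _ [U oU <-]; rewrite setTI.
pose cube (qk : 'rV[rat]_d * nat) : set 'rV[R]_d :=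
  [set v | forall i, `|v ord0 i - ratr (qk.1 ord0 i)| < qk.2.+1%:R^-1].
have -> : f @^-1` U = \bigcup_qk
    (if `[< cube qk `<=` U >] then f @^-1` cube qk else set0).
  apply/seteqP; split=> [t /= Uft|t [qk _]]; last first.
    by case: ifPn => // /asboolP sub /sub.
  have /nbhs_ballP[e /= e0 eU] : nbhs (f t) U by exact: open_nbhs_nbhs.
  have [k ke] : exists k : nat, k.+1%:R^-1 < e / 2.
    have e20 : 0 < e / 2 by rewrite divr_gt0.
    have [k _ ke] := near_infty_natSinv_lt (PosNum e20).
    by exists k; exact: (ke k (leqnn k)).
  have qP i : exists q : rat, `|f t ord0 i - ratr q| < k.+1%:R^-1 :> R.
    have /rat_in_itvoo[q] : f t ord0 i - k.+1%:R^-1 < f t ord0 i + k.+1%:R^-1.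
      by rewrite ltrD2l gtrN// invr_gt0.
    rewrite in_itv/= => /andP[q1 q2]; exists q.
    by rewrite ltr_distlC q1.
  have [q Hq] := choice qP.
  exists (\row_i q i, k) => //.
  rewrite ifT; first by move=> i /=; rewrite mxE.
  apply/asboolP => v /= cv; apply: eU; split => // i j; rewrite [i]ord1.
  have := cv j; rewrite mxE /= => vj.
  rewrite /ball/= (le_lt_trans (ler_distD (ratr (q j)) _ _))//.
  rewrite [e]splitr ltrD// ?(lt_trans (Hq j))//.
  by rewrite distrC (lt_trans vj).
apply: countable_bigcupT_measurable => [|[q k]].
  exact: countableP.
case: ifPn => // _.
have -> : f @^-1` cube (q, k) = \bigcap_(i in [set: 'I_d])
    ((fun t => f t ord0 i) @^-1` `]ratr (q ord0 i) - k.+1%:R^-1,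
       ratr (q ord0 i) + k.+1%:R^-1[%classic).
  apply/seteqP; split=> [t /= ft i _|t /= ft i].
    by rewrite /= in_itv/= -ltr_distl; exact: ft.
  by have := ft i Logic.I; rewrite /= in_itv/= -ltr_distl.
apply: fin_bigcap_measurable => // i _.
by rewrite -[X in measurable X]setTI; exact: mf.
Qed.

End borel.

Lemma sigma_finite_product_measure1 (R : realType) d1 d2
    (T1 : measurableType d1) (T2 : measurableType d2)
    (m1 : {sigma_finite_measure set T1 -> \bar R})
    (m2 : {sigma_finite_measure set T2 -> \bar R}) :
  sigma_finite setT (m1 \x m2)%E.
Proof.
have /sigma_finiteP[F [TF ndF Foo]] := sigma_finiteT m1.
have /sigma_finiteP[G [TG ndG Goo]] := sigma_finiteT m2.
exists (fun n => F n `*` G n).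
  rewrite -setXTT TF TG predeqE => -[x y]; split.
    move=> [/= [n _ Fnx] [k _ Gky]]; exists (maxn n k) => //; split.
    - by move: x Fnx; exact/subsetPset/ndF/leq_maxl.
    - by move: y Gky; exact/subsetPset/ndG/leq_maxr.
  by move=> [n _ []/= ? ?]; split; exists n.
move=> k; have [? ?] := Foo k; have [? ?] := Goo k.
split; first exact: measurableX.
by rewrite product_measure1E// lte_mul_pinfty// ge0_fin_numE.
Qed.

Section lebesgue.
Context {R : realType}.

Definition rV_cons d (xv : measurableTypeR R * 'rV[R]_d) : 'rV[R]_d.+1 :=
  \row_i oapp (fun j => xv.2 ord0 j) xv.1 (unlift ord0 i).

Definition rV_uncons d (v : 'rV[R]_d.+1) : measurableTypeR R * 'rV[R]_d :=
  (v ord0 ord0, \row_j v ord0 (lift ord0 j)).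

Lemma rV_consK d : cancel (@rV_cons d) (@rV_uncons d).
Proof.
move=> [x v]; rewrite /rV_uncons mxE unlift_none /=; congr (_, _).
by apply/rowP => j; rewrite !mxE liftK.
Qed.

Lemma measurable_rV_cons d : measurable_fun setT (@rV_cons d).
Proof.
apply: measurable_fun_rV => i; case: (unliftP ord0 i) => [j|] ->.
- rewrite (_ : (fun _ => _) = (fun v : 'rV[R]_d => v ord0 j) \o snd).
    by apply: measurableT_comp => //; exact: measurable_coord.
  by apply/funext => xv; rewrite mxE liftK.
- rewrite (_ : (fun _ => _) = fst); first exact: measurable_fst.
  by apply/funext => xv; rewrite mxE unlift_none.
Qed.

Lemma measurable_rV_uncons d : measurable_fun setT (@rV_uncons d).
Proof.
apply/measurable_fun_pair; first exact: measurable_coord.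
apply: measurable_fun_rV => j.
under eq_fun do rewrite mxE; exact: measurable_coord.
Qed.

Section step.
Local Open Scope ereal_scope.
Variables (d : nat) (m : {sigma_finite_measure set 'rV[R]_d -> \bar R}).

Definition lebesgue_step : set 'rV[R]_d.+1 -> \bar R :=
  pushforward (lebesgue_measure \x m) (@rV_cons d).

HB.instance Definition _ := Measure.copy lebesgue_step
  (measure_function_pushforward__canonical__measure_function_Measure
     (lebesgue_measure \x m) (@measurable_rV_cons d)).

Let lebesgue_step_sigma_finite : sigma_finite setT lebesgue_step.
Proof.
have [F FT Ffin] := sigma_finite_product_measure1 lebesgue_measure m.
exists (fun k => @rV_uncons d @^-1` F k).
  by rewrite -preimage_bigcup -FT.
move=> k; have [mF Fk] := Ffin k; split.
  by rewrite -[X in measurable X]setTI; exact: measurable_rV_uncons.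
rewrite /lebesgue_step /pushforward -comp_preimage.
by rewrite (_ : _ \o _ = id)//; apply/funext => xv /=; rewrite rV_consK.
Qed.

HB.instance Definition _ := Measure_isSigmaFinite.Build _ _ _
  lebesgue_step lebesgue_step_sigma_finite.

End step.

(* lambda_(d+1) is the image of lambda_1 \x lambda_d under
   (x, v) |-> (x, v_1, ..., v_d); lebesgue_rV_box below pins it down. *)
Fixpoint lebesgue_rV d : {sigma_finite_measure set 'rV[R]_d -> \bar R} :=
  match d with
  | 0 => \d_(0 : 'rV[R]_0)
  | d'.+1 => lebesgue_step (lebesgue_rV d')
  end.

Lemma lebesgue_rV_box d (A : 'I_d -> set R) :
  (forall i, measurable (A i)) ->
  lebesgue_rV d [set v : 'rV[R]_d | forall i, A i (v ord0 i)] =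
  (\prod_(i < d) lebesgue_measure (A i))%E.
Proof.
elim: d => [|d IH] in A *; move=> mA.
  by rewrite big_ord0 /= diracE mem_set// => -[].
rewrite big_ord_recl -IH => [|i]; last exact: mA.
pose B : set 'rV[R]_d := [set v | forall i, A (lift ord0 i) (v ord0 i)].
have mB : measurable B.
  have -> : B = \bigcap_(i in [set: 'I_d])
      ((fun v : 'rV[R]_d => v ord0 i) @^-1` A (lift ord0 i)).
    by apply/seteqP; split=> [v Av i _|v Av i]; [exact: Av|exact: (Av i)].
  apply: fin_bigcap_measurable => // i _.
  by rewrite -[X in measurable X]setTI; apply: measurable_coord.
transitivity ((lebesgue_measure \x lebesgue_rV d)%E (A ord0 `*` B)).
  rewrite /= /lebesgue_step /pushforward; congr (product_measure1 _ _ _).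
  apply/seteqP; split=> [[x v] /= Axv|[x v] [/= Ax Av] i].
    split=> [|i] /=; first by have := Axv ord0; rewrite mxE unlift_none.
    by have := Axv (lift ord0 i); rewrite mxE liftK.
  by case: (unliftP ord0 i) => [j|] ->;
    rewrite mxE ?liftK ?unlift_none//; exact: Av.
by rewrite product_measure1E //; exact: mA.
Qed.

End lebesgue.

Section euclidean.
Context {R : realType} {d : nat}.
Implicit Types (x y z v : 'rV[R]_d) (A B : set 'rV[R]_d).

(* The library's norm `|v| on 'rV[R]_d is the sup norm. *)
Definition enorm v : R := Num.sqrt (\sum_(i < d) v ord0 i ^+ 2).

Definition eball z (r : R) : set 'rV[R]_d := [set y | enorm (y - z) <= r].

(* +oo if A or B is empty *)
Definition edist A B : \bar R :=
  ereal_inf [set (enorm (x - y))%:E | x in A & y in B].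

Definition lexlt x y : Prop :=
  exists i : 'I_d, x ord0 i < y ord0 i /\
    forall j : 'I_d, (j < i)%N -> x ord0 j = y ord0 j.

Definition dilation (r : R) A : set 'rV[R]_d := [set r *: x | x in A].

Definition unit_cube : set 'rV[R]_d := [set x | forall i, 0 <= x ord0 i <= 1].

Definition integer_lattice : set 'rV[R]_d :=
  [set x | forall i, x ord0 i \is a Num.int].

Definition locally_finite A : Prop :=
  forall B, bounded_set B -> finite_set (A `&` B).

End euclidean.
Arguments unit_cube : clear implicits.
Arguments integer_lattice : clear implicits.

Section configurations.
Variables (R : realType) (d : nat).

Record configuration := Configuration {
  points :> set 'rV[R]_d ;
  points_locally_finite : locally_finite points }.

HB.instance Definition _ := gen_eqMixin configuration.
HB.instance Definition _ := gen_choiceMixin configuration.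

Lemma locally_finite0 : @locally_finite R d set0.
Proof. by move=> B _; rewrite set0I; exact: finite_set0. Qed.

HB.instance Definition _ :=
  isPointed.Build configuration (Configuration locally_finite0).

Definition npoints (phi : configuration) (B : set 'rV[R]_d) : \bar R :=
  counting (phi `&` B).

Definition configuration_display : measure_display.
Proof. exact: default_measure_display. Qed.

Definition configuration_measurable : set (set configuration) :=
  <<s [set E | exists B : set 'rV[R]_d, exists Y : set (\bar R),
         [/\ measurable B, measurable Y & E = (npoints ^~ B) @^-1` Y]] >>.

Let cm0 : configuration_measurable set0. Proof. exact: sigma_algebra0. Qed.
Let cmC E : configuration_measurable E -> configuration_measurable (~` E).
Proof. exact: sigma_algebraC. Qed.
Let cmU (F : (set configuration)^nat) :
  (forall i, configuration_measurable (F i)) ->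
  configuration_measurable (\bigcup_i F i).
Proof. exact: sigma_algebra_bigcup. Qed.

HB.instance Definition _ :=
  @isMeasurable.Build configuration_display configuration
    configuration_measurable cm0 cmC cmU.

Lemma sub_locally_finite (phi : configuration) (A : set 'rV[R]_d) :
  A `<=` phi -> locally_finite A.
Proof.
move=> Aphi B /(points_locally_finite phi); apply: sub_finite_set.
exact: setSI.
Qed.

Definition restriction (phi : configuration) (A : set 'rV[R]_d) :=
  Configuration (@sub_locally_finite phi (phi `&` A) (@subIsetl _ _ _)).

Lemma translate_locally_finite (phi : configuration) (x : 'rV[R]_d) :
  locally_finite [set y + x | y in phi].
Proof.
move=> B bB.
have bBx : bounded_set [set y | B (y + x)].
  have [M [Mreal BM]] := bB; exists (M + `|x|); split.
    by rewrite num_real.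
  move=> N MN y /= Byx; rewrite -(addrK x y).
  rewrite (le_trans (ler_normB _ _))// -lerBrDr.
  by apply: (BM (N - `|x|)) => //; rewrite ltrBrDr.
apply: (@sub_finite_set _ _
  [set y + x | y in phi `&` [set y | B (y + x)]]).
  by move=> _ [[y phiy <-] Byx]; exists y.
exact/finite_image/(points_locally_finite phi).
Qed.

Definition translation (phi : configuration) (x : 'rV[R]_d) :=
  Configuration (translate_locally_finite phi x).

End configurations.

Section point_processes.
Context {R : realType} {d : nat} {disp : measure_display}
  {Omega : measurableType disp} (P : probability Omega R).
Implicit Types Psi : Omega -> configuration R d.

Definition point_process Psi : Prop := measurable_fun setT Psi.

Definition stationary Psi : Prop :=
  forall (x : 'rV[R]_d) (E : set (configuration R d)), measurable E ->
    P [set w | E (translation (Psi w) x)] = P [set w | E (Psi w)].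

Definition intensity Psi : \bar R :=
  (\int[P]_w npoints (Psi w) (unit_cube R d))%E.

(* Psi w has finitely many points in the bounded set r W, so that
   taking fine loses nothing; the variance itself may be +oo. *)
Definition hyperuniform Psi : Prop :=
  forall W : set 'rV[R]_d,
    convex_set (W : set (convex_lmodType 'rV[R]_d)) -> compact W ->
    (0 < lebesgue_rV d W)%E ->
    ('V_P[fun w => fine (npoints (Psi w) (dilation r W))]
       / lebesgue_rV d (dilation r W))%E @[r --> +oo] --> 0%E.

Definition mixing_coefficient Psi (p q s : R) : \bar R :=
  ereal_sup [set c | exists (f g : configuration R d -> R) (A B : set 'rV[R]_d),
    [/\ measurable_fun setT f /\ range f `<=` [set 0; 1],
        measurable_fun setT g /\ range g `<=` [set 0; 1],
        measurable A /\ (lebesgue_rV d A <= p%:E)%E,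
        measurable B /\ (lebesgue_rV d B <= q%:E)%E &
        (s%:E <= edist A B)%E /\
        c = `|covariance P (fun w => f (restriction (Psi w) A))
                           (fun w => g (restriction (Psi w) B))|%E]].

End point_processes.

Section matching.
Context {R : realType} {d : nat}.
Variables phi psi : set 'rV[R]_d.
Implicit Types p q x y : 'rV[R]_d.

(* prefersl p x y : the point p of phi prefers x to y (both in psi) *)
Definition prefersl p x y : Prop :=
  enorm (x - p) < enorm (y - p) \/
  enorm (x - p) = enorm (y - p) /\ lexlt x y.

(* prefersr x p q : the point x of psi prefers p to q (both in phi) *)
Definition prefersr x p q : Prop :=
  enorm (p - x) < enorm (q - x) \/
  enorm (p - x) = enorm (q - x) /\ lexlt q p.

Definition mutual_nearest (A B : set 'rV[R]_d) p x : Prop :=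
  [/\ A p, B x, forall y, B y -> y <> x -> prefersl p x y &
      forall q, A q -> q <> p -> prefersr x p q].

Fixpoint unmatched (n : nat) : set 'rV[R]_d * set 'rV[R]_d :=
  if n is n'.+1 then
    let: (A, B) := unmatched n' in
    ([set p | A p /\ ~ exists x, mutual_nearest A B p x],
     [set x | B x /\ ~ exists p, mutual_nearest A B p x])
  else (phi, psi).

Definition matched p x : Prop :=
  exists n, mutual_nearest (unmatched n).1 (unmatched n).2 p x.

(* None stands for the value infinity.  A point of phi `&` psi is its own
   partner, so that the two cases of matched p x never conflict. *)
Definition matching (z : 'rV[R]_d) : option 'rV[R]_d :=
  if `[< (phi `|` psi) z >] then
    xget None [set o | exists2 y, o = Some y & matched z y \/ matched y z]
  else Some z.

(* A chain (z_1, ..., z_n) is given by its length n and the values of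
   z : nat -> 'rV[R]_d at 1, ..., n. *)
Definition descending_chain (n : nat) (z : nat -> 'rV[R]_d) : Prop :=
  [/\ (2 <= n)%N,
      forall i, (1 <= i <= n)%N -> if odd i then phi (z i) else psi (z i) &
      forall i, (2 <= i <= n.-1)%N ->
        if odd i then prefersl (z i) (z i.+1) (z i.-1)
        else prefersr (z i) (z i.+1) (z i.-1)].

(* tz is meant to be the partner of z0 *)
Definition competing_chain (z0 tz : 'rV[R]_d) (n : nat) (z : nat -> 'rV[R]_d) : Prop :=
  [/\ descending_chain n z, z 1%N = z0 &
      z 2%N = tz \/ prefersl z0 (z 2%N) tz].

Definition chain_region (n : nat) (z : nat -> 'rV[R]_d) : set 'rV[R]_d :=
  eball (z 1%N) (enorm (z 1%N - z 2%N)) `|`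
  \bigcup_(i in [set i | (2 <= i <= n)%N])
     eball (z i) (enorm (z i - z i.-1)).

Definition matching_flower (z0 : 'rV[R]_d) : set 'rV[R]_d :=
  if matching z0 is Some tz then
    [set u | exists n z, competing_chain z0 tz n z /\ chain_region n z u]
  else setT.

End matching.

Definition matched_points {R : realType} {d : nat} (phi : set 'rV[R]_d)
    (psi : configuration R d) : configuration R d :=
  Configuration (@sub_locally_finite R d psi
    (psi `&` [set x | matching phi psi x <> None]) (@subIsetl _ _ _)).

(* Main.v *)
Require Import Defs.
From HB Require Import structures.
From mathcomp Require Import all_boot all_order all_algebra.
From mathcomp Require Import all_classical all_reals all_analysis measurable_realfun.
From mathcomp Require Import ring lra.

Set Implicit Arguments.
Unset Strict Implicit.
Unset Printing Implicit Defensive.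
Import Order.TTheory GRing.Theory Num.Theory.
Import numFieldNormedType.Exports.
Local Open Scope classical_set_scope.
Local Open Scope ring_scope.

(* Write eta_z for the indicator that the lattice point z is matched into
   K = rW.  The matching is a bijection between its domain in Z^d and the
   matched points, so the count in K is the sum of the eta_z, and its variance
   is at most the sum over u in Z^d of S(u) := sum_z |Cov(eta_z, eta_(z+u))|.
   - The event that z has a partner in K and its flower lies in B(z, rho)
     depends only on the restriction to B(z, rho).  Hence Cov(eta_z, eta_(z+u))
     is bounded by the mixing coefficient plus the probabilities that z or
     z + u is matched into K with a large flower.  By stationarity the sum of
     the latter over z is at most C r^d P(F(0) not in B(0, rho)), and only
     C r^d rho^d of the mixing terms are nonzero.  With rho of order
     |u|^gamma this gives S(u) <= C r^d c_u with a summable c.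
   - Cov(eta_z, eta_(z+u)) does not change if eta_z is shifted by the constant
     1(z in K), so S(u) is at most the expected number of z such that exactly
     one of z and z + tau(0) is in K.  For |tau(0)| <= rho and convex K this
     number is at most C rho r^(d-1), which makes S(u) = o(r^d) for fixed u. *)

(** * Counting points of a configuration in measurable sections *)

(** The two hypotheses control only lattice vectors w, with radius |w|^gamma and separation exactly
    |w|, and the summand |w|^(gamma d) alpha(|w|) need not be monotone in |w|. Balls around z and z
    + u are separated by less than |u|, so S(u) cannot be compared with the term at w = u. Instead u
    is rounded to a coarser lattice vector w with |u| >= 2|w|; the gap pays for the two radii, and
    each w serves a bounded number of vectors u. The order of choices matters: first a finite list
    of shifts u outside which the majorant is small, then a radius rho depending on the length of
    that list, and finally r depending on rho. The sigma-field on configurations knows only counts,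
    whereas matching and flower are defined through stages and chains. Quantifiers over lattice
    points are countable; quantifiers over points of the configuration are replaced by positivity of
    the count in a measurable section, which is why section counts come first. *)

Section boxes.
Context {R : realType} {d : nat}.

Lemma rV_norm_le (x : 'rV[R]_d) (b : R) : 0 <= b ->
  (forall i, `|x ord0 i| <= b) -> `|x| <= b.
Proof.
move=> b0 xb; rewrite /Num.norm /= mx_normrE.
by apply: bigmax_le => // -[i j] _ /=; rewrite [i]ord1.
Qed.

Lemma coord_le_norm (x : 'rV[R]_d) i : `|x ord0 i| <= `|x|.
Proof.
rewrite [leRHS]/Num.norm /= mx_normrE.
exact: (le_bigmax_cond 0 (fun ij : 'I_1 * 'I_d => `|x ij.1 ij.2|) (j := (ord0, i))).
Qed.

Definition box (Q : R) : set 'rV[R]_d := [set x | forall i, `|x ord0 i| <= Q].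

Lemma box_bounded Q : bounded_set (box Q).
Proof.
exists `|Q|; split => // M QM x /= xQ.
apply: rV_norm_le => [|i]; first exact: le_trans (ltW QM).
by rewrite (le_trans (xQ i))// (le_trans (ler_norm _))// ltW.
Qed.

Lemma bounded_sub_box (A : set 'rV[R]_d) : bounded_set A ->
  exists2 Q, 0 < Q & A `<=` box Q.
Proof.
move=> [M [_ /(_ (`|M| + 1))]]; rewrite (le_lt_trans (ler_norm _)) ?ltrDl//.
move=> /(_ isT) AM; exists (`|M| + 1); first by rewrite ltr_wpDl.
by move=> x /AM /= xM i; exact: le_trans (coord_le_norm x i) xM.
Qed.

Lemma measurable_box Q : measurable (box Q).
Proof.
have -> : box Q = \bigcap_(i in [set: 'I_d])
    ((fun v : 'rV[R]_d => v ord0 i) @^-1` `[- Q, Q]%classic).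
  apply/seteqP; split=> [x xQ i _|x xQ i]; first by rewrite /= in_itv/= -ler_norml.
  by have := xQ i Logic.I; rewrite /= in_itv/= -ler_norml.
apply: fin_bigcap_measurable => // i _.
by rewrite -[X in measurable X]setTI; apply: measurable_coord.
Qed.

Lemma box_exhaust : \bigcup_n box n%:R = [set: 'rV[R]_d].
Proof.
apply/seteqP; split=> // x _.
exists (Num.truncn `|x|).+1 => // i; rewrite (le_trans (coord_le_norm x i))//.
exact/ltW/truncnS_gt.
Qed.

Lemma sub_box (a b : R) : a <= b -> box a `<=` box b.
Proof. by move=> ab x xa i; exact: le_trans ab. Qed.

Lemma measurable_singleton (x : 'rV[R]_d) : measurable [set x].
Proof.
have -> : [set x] = \bigcap_(i in [set: 'I_d])
    ((fun v : 'rV[R]_d => v ord0 i) @^-1` [set x ord0 i]).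
  apply/seteqP; split=> [y -> i _//|y xy].
  by apply/rowP => i; exact: (xy i).
apply: fin_bigcap_measurable => // i _.
by rewrite -[X in measurable X]setTI; apply: measurable_coord.
Qed.

Lemma countable_points (phi : configuration R d) : countable phi.
Proof.
rewrite -[X in countable X]setIT -box_exhaust setI_bigcupr.
apply: bigcup_countable => // n _; apply/finite_set_countable.
exact/points_locally_finite/box_bounded.
Qed.

Lemma measurable_points (phi : configuration R d) : measurable (phi : set 'rV[R]_d).
Proof.
by apply: countable_measurable; [exact: measurable_singleton|exact: countable_points].
Qed.

End boxes.

Section section_counting.
Context {R : realType} {d : nat} {disp : measure_display} {T : measurableType disp}.
Variables (g : T -> configuration R d) (mg : measurable_fun setT g).

(** The points of [g t] as a restricted counting measure; in the form of a kernel, the general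
    measurability result for sections applies to it. *)
Definition point_kernel (t : T) : {measure set 'rV[R]_d -> \bar R} :=
  mrestr counting (measurable_points (g t)).

Lemma point_kernelE t A : point_kernel t A = npoints (g t) A.
Proof. by rewrite /point_kernel /= /mrestr setIC. Qed.

Lemma measurable_npoints (B : set 'rV[R]_d) : measurable B ->
  measurable_fun [set: configuration R d] (fun phi => npoints phi B).
Proof.
move=> mB _ Y mY; rewrite setTI; apply: sub_sigma_algebra.
by exists B, Y.
Qed.

Lemma point_kernel_measurable (U : set 'rV[R]_d) : measurable U ->
  measurable_fun setT (point_kernel ^~ U).
Proof.
move=> mU; rewrite (_ : (fun t => point_kernel t U) = fun t => npoints (g t) U); last first.
  by apply/funext => t; exact: point_kernelE.
exact: (measurableT_comp (measurable_npoints mU) mg).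
Qed.

HB.instance Definition _ :=
  isKernel.Build _ _ _ _ R point_kernel point_kernel_measurable.

(** The kernel is finite only on bounded sets, so the count is first taken in the boxes of size n,
    and then n tends to infinity. *)
Lemma measurable_npoints_section (E : set (T * 'rV[R]_d)) : measurable E ->
  measurable_fun setT (fun t => npoints (g t) [set x | E (t, x)]).
Proof.
move=> mE.
pose f n t := npoints (g t) ([set x | E (t, x)] `&` box n%:R).
have mS t : measurable [set x | E (t, x)].
  by have := measurable_xsection t mE; rewrite xsectionE.
apply: (emeasurable_fun_cvg f) => [n|t _].
  have [|_] := @measurable_prod_subset_xsection_kernel _ _ _ _ R point_kernel _
    (measurable_box n%:R) _ _ mE; last first.
    apply: eq_measurable_fun => t _.
    by rewrite [LHS]point_kernelE xsectionE.
  move=> t; exists (fine (npoints (g t) (box n%:R)) + 1) => X mX.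
  have fin A : A `<=` box n%:R -> npoints (g t) A \is a fin_num.
    move=> Ab; rewrite /npoints /counting asboolT//.
    by apply: sub_finite_set (points_locally_finite (g t) (box_bounded n%:R)); exact: setIS.
  rewrite EFinD fineK ?fin//.
  rewrite (@le_lt_trans _ _ (npoints (g t) (box n%:R)))//.
    rewrite -point_kernelE; apply: le_measure; rewrite ?inE//.
    - by apply: measurableI => //; exact: measurable_box.
    - exact: measurable_box.
  by rewrite lteDl ?fin// lte01.
rewrite -point_kernelE -[X in point_kernel t X]setIT -box_exhaust setI_bigcupr.
rewrite /f; under eq_fun do rewrite -point_kernelE.
apply: nondecreasing_cvg_mu => //.
- by move=> n; apply: measurableI => //; exact: measurable_box.
- by apply: bigcupT_measurable => n; apply: measurableI => //; exact: measurable_box.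
- by move=> m n mn; apply/subsetPset; apply: setIS; apply: sub_box; rewrite ler_nat.
Qed.

Lemma npoints_gt0 (phi : configuration R d) (A : set 'rV[R]_d) :
  (0 < npoints phi A)%E <-> exists2 x, points phi x & A x.
Proof.
rewrite /npoints /counting; split=> [|[x phix Ax]].
  have [->|/set0P[x [? ?]] _] := eqVneq (phi `&` A) set0; last by exists x.
  by rewrite asboolT// fset_set0 ltxx.
case: ifPn => [/asboolP fin|_]; last exact: ltry.
rewrite lte_fin ltr0n finmap.cardfs_gt0; apply/finmap.fset0Pn; exists x.
by rewrite in_fset_set// inE.
Qed.

(** Existence is positivity of a count, so quantifying over the points of a random configuration
    preserves measurability. The measurability of the matching and of the flower rests on this and
    on the countability of the lattice. *)
Lemma measurable_exists_point (E : set (T * 'rV[R]_d)) : measurable E ->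
  measurable [set t | exists2 x, points (g t) x & E (t, x)].
Proof.
move=> mE.
rewrite (_ : [set t | _] =
    (fun t => npoints (g t) [set x | E (t, x)]) @^-1` [set y | 0 < y]%E); last first.
  by apply/seteqP; split=> t /=; rewrite npoints_gt0.
rewrite -[X in measurable X]setTI; apply: measurable_npoints_section => //.
rewrite (_ : [set y | _] = `]0%E, +oo%E]%classic); last first.
  by apply/seteqP; split=> y /=; rewrite in_itv/= leey andbT.
exact: emeasurable_itv.
Qed.

End section_counting.

(** * Euclidean norm and inclusion of balls *)

Section euclidean_norm.
Context {R : realType} {d : nat}.
Implicit Types x y z v : 'rV[R]_d.

Lemma enorm_ge0 x : 0 <= enorm x.
Proof. exact: sqrtr_ge0. Qed.

Let sumsq_ge0 x : 0 <= \sum_(i < d) x ord0 i ^+ 2.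
Proof. by apply: sumr_ge0 => i _; exact: sqr_ge0. Qed.

Lemma sqr_enorm x : enorm x ^+ 2 = \sum_(i < d) x ord0 i ^+ 2.
Proof. by rewrite sqr_sqrtr. Qed.

Lemma enormN x : enorm (- x) = enorm x.
Proof. by congr Num.sqrt; apply: eq_bigr => i _; rewrite mxE sqrrN. Qed.

Lemma enorm_distC x y : enorm (x - y) = enorm (y - x).
Proof. by rewrite -opprB enormN. Qed.

Lemma enorm0 : enorm (0 : 'rV[R]_d) = 0.
Proof. by rewrite /enorm big1 ?sqrtr0// => i _; rewrite mxE expr0n. Qed.

Lemma enormZ (a : R) x : 0 <= a -> enorm (a *: x) = a * enorm x.
Proof.
move=> a0; rewrite /enorm -{2}(ger0_norm a0) -sqrtr_sqr -sqrtrM ?sqr_ge0//.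
by rewrite mulr_sumr; congr Num.sqrt; apply: eq_bigr => i _; rewrite mxE exprMn.
Qed.

Lemma enorm_eq0 x : enorm x = 0 -> x = 0.
Proof.
move=> /eqP; rewrite sqrtr_eq0 => h.
have /eqP : \sum_(i < d) x ord0 i ^+ 2 = 0 by apply/eqP; rewrite eq_le h sumsq_ge0.
rewrite psumr_eq0 => [/allP /= x0|i _]; last exact: sqr_ge0.
apply/rowP => i; have := x0 i; rewrite mem_index_enum => /(_ isT).
by rewrite sqrf_eq0 mxE => /eqP.
Qed.

Lemma le_enorm x y : (forall i, `|x ord0 i| <= `|y ord0 i|) -> enorm x <= enorm y.
Proof.
move=> xy; rewrite /enorm ler_sqrt ?sumsq_ge0//; apply: ler_sum => i _.
by rewrite -(real_normK (num_real (x _ _))) -(real_normK (num_real (y _ _))) lerXn2r ?nnegrE.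
Qed.

Lemma coord_le_enorm x i : `|x ord0 i| <= enorm x.
Proof.
rewrite -(ler_pXn2r (_ : (0 < 2)%N)) ?nnegrE ?enorm_ge0//.
rewrite sqr_enorm (bigD1 i)//= real_normK ?num_real// lerDl.
by apply: sumr_ge0 => j _; exact: sqr_ge0.
Qed.

(* Lagrange's identity, in the form of a sum of squares *)
Let cauchy_schwarz x y :
  (\sum_(i < d) x ord0 i * y ord0 i) ^+ 2 <= enorm x ^+ 2 * enorm y ^+ 2.
Proof.
rewrite !sqr_enorm -subr_ge0.
have -> : (\sum_i x ord0 i ^+ 2) * (\sum_i y ord0 i ^+ 2) -
    (\sum_i x ord0 i * y ord0 i) ^+ 2 =
    2^-1 * \sum_i \sum_j (x ord0 i * y ord0 j - x ord0 j * y ord0 i) ^+ 2.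
  have E : \sum_i \sum_j (x ord0 i * y ord0 j - x ord0 j * y ord0 i) ^+ 2 =
     \sum_i \sum_j (x ord0 i ^+ 2 * y ord0 j ^+ 2) +
     \sum_i \sum_j (y ord0 i ^+ 2 * x ord0 j ^+ 2) -
     2 * \sum_i \sum_j ((x ord0 i * y ord0 i) * (x ord0 j * y ord0 j)).
    rewrite -big_split /= mulr_sumr -sumrB; apply: eq_bigr => i _.
    rewrite -big_split /= mulr_sumr -sumrB; apply: eq_bigr => j _.
    by ring.
  rewrite E -!big_distrlr /=; set a := \sum_i x _ _ ^+ 2; set b := \sum_i y _ _ ^+ 2.
  by set c := \sum_i _; field.
apply: mulr_ge0; first by rewrite invr_ge0.
by apply: sumr_ge0 => i _; apply: sumr_ge0 => j _; exact: sqr_ge0.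
Qed.

Lemma ler_enormD x y : enorm (x + y) <= enorm x + enorm y.
Proof.
rewrite -(ler_pXn2r (_ : (0 < 2)%N)) ?nnegrE ?addr_ge0 ?enorm_ge0//.
rewrite sqrrD !sqr_enorm.
have -> : \sum_i (x + y) ord0 i ^+ 2 = \sum_i x ord0 i ^+ 2 +
    (\sum_i x ord0 i * y ord0 i) *+ 2 + \sum_i y ord0 i ^+ 2.
  rewrite -sumrMnl -!big_split /=; apply: eq_bigr => i _.
  by rewrite !mxE sqrrD.
rewrite lerD2r lerD2l lerMn2r /=.
rewrite (le_trans (ler_norm _))// -(ler_pXn2r (_ : (0 < 2)%N)) ?nnegrE ?mulr_ge0 ?enorm_ge0//.
by rewrite real_normK ?num_real// exprMn cauchy_schwarz.
Qed.

Lemma enorm_tri x y z : enorm (x - z) <= enorm (x - y) + enorm (y - z).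
Proof. by rewrite -[x - z](subrKA y) ler_enormD. Qed.

Lemma norm_le_enorm x : `|x| <= enorm x.
Proof.
rewrite /Num.norm /= mx_normrE.
by apply: bigmax_le => [|[i j] _]; [exact: enorm_ge0|rewrite /= [i]ord1 coord_le_enorm].
Qed.

Lemma eball_bounded z r : bounded_set (eball z r).
Proof.
exists (`|r| + enorm z); split; first exact: num_real.
move=> M rM x /= xz; rewrite (le_trans (norm_le_enorm x))// (le_trans _ (ltW rM))//.
rewrite -[x](subrK z) (le_trans (ler_enormD _ _))// lerD2r (le_trans xz)//.
exact: ler_norm.
Qed.

(** The extreme point of the inner ball is b + s v, with v a unit vector in the direction b - z, or
    any unit vector if b = z; this is where d > 0 enters. Inclusions of flower balls thereby become
    measurable inequalities. *)
Lemma eball_subP (b z : 'rV[R]_d) (s r : R) : (0 < d)%N -> 0 <= s ->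
  (eball b s `<=` eball z r) <-> enorm (b - z) + s <= r.
Proof.
move=> d0 s0; split=> [sub|bzr x]; last first.
  rewrite /eball /= => xb; rewrite (le_trans (enorm_tri x b z))//.
  by rewrite addrC (le_trans _ bzr)// lerD2l.
have [v [v1 bzv]] : exists v : 'rV[R]_d, enorm v = 1 /\ b - z = enorm (b - z) *: v.
  have [/eqP bz|bz] := eqVneq (enorm (b - z)) 0.
    exists (delta_mx ord0 (Ordinal d0)); split; last first.
      by move/eqP/enorm_eq0 : (bz) => ->; rewrite enorm0 scale0r.
    rewrite /enorm (bigD1 (Ordinal d0))//= !mxE !eqxx/= expr1n big1 ?addr0 ?sqrtr1//.
    by move=> i /negPf i0; rewrite mxE i0 andbF expr0n.
  exists ((enorm (b - z))^-1 *: (b - z)); split.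
    by rewrite enormZ ?invr_ge0 ?enorm_ge0// mulVf.
  by rewrite scalerA mulfV// scale1r.
have : eball b s (b + s *: v).
  by rewrite /eball /= addrC addKr enormZ// v1 mulr1.
move=> /sub; rewrite /eball /= addrAC {1}bzv -scalerDl enormZ ?addr_ge0 ?enorm_ge0//.
by rewrite v1 mulr1.
Qed.

End euclidean_norm.

(** * Preferences, stages of the matching and locality of the flower *)

Lemma finite_common_bound (T : eqType) (S : set T) (Q : T -> nat -> Prop) :
  finite_set S -> (forall y, S y -> exists n, Q y n) ->
  exists N, forall y, S y -> exists2 n, (n < N)%N & Q y n.
Proof.
move=> /finite_seqP[s ->]; elim: s => [|a s IH] SQ; first by exists 0%N.
have [n Qan] := SQ a (mem_head _ _).
have [|N IHN] := IH; first by move=> y /= ys; apply: SQ; rewrite /= inE ys orbT.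
exists (maxn n.+1 N) => y /=; rewrite inE => /predU1P[->|/IHN[k kN ?]].
  by exists n => //; rewrite leq_max leqnn.
by exists k => //; rewrite leq_max kN orbT.
Qed.

Section preferences.
Context {R : realType} {d : nat}.
Implicit Types p q x y z : 'rV[R]_d.

Lemma lexlt_irr x : ~ lexlt x x.
Proof. by move=> [i []]; rewrite ltxx. Qed.

Lemma lexlt_trans x y z : lexlt x y -> lexlt y z -> lexlt x z.
Proof.
move=> [i [xyi eqi]] [j [yzj eqj]].
have [ij|ji|/val_inj ij] := ltngtP i j.
- by exists i; split=> [|k ki]; [rewrite -eqj|rewrite eqi// eqj// (ltn_trans ki)].
- by exists j; split=> [|k kj]; [rewrite eqi|rewrite eqi ?eqj// (ltn_trans kj)].
- by subst j; exists i; split=> [|k ki]; [exact: lt_trans yzj|rewrite eqi// eqj].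
Qed.

Lemma lexlt_total x y : x <> y -> lexlt x y \/ lexlt y x.
Proof.
move=> xy.
have [i0 xyi0] : exists i : 'I_d, x ord0 i != y ord0 i.
  apply/existsP; rewrite -negb_forall; apply/negP => /forallP xye; apply: xy.
  by apply/rowP => i; apply/eqP.
case: (@arg_minnP _ i0 (fun i => x ord0 i != y ord0 i) (fun i : 'I_d => val i) xyi0) => i xyi imin.
have eqi (j : 'I_d) : (j < i)%N -> x ord0 j = y ord0 j.
  by move=> ji; apply/eqP; apply: contraTT ji => /imin; rewrite -leqNgt.
by move: xyi; rewrite neq_lt => /orP[?|?]; [left|right]; exists i; split => // j /eqi.
Qed.

Lemma prefersl_irr p x : ~ prefersl p x x.
Proof. by move=> [|[_ /lexlt_irr//]]; rewrite ltxx. Qed.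

Lemma prefersl_trans p x y z : prefersl p x y -> prefersl p y z -> prefersl p x z.
Proof.
move=> [xy|[xy lxy]] [yz|[yz lyz]]; [left|left|left|right].
- exact: lt_trans yz.
- by rewrite -yz.
- by rewrite xy.
- by split; [rewrite xy|exact: lexlt_trans lyz].
Qed.

Lemma prefersl_total p x y : x <> y -> prefersl p x y \/ prefersl p y x.
Proof.
move=> xy; have [?|?|e] := ltgtP (enorm (x - p)) (enorm (y - p)).
- by left; left.
- by right; left.
- by have [?|?] := lexlt_total xy; [left|right]; right.
Qed.

Lemma prefersl_le p x y : prefersl p x y -> enorm (x - p) <= enorm (y - p).
Proof. by move=> [/ltW//|[->]]. Qed.

Lemma prefersr_irr x p : ~ prefersr x p p.
Proof. by move=> [|[_ /lexlt_irr//]]; rewrite ltxx. Qed.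

Lemma prefersr_trans x p q r : prefersr x p q -> prefersr x q r -> prefersr x p r.
Proof.
move=> [xy|[xy lxy]] [yz|[yz lyz]]; [left|left|left|right].
- exact: lt_trans yz.
- by rewrite -yz.
- by rewrite xy.
- by split; [rewrite xy|exact: lexlt_trans lxy].
Qed.

Lemma prefersr_total x p q : p <> q -> prefersr x p q \/ prefersr x q p.
Proof.
move=> pq; have [?|?|e] := ltgtP (enorm (p - x)) (enorm (q - x)).
- by left; left.
- by right; left.
- by have [?|?] := lexlt_total pq; [right|left]; right.
Qed.

Lemma prefersr_le x p q : prefersr x p q -> enorm (p - x) <= enorm (q - x).
Proof. by move=> [/ltW//|[->]]. Qed.

End preferences.

Section matching_theory.
Context {R : realType} {d : nat}.
Variables phi psi : set 'rV[R]_d.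
Implicit Types p q x y : 'rV[R]_d.

Definition matched_at n p x :=
  mutual_nearest (unmatched phi psi n).1 (unmatched phi psi n).2 p x.

Lemma unmatched1S n p : (unmatched phi psi n.+1).1 p <->
  (unmatched phi psi n).1 p /\ ~ exists x, matched_at n p x.
Proof. by rewrite /matched_at /=; case: (unmatched phi psi n). Qed.

Lemma unmatched2S n x : (unmatched phi psi n.+1).2 x <->
  (unmatched phi psi n).2 x /\ ~ exists p, matched_at n p x.
Proof. by rewrite /matched_at /=; case: (unmatched phi psi n). Qed.

Lemma unmatched1_le m n p : (m <= n)%N ->
  (unmatched phi psi n).1 p -> (unmatched phi psi m).1 p.
Proof.
by elim: n => [|n IH]; rewrite leq_eqVlt ?ltnS => /predU1P[->//|// /IH mn] /unmatched1S[/mn].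
Qed.

Lemma unmatched2_le m n x : (m <= n)%N ->
  (unmatched phi psi n).2 x -> (unmatched phi psi m).2 x.
Proof.
by elim: n => [|n IH]; rewrite leq_eqVlt ?ltnS => /predU1P[->//|// /IH mn] /unmatched2S[/mn].
Qed.

Lemma unmatched1P n p : (unmatched phi psi n).1 p <->
  phi p /\ forall m x, (m < n)%N -> ~ matched_at m p x.
Proof.
elim: n => [|n IH]; first by split=> [|[]].
split=> [/unmatched1S[/IH[phip pn] pS]|[phip pn]].
  split=> // m x; rewrite ltnS leq_eqVlt => /predU1P[->|/pn]; last exact.
  by move=> pmx; apply: pS; exists x.
apply/unmatched1S; split; first by apply/IH; split => // m x /ltnW; exact: pn.
by move=> [x]; exact: pn.
Qed.

Lemma unmatched2P n x : (unmatched phi psi n).2 x <->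
  psi x /\ forall m p, (m < n)%N -> ~ matched_at m p x.
Proof.
elim: n => [|n IH]; first by split=> [|[]].
split=> [/unmatched2S[/IH[phip pn] pS]|[phip pn]].
  split=> // m p; rewrite ltnS leq_eqVlt => /predU1P[->|/pn]; last exact.
  by move=> pmx; apply: pS; exists p.
apply/unmatched2S; split; first by apply/IH; split => // m p /ltnW; exact: pn.
by move=> [p]; exact: pn.
Qed.

Lemma matched_phi p x : matched phi psi p x -> phi p.
Proof. by move=> [n [/unmatched1P[]]]. Qed.

Lemma matched_psi p x : matched phi psi p x -> psi x.
Proof. by move=> [n [_ /unmatched2P[]]]. Qed.

Lemma matched_fun p x y : matched phi psi p x -> matched phi psi p y -> x = y.
Proof.
move=> [m pmx] [n pny]; apply: contrapT => xy.
wlog mn : m n x y pmx pny xy / (m <= n)%N.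
  by move=> W; case/orP: (leq_total m n) => mn; [apply: (W m n x y)|apply: (W n m y x)] => // /esym.
have [emn|] := eqVneq m n.
  subst n; case: pmx => _ xm xmin _; case: pny => _ ym ymin _.
  apply: (@prefersl_irr _ _ p x); apply: (@prefersl_trans _ _ p x y).
    by apply: xmin => // /esym.
  exact: ymin.
rewrite neq_ltn [X in _ || X]ltnNge mn orbF => {}mn.
by case: pny => /unmatched1P[_ /(_ _ _ mn pmx)].
Qed.

Lemma matched_inj p q x : matched phi psi p x -> matched phi psi q x -> p = q.
Proof.
move=> [m pmx] [n pny]; apply: contrapT => xy.
wlog mn : m n p q pmx pny xy / (m <= n)%N.
  by move=> W; case/orP: (leq_total m n) => mn; [apply: (W m n p q)|apply: (W n m q p)] => // /esym.
have [emn|] := eqVneq m n.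
  subst n; case: pmx => xm _ _ xmin; case: pny => ym _ _ ymin.
  apply: (@prefersr_irr _ _ x p); apply: (@prefersr_trans _ _ x p q).
    by apply: xmin => // /esym.
  exact: ymin.
rewrite neq_ltn [X in _ || X]ltnNge mn orbF => {}mn.
by case: pny => _ /unmatched2P[_ /(_ _ _ mn pmx)].
Qed.

(** A common point is at distance 0 from itself, so it is matched with itself at stage 0. This
    settles the case where both alternatives in [matching] could apply. *)
Lemma matched_self z : phi z -> psi z -> matched phi psi z z.
Proof.
move=> phiz psiz; exists 0%N; split=> //= y _ yz; left; rewrite subrr enorm0;
  by rewrite lt_neqAle enorm_ge0 andbT eq_sym; apply/eqP => /enorm_eq0/subr0_eq.
Qed.

Lemma matching_lP z y : phi z ->
  matching phi psi z = Some y <-> matched phi psi z y.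
Proof.
move=> phiz; rewrite /matching asboolT; last by left.
have key w : matched phi psi w z -> matched phi psi z w.
  move=> wz; have zz := matched_self phiz (matched_psi wz).
  by rewrite (matched_inj wz zz).
split; case: xgetP => [v _ [w -> wz]|no] //.
- by move=> [<-]; case: wz => // /key.
- by move=> zy; congr Some; case: wz => [|/key] /matched_fun; apply.
- by move=> zy; exfalso; apply: (no (Some y)); exists y => //; left.
Qed.

Lemma matching_rP x : psi x ->
  matching phi psi x <> None <-> exists p, matched phi psi p x.
Proof.
move=> psix; rewrite /matching asboolT; last by right.
split; case: xgetP => [v _ [w -> wz]|no] //.
- case: wz => [xw|wx] _; last by exists w.
  by exists x; apply: matched_self => //; exact: matched_phi xw.
- by move=> [p px] _; apply: (no (Some p)); exists p => //; right.
Qed.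

End matching_theory.

Section stable_characterization.
Context {R : realType} {d : nat}.
Variables phi psi : set 'rV[R]_d.
Hypotheses (lfphi : locally_finite phi) (lfpsi : locally_finite psi).
Implicit Types p q x y : 'rV[R]_d.

(* There are finitely many points that p or x would prefer, so they have all
   been removed at some common stage. *)
Lemma matched_intro p x : phi p -> psi x ->
  (forall y, psi y -> prefersl p y x ->
    exists2 q, matched phi psi q y & prefersr y q p) ->
  (forall q, phi q -> prefersr x q p ->
    exists2 y, matched phi psi q y & prefersl q y x) ->
  matched phi psi p x.
Proof.
move=> phip psix Hl Hr.
have [N1 HN1] : exists N, forall y, psi y /\ prefersl p y x ->
    exists2 n, (n < N)%N & exists q, matched_at phi psi n q y.
  apply: finite_common_bound => [|y [psiy pyx]]; last first.
    by have [q [n ?] _] := Hl _ psiy pyx; exists n, q.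
  apply: sub_finite_set (lfpsi (eball_bounded p (enorm (x - p)))) => y [psiy /prefersl_le yx].
  by split.
have [N2 HN2] : exists N, forall q, phi q /\ prefersr x q p ->
    exists2 n, (n < N)%N & exists y, matched_at phi psi n q y.
  apply: finite_common_bound => [|q [phiq xqp]]; last first.
    by have [y [n ?] _] := Hr _ phiq xqp; exists n, y.
  apply: sub_finite_set (lfphi (eball_bounded x (enorm (p - x)))) => q [phiq /prefersr_le qp].
  by split.
(* Until p and x are matched to each other, both survive. If p were matched to some y that it
   prefers to x, then [Hl] would give y a partner that y strictly prefers to p, although this
   partner is p by injectivity; similarly for x. *)
have stay n : (exists2 m, (m < n)%N & matched_at phi psi m p x) \/
    (unmatched phi psi n).1 p /\ (unmatched phi psi n).2 x.
  elim: n => [|n [[m mn pmx]|[pn xn]]]; first by right.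
    by left; exists m => //; exact: leqW.
  have [pnx|pnx] := pselect (matched_at phi psi n p x); first by left; exists n.
  right; split.
    apply/unmatched1S; split=> // -[y pny].
    have xy : x <> y by move=> xy; apply: pnx; rewrite xy.
    have [pxy|pyx] := prefersl_total p xy.
      have [_ _ /(_ _ xn xy) pyx _] := pny.
      exact: prefersl_irr (prefersl_trans pxy pyx).
    have [_ /unmatched2P[psiy _] _ _] := pny.
    have [q qy] := Hl _ psiy pyx.
    have -> : q = p by apply: matched_inj qy _; exists n.
    exact: prefersr_irr.
  apply/unmatched2S; split=> // -[q qnx].
  have pq : p <> q by move=> pq; apply: pnx; rewrite pq.
  have [xpq|xqp] := prefersr_total x pq.
    have [_ _ _ /(_ _ pn pq) xqp] := qnx.
    exact: prefersr_irr (prefersr_trans xpq xqp).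
  have [/unmatched1P[phiq _] _ _ _] := qnx.
  have [y qy] := Hr _ phiq xqp.
  have -> : y = x by apply: matched_fun qy _; exists n.
  exact: prefersl_irr.
have [[m _ ?]|[pN xN]] := stay (maxn N1 N2); first by exists m.
exists (maxn N1 N2); split=> // [y yN yx|q qN qp].
  have [//|pyx] : prefersl p x y \/ prefersl p y x by apply: prefersl_total => /esym.
  have /unmatched2P[psiy ymax] := yN.
  have [|n nN1 [q qny]] := HN1 y; first by split.
  by case: (ymax n q _ qny); rewrite leq_max nN1.
have [//|xqp] : prefersr x p q \/ prefersr x q p by apply: prefersr_total => /esym.
have /unmatched1P[phiq qmax] := qN.
have [|n nN2 [y qny]] := HN2 q; first by split.
by case: (qmax n y _ qny); rewrite leq_max nN2 orbT.
Qed.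

(** Converse to [matched_intro], with stages: if y were still present at stage n, then p would not
    choose x. The strict inequality m < n is what makes the induction in [matched_local]
    possible. *)
Lemma matched_blockl n p x y : matched_at phi psi n p x ->
  psi y -> prefersl p y x ->
  exists m q, [/\ (m < n)%N, matched_at phi psi m q y & prefersr y q p].
Proof.
move=> pnx psiy pyx.
have yNx : y <> x by move=> yx; move: pyx; rewrite yx => /prefersl_irr.
have yn : ~ (unmatched phi psi n).2 y.
  move=> yn; case: pnx => _ _ /(_ _ yn yNx) pxy _.
  exact: prefersl_irr (prefersl_trans pxy pyx).
have [m [q [mn qmy]]] : exists m q, (m < n)%N /\ matched_at phi psi m q y.
  apply: contrapT => no; apply: yn; apply/unmatched2P; split=> // m q mn qmy.
  by apply: no; exists m, q.
exists m, q; split=> //; have [_ _ _] := qmy; apply.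
  by case: pnx => /(unmatched1_le (ltnW mn)).
move=> pq; apply: yNx; apply: (matched_fun (phi := phi) (psi := psi) (p := p)); last by exists n.
by rewrite pq; exists m.
Qed.

Lemma matched_blockr n p x q : matched_at phi psi n p x ->
  phi q -> prefersr x q p ->
  exists m y, [/\ (m < n)%N, matched_at phi psi m q y & prefersl q y x].
Proof.
move=> pnx phiq xqp.
have qNp : q <> p by move=> qp; move: xqp; rewrite qp => /prefersr_irr.
have qn : ~ (unmatched phi psi n).1 q.
  move=> qn; case: pnx => _ _ _ /(_ _ qn qNp) xpq.
  exact: prefersr_irr (prefersr_trans xpq xqp).
have [m [y [mn qmy]]] : exists m y, (m < n)%N /\ matched_at phi psi m q y.
  apply: contrapT => no; apply: qn; apply/unmatched1P; split=> // m y mn qmy.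
  by apply: no; exists m, y.
exists m, y; split=> //; have [_ _ + _] := qmy; apply.
  by case: pnx => _ /(unmatched2_le (ltnW mn)).
move=> xy; apply: qNp; apply: (matched_inj (phi := phi) (psi := psi) (x := x)); last by exists n.
by rewrite xy; exists m.
Qed.

End stable_characterization.

Section flower.
Context {R : realType} {d : nat}.
Implicit Types (phi psi A : set 'rV[R]_d) (p q x y z tz a b c : 'rV[R]_d).

(* (a, b) are the last two points of a competing chain of length n + 2 *)
Fixpoint chain_edge phi psi z tz n a b : Prop :=
  if n is n'.+1 then
    exists c, chain_edge phi psi z tz n' c a /\
      (if odd n' then psi b /\ prefersl a b c else phi b /\ prefersr a b c)
  else [/\ a = z, psi b & b = tz \/ prefersl z b tz].

(** Inclusion of the flower of z in A, tested on the ball at z and on the ball at the last point of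
    each chain; every chain ball arises this way because initial pieces of competing chains are
    competing chains. The partner is a parameter, so the condition makes sense without evaluating
    [matching]. *)
Definition flower_within phi psi z tz A : Prop :=
  (forall y, psi y -> y = tz \/ prefersl z y tz -> eball z (enorm (z - y)) `<=` A) /\
  (forall n a b, chain_edge phi psi z tz n a b -> eball b (enorm (b - a)) `<=` A).

Lemma le_eball z (r s : R) : r <= s -> eball z r `<=` eball z s.
Proof. by move=> rs x; rewrite /eball /= => /le_trans; apply. Qed.

(* Competing chains of q can be prolonged to competing chains of p. *)
Lemma flower_within_blockl phi psi p x q y A :
  flower_within phi psi p x A -> phi q -> psi y ->
  prefersl p y x -> prefersr y q p -> flower_within phi psi q y A.
Proof.
move=> [_ F] phiq psiy pyx yqp.
have e0 : chain_edge phi psi p x 0 p y by split=> //; right.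
have e1 : chain_edge phi psi p x 1 y q by exists p.
have Fq : eball q (enorm (q - y)) `<=` A by exact: F e1.
have Fy : eball y (enorm (y - q)) `<=` A.
  apply: subset_trans (F _ _ _ e0); apply: le_eball.
  by rewrite enorm_distC (enorm_distC y p) prefersr_le.
split=> [w psiw wy|k a b].
  apply: subset_trans Fq; apply: le_eball; rewrite enorm_distC (enorm_distC q y).
  by case: wy => [->//|/prefersl_le].
(* A chain of q avoiding y as its second point is prefixed by (p, y). A chain (q, y, b, ...) cannot
   be, since q would have to prefer y to itself; it becomes (p, y, b, ...), because y prefers b to q
   and q to p. Both changes preserve parity. *)
suff H : chain_edge phi psi q y k a b -> [/\ k = 0%N, a = q & b = y] \/
    exists2 k', odd k' = odd k & chain_edge phi psi p x k' a b.
  by move=> /H[[_ -> ->]//|[k' _ /F]].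
elim: k a b => [|k IH] a b /=.
  move=> [-> psib [->|qby]]; first by left.
  by right; exists 2%N => //; exists y; split.
move=> [c [/IH[[-> -> ->]/= [phib ybq]|[k' okk' ek'] H]]].
  right; exists 1%N => //; exists p; split=> //=; split=> //.
  exact: prefersr_trans yqp.
right; exists k'.+1; rewrite /= ?okk'//.
by exists c.
Qed.

(** Every competing chain of q can be prefixed by (p, x): x prefers q to p, and q prefers the second
    point of its chain to x. *)
Lemma flower_within_blockr phi psi p x q y A :
  flower_within phi psi p x A -> phi q -> psi x ->
  prefersr x q p -> prefersl q y x -> flower_within phi psi q y A.
Proof.
move=> [_ F] phiq psix xqp qyx.
have e0 : chain_edge phi psi p x 0 p x by split=> //; left.
have e1 : chain_edge phi psi p x 1 x q by exists p.
have qwx w : w = y \/ prefersl q w y -> prefersl q w x.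
  by move=> [->//|/prefersl_trans]; apply.
split=> [w psiw /qwx qw|k a b].
  apply: subset_trans (F _ _ _ e1); apply: le_eball.
  by rewrite enorm_distC (enorm_distC q x) prefersl_le.
suff H : chain_edge phi psi q y k a b -> chain_edge phi psi p x k.+2 a b by move/H/F.
elim: k a b => [|k IH] a b; first by move=> [-> psib /qwx qb]; exists x.
by move=> [c [/IH ec H]]; exists c; split=> //=; rewrite negbK.
Qed.

Lemma flower_sub_region phi psi z tz A : psi tz -> flower_within phi psi z tz A ->
  eball z (enorm (z - tz)) `<=` A.
Proof. by move=> psitz [+ _]; apply => //; left. Qed.

Section locality.
Variables (phi psi psi' A : set 'rV[R]_d).
Hypotheses (lfphi : locally_finite phi) (lfpsi' : locally_finite psi').
Hypothesis agree : forall x, A x -> psi x <-> psi' x.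

(** The next point of a chain is no farther from its current end than the previous point, so it lies
    in a flower ball and hence in A, where psi and psi' agree. Thus psi' creates no new chains. *)
Lemma chain_edge_local z tz n a b : psi tz -> flower_within phi psi z tz A ->
  chain_edge phi psi' z tz n a b -> chain_edge phi psi z tz n a b.
Proof.
move=> psitz F; have Fz := flower_sub_region psitz F; case: F => _ F.
elim: n a b => [|n IH] a b.
  move=> [-> psib btz]; split=> //; apply/agree => //; apply: Fz.
  rewrite /eball /= (enorm_distC z).
  by case: btz => [->//|/prefersl_le].
move=> [c [/IH ec H]]; exists c; split=> //; case: (odd n) H => // -[psib abc].
split=> //; apply/agree => //; apply: F ec _ _.
by rewrite /eball /= (enorm_distC a); exact: prefersl_le.
Qed.

Lemma flower_within_local z tz : psi tz -> flower_within phi psi z tz A ->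
  flower_within phi psi' z tz A.
Proof.
move=> psitz F; split=> [y psiy ytz|n a b /(chain_edge_local psitz F)]; last first.
  exact: F.2.
apply: subset_trans (flower_sub_region psitz F); apply: le_eball.
rewrite enorm_distC (enorm_distC z tz).
by case: ytz => [->//|/prefersl_le].
Qed.

(** Induction on the stage. A point that p or x would prefer was matched at an earlier stage, and
    the flower of the lattice-side point of that pair again lies in A by [flower_within_blockl] and
    [flower_within_blockr]. So that pair is matched in psi' too, and [matched_intro] applies. *)
Lemma matched_local z tz : matched phi psi z tz -> flower_within phi psi z tz A ->
  matched phi psi' z tz.
Proof.
move=> [n]; elim/ltn_ind: n z tz => n IH p x pnx F.
have px : matched phi psi p x by exists n.
have [phip psix] : phi p /\ psi x by split; [exact: matched_phi px|exact: matched_psi px].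
have FA := flower_sub_region psix F.
have psi'P y : prefersl p y x \/ y = x -> psi' y -> psi y.
  move=> yx psi'y; apply/agree => //; apply: FA.
  by rewrite /eball /= (enorm_distC p); case: yx => [/prefersl_le|->].
apply: matched_intro => //.
- apply/agree => //; apply: FA; rewrite /eball /= enorm_distC //.
- move=> y psi'y pyx; have psiy : psi y by apply: psi'P => //; left.
  have [m [q [mn qmy yqp]]] := matched_blockl pnx psiy pyx.
  exists q => //; apply: (IH m) => //.
  apply: (flower_within_blockl F) => //.
  by apply: (@matched_phi _ _ phi psi q y); exists m.
- move=> q phiq xqp; have [m [y [mn qmy qyx]]] := matched_blockr pnx phiq xqp.
  exists y => //; apply: (IH m) => //.
  exact: (flower_within_blockr F) qyx.
Qed.

End locality.

End flower.

Section flower_chains.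
Context {R : realType} {d : nat}.
Variables (phi psi : set 'rV[R]_d) (z tz : 'rV[R]_d).

Lemma chain_of_edge n a b : phi z -> chain_edge phi psi z tz n a b ->
  exists c, [/\ competing_chain phi psi z tz n.+2 c, c n.+1 = a & c n.+2 = b].
Proof.
move=> phiz; elim: n a b => [|n IH] a b.
  move=> [-> psib btz]; exists (fun i => if i == 1%N then z else b); split=> //.
  split=> //; split=> // i; first by case: i => [|[|[|]]].
  by rewrite ltnNge; case: ltngtP.
move=> [x [/IH[c [[[_ cmem cdesc] c1 c2] <- <-]] H]].
exists (fun i => if i == n.+3 then b else c i); split.
- split=> //; split=> // i.
    move=> /andP[i0]; rewrite leq_eqVlt => /predU1P[->|i3].
      by rewrite eqxx /= negbK; move: H; case: (odd n) => -[].
    by rewrite (ltn_eqF i3); apply: cmem; rewrite i0.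
  move=> /andP[i2]; rewrite leq_eqVlt => /predU1P[->|i3].
    by rewrite /= eqxx !ltn_eqF//= negbK; move: H; case: (odd n) => -[].
  rewrite [i == _]ltn_eqF ?[i.+1 == _]ltn_eqF ?[i.-1 == _]ltn_eqF//; last 2 first.
  - by rewrite (leq_ltn_trans (leq_pred _))// ltnW.
  - exact: ltnW.
  by apply: cdesc; rewrite i2.
- by rewrite ltn_eqF.
- by rewrite eqxx.
Qed.

Lemma edge_of_chain N c n : competing_chain phi psi z tz N c -> (n.+2 <= N)%N ->
  chain_edge phi psi z tz n (c n.+1) (c n.+2).
Proof.
move=> [[N2 cmem cdesc] c1 c2]; elim: n => [|n IH] nN.
  by split=> //; exact: (cmem 2%N).
exists (c n.+1); split; first exact/IH/ltnW.
have := cmem n.+3; rewrite nN /= negbK => /(_ isT).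
have := cdesc n.+2; rewrite /= negbK; case: N nN {N2 cmem cdesc IH} => //= N nN.
by move=> /(_ nN); case: (odd n).
Qed.

End flower_chains.

(** An unmatched z has flower [setT]; excluding A = [setT] makes the inclusion force the existence
    of a partner. *)
Lemma matching_flowerP {R : realType} {d : nat} (phi psi A : set 'rV[R]_d) z :
  phi z -> A <> setT ->
  matching_flower phi psi z `<=` A <->
  exists2 tz, matched phi psi z tz & flower_within phi psi z tz A.
Proof.
move=> phiz AT; rewrite /matching_flower.
case E : (matching phi psi z) => [tz|]; last first.
  split=> [TA|[tz /(matching_lP _ _ phiz)]]; last by rewrite E.
  by case: AT; apply/seteqP; split.
move/(matching_lP _ _ phiz) : E => ztz.
split=> [FA|[tz' /(matched_fun ztz) <- [F1 F2]] u [n [c [cc]]]].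
  exists tz => //; split=> [y psiy ytz|n a b].
    have e : chain_edge phi psi z tz 0 z y by split.
    have [c [cc c1 c2]] := chain_of_edge phiz e.
    apply: subset_trans FA => u uz; exists 2%N, c; split=> //.
    by left; rewrite c1 c2.
  move=> /(chain_of_edge phiz)[c [cc c1 c2]].
  apply: subset_trans FA => u ub; exists n.+2, c; split=> //.
  by right; exists n.+2 => //=; rewrite c1 c2.
have [[n2 cmem _] c1 c2] := cc.
move=> [|[[|[|i]]//= ilen]].
  rewrite c1; apply: F1 => //; exact: (cmem 2%N).
by apply: F2; apply: edge_of_chain cc _.
Qed.

(** * Translation covariance of the matching and of the flower *)

Section shift.
Context {R : realType} {d : nat}.
Implicit Types (p q x y z v : 'rV[R]_d) (A B : set 'rV[R]_d).

(** A' = A + v in pointwise form. It inverts through [shiftedN], so one implication often yields the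
    other by shifting back. *)
Definition shifted v A A' := forall x, A' (x + v) <-> A x.

Lemma shiftedN v A A' : shifted v A A' -> shifted (- v) A' A.
Proof. by move=> s x; rewrite -s subrK. Qed.

Let shiftB v x y : x + v - (y + v) = x - y.
Proof. by rewrite opprD addrACA subrr addr0. Qed.

Lemma lexlt_shift v x y : lexlt (x + v) (y + v) <-> lexlt x y.
Proof.
split=> -[i [xyi e]]; exists i; split=> [|j /e]; move: xyi; rewrite !mxE ?ltrD2r//.
  by move=> _ /addIr.
by move=> _ ->.
Qed.

Lemma prefersl_shift v p x y : prefersl (p + v) (x + v) (y + v) <-> prefersl p x y.
Proof. by rewrite /prefersl !shiftB; have := lexlt_shift v x y; tauto. Qed.

Lemma prefersr_shift v x p q : prefersr (x + v) (p + v) (q + v) <-> prefersr x p q.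
Proof. by rewrite /prefersr !shiftB; have := lexlt_shift v q p; tauto. Qed.

Lemma mutual_nearest_shift v A A' B B' p x : shifted v A A' -> shifted v B B' ->
  mutual_nearest A' B' (p + v) (x + v) <-> mutual_nearest A B p x.
Proof.
move=> sA sB.
suff W w C C' D D' q y : shifted w C C' -> shifted w D D' ->
    mutual_nearest C D q y -> mutual_nearest C' D' (q + w) (y + w).
  split; last exact: W.
  by rewrite -{2}[p](addrK v) -{2}[x](addrK v); apply: W; exact: shiftedN.
move=> sC sD [Cq Dy ymin qmin]; split; [exact/sC|exact/sD| |].
  move=> u; rewrite -[u](subrK w) => /sD Du uy; apply/prefersl_shift.
  by apply: ymin => // uy'; apply: uy; rewrite uy'.
move=> u; rewrite -[u](subrK w) => /sC Cu uq; apply/prefersr_shift.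
by apply: qmin => // uq'; apply: uq; rewrite uq'.
Qed.

Section shifted_matching.
Variables (v : 'rV[R]_d) (phi phi' psi psi' : set 'rV[R]_d).
Hypotheses (sphi : shifted v phi phi') (spsi : shifted v psi psi').

Lemma unmatched_shift n :
  shifted v (unmatched phi psi n).1 (unmatched phi' psi' n).1 /\
  shifted v (unmatched phi psi n).2 (unmatched phi' psi' n).2.
Proof.
elim: n => [//|n [IH1 IH2]].
split=> x; [rewrite !unmatched1S|rewrite !unmatched2S].
- suff -> : (exists y, matched_at phi' psi' n (x + v) y) <-> exists y, matched_at phi psi n x y.
    by rewrite (IH1 x).
  split=> -[y H]; last by exists (y + v); apply/mutual_nearest_shift; eassumption.
  exists (y - v); move: H; rewrite -{1}[y](subrK v) => H.
  by apply/(mutual_nearest_shift x (y - v) IH1 IH2).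
- suff -> : (exists y, matched_at phi' psi' n y (x + v)) <-> exists y, matched_at phi psi n y x.
    by rewrite (IH2 x).
  split=> -[y H]; last by exists (y + v); apply/mutual_nearest_shift; eassumption.
  exists (y - v); move: H; rewrite -{1}[y](subrK v) => H.
  by apply/(mutual_nearest_shift (y - v) x IH1 IH2).
Qed.

Lemma matched_shift p x :
  matched phi' psi' (p + v) (x + v) <-> matched phi psi p x.
Proof.
by split=> -[n H]; exists n; have [s1 s2] := unmatched_shift n;
  apply/(mutual_nearest_shift p x s1 s2).
Qed.

Lemma chain_edge_shift z tz n a b :
  chain_edge phi' psi' (z + v) (tz + v) n (a + v) (b + v) <->
  chain_edge phi psi z tz n a b.
Proof.
elim: n a b => [|n IH] a b /=.
  split=> -[az psib H]; split.
  - exact: addIr az.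
  - exact/spsi.
  - by case: H => [/addIr|/prefersl_shift]; tauto.
  - by rewrite az.
  - exact/spsi.
  - by case: H => [->|/prefersl_shift-/(_ v)]; tauto.
split=> -[c [ec H]].
- exists (c - v); move: ec; rewrite -{1}[c](subrK v) => ec; split; first exact/IH.
  case: (odd n) H => -[bb H]; split; try exact/spsi; try exact/sphi.
  + by move: H; rewrite -{1}[c](subrK v) => /prefersl_shift.
  + by move: H; rewrite -{1}[c](subrK v) => /prefersr_shift.
- exists (c + v); split; first exact/IH.
  case: (odd n) H => -[bb H]; split; try exact/spsi; try exact/sphi.
  + exact/prefersl_shift.
  + exact/prefersr_shift.
Qed.

Lemma flower_within_shift z tz A A' : shifted v A A' ->
  flower_within phi psi z tz A -> flower_within phi' psi' (z + v) (tz + v) A'.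
Proof.
move=> sA [F1 F2]; have sB b r : eball b r `<=` A -> eball (b + v) r `<=` A'.
  move=> bA x; rewrite -[x](subrK v) /eball /= shiftB => xb.
  exact/sA/bA.
split=> [y|n a b].
  rewrite -[y](subrK v) => /spsi psiy yz; rewrite shiftB; apply/sB/F1 => //.
  by case: yz => [/addIr|/prefersl_shift]; tauto.
rewrite -[a](subrK v) -[b](subrK v) => /chain_edge_shift /F2 ba.
by rewrite shiftB; apply: sB.
Qed.

End shifted_matching.

End shift.

(** * Counting lattice points *)

Lemma count_le_card (T : eqType) (U : finType) (p : pred T) (s : seq T) (f : T -> U) :
  uniq s -> {in [seq x <- s | p x] &, injective f} -> (count p s <= #|U|)%N.
Proof.
move=> us finj; rewrite -size_filter -(size_map f).
have /card_uniqP <- : uniq (map f [seq x <- s | p x]).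
  by rewrite map_inj_in_uniq// filter_uniq.
exact: max_card.
Qed.

Lemma count_le_sum (T : Type) (I : finType) (p : pred T) (q : I -> pred T) (s : seq T) :
  (forall z, p z -> exists i, q i z) -> (count p s <= \sum_i count (q i) s)%N.
Proof.
move=> pq; elim: s => [|z s IH]; first by rewrite /= .
rewrite /= big_split leq_add//=; case: (boolP (p z)) => // /pq[i qi].
by rewrite (bigD1 i)//= qi.
Qed.

Section lattice_points.
Context {R : realType} {d : nat}.
Notation L := (integer_lattice R d).
Implicit Types (z y : 'rV[R]_d) (s : seq 'rV[R]_d).

Lemma latticeD z y : L z -> L y -> L (z + y).
Proof. by move=> Lz Ly i; rewrite mxE rpredD. Qed.

Lemma latticeN z : L z -> L (- z).
Proof. by move=> Lz i; rewrite mxE rpredN. Qed.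

Lemma lattice0 : L 0.
Proof. by move=> i; rewrite mxE rpred0. Qed.

Lemma latticeMn z n : L z -> L (n%:R *: z).
Proof. by move=> Lz i; rewrite mxE rpredM// natr_int. Qed.

Lemma int_eq_truncn (a b c : R) : a \is a Num.int -> b \is a Num.int ->
  0 <= a - c -> 0 <= b - c -> Num.truncn (a - c) = Num.truncn (b - c) -> a = b.
Proof.
move=> aI bI ac bc E.
have /andP[] := truncn_itv ac; rewrite E => a1 a2.
have /andP[b1 b2] := truncn_itv bc.
have : `|a - b| < 1 by rewrite ltr_norml -!natr1 in a2 b2 *; apply/andP; split; lra.
apply: contraTeq => ab; rewrite -leNgt norm_intr_ge1 ?rpredB//.
by rewrite subr_eq0.
Qed.

(* Each coordinate is confined to an interval; the base point of the k-th one
   may depend on the other coordinates. *)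
Lemma lattice_count s (p : pred 'rV[R]_d) (m : 'I_d -> nat)
    (b : 'I_d -> 'rV[R]_d -> R) (k : 'I_d) :
  uniq s -> (forall z, z \in s -> L z) ->
  (forall z j, z \in s -> p z -> 0 <= z ord0 j - b j z < (m j).+1%:R) ->
  (forall z z' j, z \in s -> z' \in s -> p z -> p z' -> j != k -> b j z = b j z') ->
  (forall z z', z \in s -> z' \in s -> p z -> p z' ->
    (forall j, j != k -> z ord0 j = z' ord0 j) -> b k z = b k z') ->
  (count p s <= \prod_j (m j).+1)%N.
Proof.
move=> us sL H1 H2 H3.
pose f z : {dffun forall j, 'I_(m j).+1} :=
  [ffun j => inord (Num.truncn (z ord0 j - b j z))].
have /(count_le_card us) : {in [seq x <- s | p x] &, injective f}.
  move=> z z'; rewrite !mem_filter => /andP[pz zs] /andP[pz' zs'] ff.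
  have fE j : Num.truncn (z ord0 j - b j z) = Num.truncn (z' ord0 j - b j z').
    have := congr1 (fun g : {dffun forall j, 'I_(m j).+1} => val (g j)) ff.
    have /andP[l u] := H1 z j zs pz; have /andP[l' u'] := H1 z' j zs' pz'.
    by rewrite !ffunE /= !inordK ?truncn_lt_nat.
  have zE j : b j z = b j z' -> z ord0 j = z' ord0 j.
    have /andP[l _] := H1 z j zs pz; have /andP[l' _] := H1 z' j zs' pz'.
    move=> bE; apply: (@int_eq_truncn _ _ (b j z)) => //; first exact: sL.
    - exact: sL.
    - by rewrite bE.
    - by rewrite fE bE.
  have offk j : j != k -> z ord0 j = z' ord0 j by move=> jk; apply: zE; exact: H2.
  apply/rowP => j; have [->|/offk//] := eqVneq j k.
  exact/zE/H3.
by rewrite card_dep_ffun foldrE big_image /=; under eq_bigr do rewrite card_ord.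
Qed.

Lemma truncn1_le (x : R) : 0 <= x -> (Num.truncn x).+1%:R <= x + 1.
Proof. by move=> x0; rewrite -natr1 lerD2r; case/andP: (truncn_itv x0). Qed.

Lemma box_lattice_count s y (Q : R) : (0 < d)%N -> 0 <= Q ->
  uniq s -> (forall z, z \in s -> L z) ->
  (count (fun z => `[< box Q (z + y) >]) s)%:R <= (2 * Q + 1) ^+ d.
Proof.
move=> d0 Q0 us sL.
have Q2 : 0 <= 2 * Q by rewrite mulr_ge0.
have H : forall z j, z \in s -> `[< box Q (z + y) >] ->
    0 <= z ord0 j - (- Q - y ord0 j) < (Num.truncn (2 * Q)).+1%:R.
  move=> z j _ /asboolP /(_ j); rewrite mxE ler_norml => /andP[l u].
  have /andP[_] := truncn_itv Q2; rewrite -natr1 => v.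
  by apply/andP; split; lra.
have := @lattice_count s _ (fun=> Num.truncn (2 * Q))
  (fun j _ => - Q - y ord0 j) (Ordinal d0) us sL H (fun _ _ _ _ _ _ _ _ => erefl)
  (fun _ _ _ _ _ _ _ => erefl).
rewrite prod_nat_const card_ord -(ler_nat R) => /le_trans; apply.
by rewrite natrX lerXn2r ?nnegrE ?addr_ge0// truncn1_le.
Qed.

Definition segment_closed (K : set 'rV[R]_d) := forall x y (t : R), 0 <= t <= 1 ->
  K x -> K y -> K (t *: x + (1 - t) *: y).

(* On a line in direction e_k the set K is a segment, so at most |c| + 1 of
   its points of a translated lattice leave K when shifted by c. *)
Lemma line_count s (K : set 'rV[R]_d) (a : 'rV[R]_d) (k : 'I_d) (c Q : R) :
  segment_closed K -> K `<=` box Q -> 0 <= Q ->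
  uniq s -> (forall z, z \in s -> L z) ->
  (count (fun z => `[< K (z + a) /\ ~ K (z + a + c *: delta_mx ord0 k) >]) s)%:R
    <= (2 * Q + 1) ^+ d.-1 * (`|c| + 1).
Proof.
move=> cK KQ Q0 us sL; set p := (fun z => _).
have pP z : p z -> K (z + a) /\ ~ K (z + a + c *: delta_mx ord0 k) by move/asboolP.
have Q2 : 0 <= 2 * Q by rewrite mulr_ge0.
have close z z' : p z -> p z' -> (forall j, j != k -> z ord0 j = z' ord0 j) ->
    z ord0 k - z' ord0 k <= `|c|.
  (* If c = t (u'_k - u_k) with t in [0, 1], then u + a + c e_k is a convex combination of u' + a
     and u + a, so it lies in K. A gap larger than |c| between two bad points of a line would make c
     of this form, with the roles of the points chosen by the sign of c. *)
  suff W u u' (t : R) : p u -> p u' -> (forall j, j != k -> u ord0 j = u' ord0 j) ->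
      0 <= t <= 1 -> c <> t * (u' ord0 k - u ord0 k).
    move=> pz pz' zz'; rewrite leNgt; apply/negP => lt.
    have D0 : 0 < z ord0 k - z' ord0 k by rewrite (le_lt_trans _ lt).
    have [c0|c0] := leP 0 c.
      apply: (W z' z (c / (z ord0 k - z' ord0 k))) => //; last by field; rewrite gt_eqF.
      - by move=> j /zz'.
      - by rewrite divr_ge0// ?(ltW D0)//= ler_pdivrMr// mul1r (le_trans (ler_norm _))// ltW.
    apply: (W z z' (- c / (z ord0 k - z' ord0 k))) => //; last by field; rewrite gt_eqF.
    rewrite divr_ge0// ?(ltW D0)//= ?oppr_ge0 ?(ltW c0)//.
    by rewrite ler_pdivrMr// mul1r -(ltr0_norm c0) ltW.
  move=> /pP[Ku nKu] /pP[Ku' _] uu' t01 cE; apply: nKu.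
  suff -> : u + a + c *: delta_mx ord0 k = t *: (u' + a) + (1 - t) *: (u + a).
    exact: cK.
  apply/rowP => j; rewrite !mxE /=.
  have [->|jk] := eqVneq j k; first by rewrite cE ?eqxx /=; ring.
  by rewrite (uu' _ jk) ?(negPf jk) ?andbF /=; ring.
(* The k-th coordinates of the bad points on the line through z. Measured from their infimum, which
   depends on the line only, they lie in [0, |c|]; the other coordinates are measured from the lower
   face of the translated box. *)
pose fib z := [set t | exists2 z', z' \in s /\ p z' &
  (forall j, j != k -> z' ord0 j = z ord0 j) /\ t = z' ord0 k].
pose b (j : 'I_d) z : R := if j == k then inf (fib z) else - Q - a ord0 j.
pose m (j : 'I_d) := Num.truncn (if j == k then `|c| else 2 * Q).
have fibz z : z \in s -> p z -> fib z (z ord0 k) by move=> zs pz; exists z.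
have fib_lb z : p z -> lbound (fib z) (z ord0 k - `|c|).
  move=> pz _ [z' [_ pz'] [zz' ->]].
  by rewrite lerBlDr addrC -lerBlDr close// => j /zz'.
have H1 z j : z \in s -> p z -> 0 <= z ord0 j - b j z < (m j).+1%:R.
  move=> zs pz; rewrite /b /m; case: eqVneq => [->|jk].
    have /andP[_] := truncn_itv (normr_ge0 c); rewrite subr_ge0 => cm.
    have hl : has_lbound (fib z) by exists (z ord0 k - `|c|); exact: fib_lb.
    rewrite (ge_inf hl (fibz z zs pz)) /=.
    apply: le_lt_trans cm; rewrite lerBlDr addrC -lerBlDr lb_le_inf//; last exact: fib_lb.
    by exists (z ord0 k); exact: fibz.
  move: (pz) => /pP[/KQ/(_ j)]; rewrite mxE ler_norml => /andP[l u] _.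
  have /andP[_] := truncn_itv Q2; rewrite -natr1 => v.
  by apply/andP; split; lra.
have H2 z z' j : z \in s -> z' \in s -> p z -> p z' -> j != k -> b j z = b j z'.
  by move=> _ _ _ _ /negPf jk; rewrite /b jk.
have := @lattice_count s p m b k us sL H1 H2.
move=> H; have {H} : (count p s <= \prod_j (m j).+1)%N.
  apply: H => z z' zs z's pz pz' zz'; rewrite /b eqxx; congr inf.
  by apply/seteqP; split=> t [u up [uz ->]]; exists u => //; split=> // j jk;
    rewrite uz// zz'.
rewrite -(ler_nat R) => /le_trans; apply.
rewrite (bigD1 k)//= natrM mulrC ler_pM//; last by rewrite /m eqxx truncn1_le.
rewrite (eq_bigr (fun=> (Num.truncn (2 * Q)).+1)) => [|j /negPf jk]; last by rewrite /m jk.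
rewrite prod_nat_const cardC1 card_ord natrX lerXn2r ?nnegrE ?addr_ge0//.
exact: truncn1_le.
Qed.

(* Pass from z to z + y one coordinate at a time. *)
Lemma symdiff_lattice_count s (K : set 'rV[R]_d) y (Q rho : R) :
  segment_closed K -> K `<=` box Q -> 0 <= Q -> box rho y ->
  uniq s -> (forall z, z \in s -> L z) ->
  (count (fun z => `[< K z >] != `[< K (z + y) >]) s)%:R
    <= d%:R * (2 * ((2 * Q + 1) ^+ d.-1 * (rho + 1))).
Proof.
move=> cK KQ Q0 yrho us sL.
pose a (n : nat) : 'rV[R]_d := \row_j (if (j < n)%N then y ord0 j else 0).
have a0 : a 0%N = 0 by apply/rowP => j; rewrite !mxE.
have ad : a d = y by apply/rowP => j; rewrite !mxE ltn_ord.
have aS (k : 'I_d) : a k.+1 = a k + y ord0 k *: delta_mx ord0 k.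
  apply/rowP => j; rewrite !mxE /= ltnS leq_eqVlt.
  have [->|jk] := eqVneq j k; first by rewrite eqxx ltnn mulr1 add0r.
  by rewrite mulr0 addr0 val_eqE (negPf jk).
pose leave (b : 'rV[R]_d) k (c : R) z := `[< K (z + b) /\ ~ K (z + b + c *: delta_mx ord0 k) >].
(* Membership in K can change in coordinate k in two ways: leaving K under y_k from [a k], or
   entering it, which is leaving under - y_k from [a k.+1]. This gives the factor 2. *)
pose q (k : 'I_d) z := leave (a k) k (y ord0 k) z || leave (a k.+1) k (- y ord0 k) z.
have pq z : `[< K z >] != `[< K (z + y) >] -> exists k, q k z.
  move=> zy; apply/existsP; apply: contraNT zy => /existsPn noq.
  suff W n : (n <= d)%N -> `[< K z >] = `[< K (z + a n) >] by rewrite {1}(W d)// ad.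
  elim: n => [|n IH] nd; first by rewrite a0 addr0.
  rewrite (IH (ltnW nd)); move: (noq (Ordinal nd)); rewrite /q negb_or => /andP[].
  rewrite /leave !aS scaleNr addrA addrK -!addrA -!aS /= => /asboolPn l1 /asboolPn l2.
  by apply/asbool_equiv_eq; split=> ?; apply: contrapT => ?; [apply: l1|apply: l2]; split.
have /(_ s) := count_le_sum _ pq; rewrite -(ler_nat R) => /le_trans; apply.
rewrite natr_sum -[X in X%:R * _]card_ord -sum1_card natr_sum mulr_suml.
apply: ler_sum => k _; rewrite mul1r.
have qU : (count (q k) s <= count (leave (a k) k (y ord0 k)) s +
    count (leave (a k.+1) k (- y ord0 k)) s)%N.
  by rewrite -count_predUI leq_addr.
move: qU; rewrite -(ler_nat R) natrD => /le_trans; apply.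
have Q2 : 0 <= (2 * Q + 1) ^+ d.-1 by rewrite exprn_ge0// addr_ge0// mulr_ge0.
have yk : `|y ord0 k| + 1 <= rho + 1 by rewrite lerD2r; exact: yrho.
rewrite mulr_natl mulr2n lerD// (le_trans (line_count _ _ _ cK KQ Q0 us sL))//.
  by rewrite ler_wpM2l.
by rewrite normrN ler_wpM2l.
Qed.

Lemma finite_lattice_bounded (A : set 'rV[R]_d) : (0 < d)%N -> bounded_set A ->
  finite_set (L `&` A).
Proof.
move=> d0 /bounded_sub_box[Q Q0 AQ]; apply: contrapT => inf.
have [F FA Fn] := infinite_set_fset (Num.truncn ((2 * Q + 1) ^+ d)).+1 inf.
have := @box_lattice_count (finmap.enum_fset F) 0 Q d0 (ltW Q0) (finmap.fset_uniq F).
move=> /(_ (fun z zF => (FA z zF).1)); apply/negP; rewrite -ltNge.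
rewrite (lt_le_trans (truncnS_gt _))// ler_nat (leq_trans Fn)//.
rewrite -(count_predT (finmap.enum_fset F)); apply: eq_leq; apply: eq_in_count => z zF.
by rewrite addr0 asboolT//; apply: AQ; exact: (FA z zF).2.
Qed.

Lemma lattice_locally_finite : (0 < d)%N -> locally_finite L.
Proof. by move=> d0 A; exact: finite_lattice_bounded. Qed.

Lemma countable_lattice : (0 < d)%N -> countable L.
Proof.
move=> d0; rewrite -[X in countable X]setIT -box_exhaust setI_bigcupr.
apply: bigcup_countable => // n _; apply/finite_set_countable.
exact/finite_lattice_bounded/box_bounded.
Qed.

End lattice_points.

(** * Measurability of the matching and of the flower *)

Section measurable_relations.
Context {disp : measure_display} {T : measurableType disp}.

Lemma measurable_preimage d' (U : measurableType d') (f : T -> U) (A : set U) :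
  measurable_fun setT f -> measurable A -> measurable [set t | A (f t)].
Proof. by move=> mf mA; rewrite -[X in measurable X]setTI; exact: mf. Qed.

Lemma measurable_bool_set (b : T -> bool) :
  measurable_fun setT b -> measurable [set t | b t].
Proof. by move=> mb; apply: (measurable_preimage (A := [set true]) mb). Qed.

Lemma measurable_disj (A B : T -> Prop) : measurable [set t | A t] ->
  measurable [set t | B t] -> measurable [set t | A t \/ B t].
Proof. exact: measurableU. Qed.

Lemma measurable_conj (A B : T -> Prop) : measurable [set t | A t] ->
  measurable [set t | B t] -> measurable [set t | A t /\ B t].
Proof. exact: measurableI. Qed.

Lemma measurable_not (A : T -> Prop) : measurable [set t | A t] ->
  measurable [set t | ~ A t].
Proof. exact: measurableC. Qed.

Lemma measurable_cst_prop (Q : Prop) : measurable [set _ : T | Q].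
Proof.
have [q|nq] := pselect Q.
  by rewrite (_ : mkset _ = setT)//; apply/seteqP; split.
by rewrite (_ : mkset _ = set0)//; apply/seteqP; split.
Qed.

Lemma measurable_exists_countable (U : choiceType) (D : set U) (A : U -> T -> Prop) :
  countable D -> (forall u, D u -> measurable [set t | A u t]) ->
  measurable [set t | exists2 u, D u & A u t].
Proof.
move=> cD mA; rewrite (_ : [set t | _] = \bigcup_(u in D) [set t | A u t])//.
have [->|/set0P[r Dr]] := eqVneq D set0; first by rewrite bigcup_set0.
move/countable_injP : cD => [f injf].
rewrite -(injpinv_image (cst r) injf) bigcup_image.
by apply: bigcup_measurable => _ /= [u Du <-]; rewrite pinvKV ?inE//; exact: mA.
Qed.

Lemma measurable_forall_countable (U : choiceType) (D : set U) (A : U -> T -> Prop) :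
  countable D -> (forall u, D u -> measurable [set t | A u t]) ->
  measurable [set t | forall u, D u -> A u t].
Proof.
move=> cD mA.
rewrite (_ : [set t | _] = [set t | ~ exists2 u, D u & ~ A u t]); last first.
  apply/seteqP; split=> t /= H; first by move=> [u /H].
  by move=> u Du; apply: contrapT => nA; apply: H; exists u.
apply/measurable_not/measurable_exists_countable => // u Du.
exact/measurable_not/mA.
Qed.

Lemma measurable_exists_nat (A : nat -> T -> Prop) :
  (forall n, measurable [set t | A n t]) -> measurable [set t | exists n, A n t].
Proof.
move=> mA; rewrite (_ : [set t | _] = \bigcup_n [set t | A n t]); first exact: bigcupT_measurable.
by apply/seteqP; split=> t [n]; exists n.
Qed.

Context {R : realType} {d : nat}.
Implicit Types f g h : T -> 'rV[R]_d.

Lemma measurable_coord_fun f i : measurable_fun setT f ->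
  measurable_fun setT (fun t => f t ord0 i).
Proof. by move=> mf; apply: (measurableT_comp (measurable_coord i)). Qed.

Lemma measurable_enorm_dist f g : measurable_fun setT f -> measurable_fun setT g ->
  measurable_fun setT (fun t => enorm (f t - g t)).
Proof.
move=> mf mg; apply: (measurableT_comp (continuous_measurable_fun (@sqrt_continuous R))).
apply: measurable_sum => i.
rewrite (_ : (fun t => _) = fun t => (f t ord0 i - g t ord0 i) ^+ 2); last first.
  by apply/funext => t; rewrite !mxE.
by apply: measurable_funX; apply: measurable_funB; exact: measurable_coord_fun.
Qed.

Lemma measurable_lexlt f g : measurable_fun setT f -> measurable_fun setT g ->
  measurable [set t | lexlt (f t) (g t)].
Proof.
move=> mf mg.
rewrite (_ : [set t | _] = \bigcup_(i in [set: 'I_d])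
   ([set t | f t ord0 i < g t ord0 i] `&`
    \bigcap_(j in [set j : 'I_d | (j < i)%N]) [set t | f t ord0 j == g t ord0 j])); last first.
  apply/seteqP; split=> t [i]; first by move=> [fg e]; exists i => //; split => // j /e /eqP.
  by move=> _ [fg e]; exists i; split => // j /e /eqP.
apply: fin_bigcup_measurable => // i _; apply: measurableI.
  by apply: measurable_bool_set; apply: measurable_fun_ltr; exact: measurable_coord_fun.
apply: fin_bigcap_measurable => // j _.
by apply: measurable_bool_set; apply: measurable_fun_eqr; exact: measurable_coord_fun.
Qed.

Lemma measurable_prefersl f g h : measurable_fun setT f -> measurable_fun setT g ->
  measurable_fun setT h -> measurable [set t | prefersl (f t) (g t) (h t)].
Proof.
move=> mf mg mh; apply: measurable_disj.
  by apply: measurable_bool_set; apply: measurable_fun_ltr; exact: measurable_enorm_dist.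
apply: measurable_conj; last exact: measurable_lexlt.
rewrite (_ : mkset _ = [set t | enorm (g t - f t) == enorm (h t - f t)]).
  by apply: measurable_bool_set; apply: measurable_fun_eqr; exact: measurable_enorm_dist.
by apply/seteqP; split=> t /eqP.
Qed.

Lemma measurable_prefersr f g h : measurable_fun setT f -> measurable_fun setT g ->
  measurable_fun setT h -> measurable [set t | prefersr (f t) (g t) (h t)].
Proof.
move=> mf mg mh; apply: measurable_disj.
  by apply: measurable_bool_set; apply: measurable_fun_ltr; exact: measurable_enorm_dist.
apply: measurable_conj; last exact: measurable_lexlt.
rewrite (_ : mkset _ = [set t | enorm (g t - f t) == enorm (h t - f t)]).
  by apply: measurable_bool_set; apply: measurable_fun_eqr; exact: measurable_enorm_dist.
by apply/seteqP; split=> t /eqP.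
Qed.

Lemma measurable_eq_rV f g : measurable_fun setT f -> measurable_fun setT g ->
  measurable [set t | f t = g t].
Proof.
move=> mf mg; rewrite (_ : mkset _ = \bigcap_(i in [set: 'I_d]) [set t | f t ord0 i == g t ord0 i]).
  apply: fin_bigcap_measurable => // j _.
  by apply: measurable_bool_set; apply: measurable_fun_eqr; exact: measurable_coord_fun.
apply/seteqP; split=> t /= H; first by move=> i _ /=; rewrite H.
by apply/rowP => i; apply/eqP; exact: (H i).
Qed.

End measurable_relations.

Lemma chain_edge_left {R : realType} {d : nat} (phi psi : set 'rV[R]_d) z tz n a b :
  phi z -> chain_edge phi psi z tz n a b -> if odd n then psi a else phi a.
Proof.
move=> phiz; case: n => [[->]//|n /= [c [ec _]]].
case: n ec => [[_ //]|n /= [e [_]]].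
by case: (odd n) => -[].
Qed.

Section measurable_matching.
Context {R : realType} {d : nat}.
Hypothesis d_gt0 : (0 < d)%N.
Notation L := (integer_lattice R d).
Notation N := (configuration R d).

Lemma measurable_points_pair : measurable [set u : N * 'rV[R]_d | points u.1 u.2].
Proof.
rewrite (_ : mkset _ = [set u : N * 'rV[R]_d | exists2 y, points u.1 y & u.2 = y]); last first.
  by apply/seteqP; split=> u /= => [?|[y ? ->]//]; exists u.2.
apply: (measurable_exists_point measurable_fst
  (E := [set w : N * 'rV[R]_d * 'rV[R]_d | w.1.2 = w.2])) => //.
apply: measurable_eq_rV => //.
exact: measurableT_comp.
Qed.

(** Lattice points are fixed parameters and points of the configuration are variables of a product
    space. Universal statements are rewritten as negated existential ones, to which
    [measurable_exists_point] applies. *)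
Lemma measurable_matched_at n :
  (forall p, L p -> measurable [set phi : N | (unmatched L phi n).1 p]) ->
  measurable [set u : N * 'rV[R]_d | (unmatched L u.1 n).2 u.2] ->
  forall p, L p -> measurable [set u : N * 'rV[R]_d | matched_at L u.1 n p u.2].
Proof.
move=> mA mB p Lp.
have mA1 q : L q -> measurable [set u : N * 'rV[R]_d | (unmatched L u.1 n).1 q].
  move=> Lq; apply: (measurable_preimage (f := fst)
    (A := [set phi : N | (unmatched L phi n).1 q])) => //.
  exact: mA.
rewrite (_ : mkset _ = [set u : N * 'rV[R]_d | (unmatched L u.1 n).1 p /\
   ((unmatched L u.1 n).2 u.2 /\
   ((~ exists2 y, points u.1 y &
       ((unmatched L u.1 n).2 y /\ (~ (y = u.2) /\ ~ prefersl p u.2 y))) /\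
    (forall q, L q ->
       ~ ((unmatched L u.1 n).1 q /\ (~ (q = p) /\ ~ prefersr u.2 p q)))))]); last first.
  apply/seteqP; split=> u /= [H1 H2].
    move=> H3 H4; split=> //; split=> //; split.
      by move=> [y _ [By [yu]]]; apply; exact: H3.
    by move=> q _ [Aq [qp]]; apply; exact: H4.
  case: H2 => H2 [H3 H4]; split=> // [y By yu|q Aq qp]; apply: contrapT => npref.
    by apply: H3; exists y => //; case/unmatched2P : By.
  by apply: (H4 q) => //; case/unmatched1P : Aq.
apply: measurable_conj; first exact: mA1.
apply: measurable_conj => //; apply: measurable_conj.
  apply: measurable_not.
  apply: (measurable_exists_point measurable_fst (E := [set w : N * 'rV[R]_d * 'rV[R]_d |
    (unmatched L w.1.1 n).2 w.2 /\ (~ (w.2 = w.1.2) /\ ~ prefersl p w.1.2 w.2)])) => //.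
  have m12 : measurable_fun [set: N * 'rV[R]_d * 'rV[R]_d] (fun w => w.1.2).
    exact: measurableT_comp.
  have m11 : measurable_fun [set: N * 'rV[R]_d * 'rV[R]_d] (fun w => w.1.1).
    exact: measurableT_comp.
  apply: measurable_conj; last apply: measurable_conj; try apply: measurable_not.
  - apply: (measurable_preimage (f := fun w : N * 'rV[R]_d * 'rV[R]_d => (w.1.1, w.2)) _ mB).
    exact: measurable_fun_pair.
  - exact: measurable_eq_rV.
  - exact: measurable_prefersl.
apply: measurable_forall_countable; first exact: countable_lattice.
move=> q Lq; apply/measurable_not/measurable_conj; first exact: mA1.
apply: measurable_conj; first exact: measurable_cst_prop.
exact/measurable_not/measurable_prefersr.
Qed.

Lemma measurable_unmatched n :
  (forall p, L p -> measurable [set phi : N | (unmatched L phi n).1 p]) /\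
  measurable [set u : N * 'rV[R]_d | (unmatched L u.1 n).2 u.2].
Proof.
elim: n => [|n [mA mB]].
  split=> [p Lp|]; last exact: measurable_points_pair.
  by rewrite (_ : mkset _ = setT)//; apply/seteqP; split.
have mM := measurable_matched_at mA mB; split=> [p Lp|].
  rewrite (_ : mkset _ = [set phi : N | (unmatched L phi n).1 p /\
     ~ exists2 x, points phi x & matched_at L phi n p x]); last first.
    apply/seteqP; split=> phi /=; rewrite unmatched1S => -[Ap no]; split=> //.
      by move=> [x _ ?]; apply: no; exists x.
    move=> [x px]; apply: no; exists x => //; apply: (@matched_psi _ _ L _ p); by exists n.
  apply: measurable_conj; first exact: mA.
  apply: measurable_not; apply: (measurable_exists_point (@measurable_id _ N setT)
    (E := [set u : N * 'rV[R]_d | matched_at L u.1 n p u.2])) => //.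
  exact: mM.
rewrite (_ : mkset _ = [set u : N * 'rV[R]_d | (unmatched L u.1 n).2 u.2 /\
   ~ exists2 p, L p & matched_at L u.1 n p u.2]); last first.
  apply/seteqP; split=> u /=; rewrite unmatched2S => -[Ap no]; split=> //.
    by move=> [x _ ?]; apply: no; exists x.
  move=> [p px]; apply: no; exists p => //; apply: (@matched_phi _ _ L u.1 p u.2); by exists n.
apply: measurable_conj => //; apply/measurable_not/measurable_exists_countable => //.
exact: countable_lattice.
Qed.

Lemma measurable_matched p : L p ->
  measurable [set u : N * 'rV[R]_d | matched L u.1 p u.2].
Proof.
move=> Lp; apply: measurable_exists_nat => n.
by have [mA mB] := measurable_unmatched n; exact: measurable_matched_at.
Qed.

Lemma npoints_matched_points (phi : N) B : npoints (matched_points L phi) B =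
  npoints phi [set x | B x /\ exists2 p, L p & matched L phi p x].
Proof.
rewrite /npoints; congr counting; apply/seteqP; split=> x /=.
  move=> [[phix /(matching_rP _ phix)[p px]] Bx]; split=> //; split=> //.
  by exists p => //; exact: matched_phi px.
by move=> [phix [Bx [p _ px]]]; split=> //; split=> //; apply/(matching_rP _ phix); exists p.
Qed.

Lemma measurable_matched_points : measurable_fun setT (fun phi : N => matched_points L phi).
Proof.
apply: (measurability [set E : set N | exists B : set 'rV[R]_d, exists Y : set (\bar R),
   [/\ measurable B, measurable Y & E = (fun phi : N => npoints phi B) @^-1` Y]] erefl).
move=> _ [_ [B [Y [mB mY ->]]] <-].
rewrite setTI -comp_preimage.
rewrite (_ : _ \o _ = fun phi : N => npoints phi [set x | [set u : N * 'rV[R]_d |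
    B u.2 /\ exists2 p, L p & matched L u.1 p u.2] (phi, x)]); last first.
  by apply/funext => phi /=; rewrite npoints_matched_points.
rewrite -[X in measurable X]setTI.
apply: (measurable_npoints_section (@measurable_id _ N setT)) => //.
apply: measurable_conj; first exact: (measurable_preimage (f := snd)).
apply: measurable_exists_countable; first exact: countable_lattice.
exact: measurable_matched.
Qed.

End measurable_matching.

Section measurable_flower.
Context {R : realType} {d : nat}.
Hypothesis d_gt0 : (0 < d)%N.
Notation L := (integer_lattice R d).
Notation N := (configuration R d).
Variable z : 'rV[R]_d.
Hypothesis Lz : L z.

(* lattice end point p, configuration end point y, in the order given by the
   parity of n *)
Definition bipartite_edge (phi : N) (tz : 'rV[R]_d) n p y : Prop :=
  if odd n then chain_edge L phi z tz n y p else chain_edge L phi z tz n p y.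

Lemma bipartite_edge_points phi tz n p y : bipartite_edge phi tz n p y ->
  L p /\ points phi y.
Proof.
rewrite /bipartite_edge; case on : (odd n) => e.
  have := chain_edge_left Lz e; rewrite on => phiy; split=> //.
  case: n on e => [//|n] /= on [c [_]]; move/negbTE: on => ->.
  by case.
have := chain_edge_left Lz e; rewrite on => Lp; split=> //.
case: n on e => [_ []//|n] /= on [c [_]]; move/negbFE: on => ->.
by case.
Qed.

Lemma measurable_bipartite_edge n p : L p ->
  measurable [set u : (N * 'rV[R]_d) * 'rV[R]_d | bipartite_edge u.1.1 u.1.2 n p u.2].
Proof.
have m12 : measurable_fun [set: N * 'rV[R]_d * 'rV[R]_d] (fun w => w.1.2).
  exact: measurableT_comp.
have m11 : measurable_fun [set: N * 'rV[R]_d * 'rV[R]_d] (fun w => w.1.1).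
  exact: measurableT_comp.
elim: n p => [|n IH] p Lp.
  rewrite (_ : mkset _ = [set u : (N * 'rV[R]_d) * 'rV[R]_d |
      p = z /\ (points u.1.1 u.2 /\ (u.2 = u.1.2 \/ prefersl z u.2 u.1.2))]); last first.
    by apply/seteqP; split=> u /=; rewrite /bipartite_edge /=; [case|case=> ? []].
  apply: measurable_conj; first exact: measurable_cst_prop.
  apply: measurable_conj.
    apply: (measurable_preimage (f := fun w : N * 'rV[R]_d * 'rV[R]_d => (w.1.1, w.2)) _
      measurable_points_pair).
    exact: measurable_fun_pair.
  by apply: measurable_disj; [exact: measurable_eq_rV|exact: measurable_prefersl].
have [on|en] := boolP (odd n).
  rewrite (_ : mkset _ = [set u : (N * 'rV[R]_d) * 'rV[R]_d | exists2 c, points u.1.1 c &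
      (bipartite_edge u.1.1 u.1.2 n p c /\
       (points u.1.1 u.2 /\ prefersl p u.2 c))]); last first.
    apply/seteqP; split=> u /=.
      rewrite {1}/bipartite_edge /= on /= => -[c [ec H]].
      have e : bipartite_edge u.1.1 u.1.2 n p c by rewrite /bipartite_edge on.
      by exists c => //; case: (bipartite_edge_points e).
    move=> [c _ [ec H]]; rewrite /bipartite_edge /= on /=; exists c.
    by rewrite /bipartite_edge on in ec.
  have m111 : measurable_fun [set: N * 'rV[R]_d * 'rV[R]_d * 'rV[R]_d] (fun w => w.1.1.1).
    by apply: (measurableT_comp m11); exact: measurable_fst.
  have m112 : measurable_fun [set: N * 'rV[R]_d * 'rV[R]_d * 'rV[R]_d] (fun w => w.1.2).
    exact: measurableT_comp.
  have m1 : measurable_fun [set: N * 'rV[R]_d * 'rV[R]_d * 'rV[R]_d] (fun w => w.1.1).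
    exact: measurableT_comp.
  apply: (measurable_exists_point m11 (E := [set w : N * 'rV[R]_d * 'rV[R]_d * 'rV[R]_d |
    bipartite_edge w.1.1.1 w.1.1.2 n p w.2 /\
       (points w.1.1.1 w.1.2 /\ prefersl p w.1.2 w.2)])).
  apply: measurable_conj.
    apply: (measurable_preimage
      (f := fun w : N * 'rV[R]_d * 'rV[R]_d * 'rV[R]_d => (w.1.1, w.2)) _ (IH p Lp)).
    exact: measurable_fun_pair.
  apply: measurable_conj; last exact: measurable_prefersl.
  apply: (measurable_preimage
    (f := fun w : N * 'rV[R]_d * 'rV[R]_d * 'rV[R]_d => (w.1.1.1, w.1.2)) _
    measurable_points_pair).
  exact: measurable_fun_pair.
rewrite (_ : mkset _ = [set u : (N * 'rV[R]_d) * 'rV[R]_d | exists2 c, L c &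
    (bipartite_edge u.1.1 u.1.2 n c u.2 /\ (L p /\ prefersr u.2 p c))]); last first.
  apply/seteqP; split=> u /=.
    rewrite {1}/bipartite_edge /= (negPf en) /= => -[c [ec H]].
    have e : bipartite_edge u.1.1 u.1.2 n c u.2 by rewrite /bipartite_edge (negPf en).
    by exists c => //; case: (bipartite_edge_points e).
  move=> [c _ [ec H]]; rewrite /bipartite_edge /= (negPf en) /=; exists c.
  by rewrite /bipartite_edge (negPf en) in ec.
apply: measurable_exists_countable; first exact: countable_lattice.
move=> c Lc; apply: measurable_conj; first exact: IH.
by apply: measurable_conj; [exact: measurable_cst_prop|exact: measurable_prefersr].
Qed.

(** Brings the flower condition into the form needed for measurability: inclusions become
    inequalities by [eball_subP], and the quantifiers run over lattice points, configuration points
    and chain lengths separately. *)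
Lemma flower_within_eballP (phi : N) tz (r : R) :
  flower_within L phi z tz (eball z r) <->
  (~ exists2 y, points phi y & (y = tz \/ prefersl z y tz) /\ ~ enorm (z - y) <= r) /\
  (forall n, ~ exists2 p, L p & exists2 y, points phi y &
     bipartite_edge phi tz n p y /\
     ~ (if odd n then enorm (p - z) else enorm (y - z)) + enorm (y - p) <= r).
Proof.
have ballP b (s : R) : 0 <= s -> eball b s `<=` eball z r <-> enorm (b - z) + s <= r.
  exact: eball_subP.
split=> [[F1 F2]|[G1 G2]]; split.
- move=> [y phiy [yt]]; apply.
  by have /ballP := F1 _ phiy yt; rewrite subrr enorm0 add0r; apply; exact: enorm_ge0.
- move=> n [p Lp [y phiy [+]]]; rewrite /bipartite_edge; case: (odd n) => e; apply.
    by rewrite (enorm_distC y); apply/(ballP p _ (enorm_ge0 _)); apply: F2 e.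
  by apply/(ballP y _ (enorm_ge0 _)); apply: F2 e.
- move=> y phiy yt; apply/(ballP _ _ (enorm_ge0 _)); rewrite subrr enorm0 add0r.
  by apply: contrapT => nyr; apply: G1; exists y.
move=> n a b e; apply/(ballP _ _ (enorm_ge0 _)); apply: contrapT => nbr.
apply: (G2 n); case on : (odd n).
  have e' : bipartite_edge phi tz n b a by rewrite /bipartite_edge on.
  have [Lb phia] := bipartite_edge_points e'.
  by exists b => //; exists a => //; split=> //; rewrite (enorm_distC a).
have e' : bipartite_edge phi tz n a b by rewrite /bipartite_edge on.
have [La phib] := bipartite_edge_points e'.
by exists a => //; exists b.
Qed.

Lemma measurable_flower_within (r : R) :
  measurable [set u : N * 'rV[R]_d | flower_within L u.1 z u.2 (eball z r)].
Proof.
have m12 : measurable_fun [set: N * 'rV[R]_d * 'rV[R]_d] (fun w => w.1.2).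
  exact: measurableT_comp.
have mle (disp : measure_display) (T : measurableType disp) (f : T -> R) :
    measurable_fun setT f -> measurable [set t | ~ f t <= r].
  move=> mf; rewrite (_ : mkset _ = [set t | r < f t]).
    by apply: measurable_bool_set; apply: measurable_fun_ltr.
  by apply/seteqP; split=> t /=; rewrite ltNge => /negP.
rewrite (_ : mkset _ = [set u : N * 'rV[R]_d |
  (~ exists2 y, points u.1 y & (y = u.2 \/ prefersl z y u.2) /\ ~ enorm (z - y) <= r) /\
  (forall n, ~ exists2 p, L p & exists2 y, points u.1 y &
     bipartite_edge u.1 u.2 n p y /\
     ~ (if odd n then enorm (p - z) else enorm (y - z)) + enorm (y - p) <= r)]); last first.
  by apply/seteqP; split=> u /flower_within_eballP.
apply: measurable_conj.
  apply: measurable_not; apply: (measurable_exists_point measurable_fst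
    (E := [set w : N * 'rV[R]_d * 'rV[R]_d |
      (w.2 = w.1.2 \/ prefersl z w.2 w.1.2) /\ ~ enorm (z - w.2) <= r])).
  apply: measurable_conj; last by apply: mle; exact: measurable_enorm_dist.
  by apply: measurable_disj; [exact: measurable_eq_rV|exact: measurable_prefersl].
rewrite (_ : mkset _ = \bigcap_n [set u : N * 'rV[R]_d |
   ~ exists2 p, L p & exists2 y, points u.1 y &
     bipartite_edge u.1 u.2 n p y /\
     ~ (if odd n then enorm (p - z) else enorm (y - z)) + enorm (y - p) <= r]); last first.
  by apply/seteqP; split=> u H n; [move=> _|]; exact: H.
apply: bigcapT_measurable => n; apply: measurable_not.
apply: measurable_exists_countable; first exact: countable_lattice.
move=> p Lp; apply: (measurable_exists_point measurable_fst
    (E := [set w : N * 'rV[R]_d * 'rV[R]_d | bipartite_edge w.1.1 w.1.2 n p w.2 /\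
     ~ (if odd n then enorm (p - z) else enorm (w.2 - z)) + enorm (w.2 - p) <= r])).
apply: measurable_conj; first exact: measurable_bipartite_edge.
apply: mle; apply: measurable_funD; last exact: measurable_enorm_dist.
by case: (odd n) => //; exact: measurable_enorm_dist.
Qed.

Definition partner_flower_in (B : set 'rV[R]_d) (r : R) : set N :=
  [set phi | exists2 x, matched L phi z x & B x /\ flower_within L phi z x (eball z r)].

Definition partner_in (B : set 'rV[R]_d) : set N :=
  [set phi | exists2 x, matched L phi z x & B x].

Lemma measurable_partner_flower_in B r : measurable B -> measurable (partner_flower_in B r).
Proof.
move=> mB; rewrite (_ : partner_flower_in B r = [set phi | exists2 x, points phi x &
   [set u : N * 'rV[R]_d | matched L u.1 z u.2 /\ (B u.2 /\
     flower_within L u.1 z u.2 (eball z r))] (phi, x)]); last first.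
  apply/seteqP; split=> phi /= [x]; last by move=> _ [? ?]; exists x.
  by move=> zx H; exists x => //; exact: matched_psi zx.
apply: (measurable_exists_point (@measurable_id _ N setT)).
apply: measurable_conj; first exact: measurable_matched.
apply: measurable_conj; last exact: measurable_flower_within.
exact: (measurable_preimage (f := snd)).
Qed.

Lemma measurable_partner_in B : measurable B -> measurable (partner_in B).
Proof.
move=> mB; rewrite (_ : partner_in B = [set phi | exists2 x, points phi x &
   [set u : N * 'rV[R]_d | matched L u.1 z u.2 /\ B u.2] (phi, x)]); last first.
  apply/seteqP; split=> phi /= [x]; last by move=> _ [? ?]; exists x.
  by move=> zx H; exists x => //; exact: matched_psi zx.
apply: (measurable_exists_point (@measurable_id _ N setT)).
apply: measurable_conj; first exact: measurable_matched.
exact: (measurable_preimage (f := snd)).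
Qed.

End measurable_flower.

(** * Lebesgue measure of dilations and balls *)

Section lebesgue_scaling.
Context {R : realType}.
Variable r : R.
Hypothesis r_gt0 : 0 < r.

Let ri0 : 0 <= r^-1. Proof. by rewrite invr_ge0 ltW. Qed.
Let rnn : {nonneg R} := NngNum ri0.

(** The image measure divided by r agrees with Lebesgue measure on half-open intervals, hence
    everywhere. *)
Lemma lebesgue_measure_scale (A : set (measurableTypeR R)) : measurable A ->
  lebesgue_measure [set x : measurableTypeR R | A (r^-1 * x)] = (r%:E * lebesgue_measure A)%E.
Proof.
move=> mA.
have mf : measurable_fun setT (fun x : measurableTypeR R => r^-1 * x : measurableTypeR R).
  exact: (@mulrl_measurable R _ _).
pose mu : {measure set (measurableTypeR R) -> \bar R} := mscale rnn
  (measure_function_pushforward__canonical__measure_function_Measure lebesgue_measure mf).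
have -> : lebesgue_measure A = mu A.
  apply: lebesgue_measure_unique => //= _ [[a b]] _ <-.
  rewrite /mscale /= /pushforward.
  have -> : (fun x : measurableTypeR R => r^-1 * x) @^-1` `]a, b]%classic = `]r * a, r * b]%classic.
    apply/seteqP; split=> x /=; rewrite !in_itv /= [r^-1 * x]mulrC;
      by rewrite ltr_pdivlMr// ler_pdivrMr// [a * r]mulrC [b * r]mulrC.
  rewrite !lebesgue_measure_itv/= !lte_fin ltr_pM2l//.
  case: ifPn => _; last by rewrite mule0.
  by rewrite -!EFinB -EFinM -mulrBr mulKf// gt_eqF.
rewrite /mu /= /mscale /= /pushforward muleA -EFinM divff ?gt_eqF// mul1e.
by [].
Qed.

Let mule_expVK n (x y : \bar R) :
  ((r^-1 ^+ n.+1)%:E * ((r%:E * x) * ((r ^+ n)%:E * y)) = x * y)%E.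
Proof.
rewrite muleACA -(EFinM r (r ^+ n)) [LHS]muleA -(EFinM (r^-1 ^+ n.+1)).
rewrite -exprS -exprMn mulVf ?gt_eqF// expr1n mul1e.
by [].
Qed.

Lemma measurable_scale d : measurable_fun setT (fun x : 'rV[R]_d => r^-1 *: x).
Proof.
apply: measurable_fun_rV => i.
rewrite (_ : (fun t => _) = fun t : 'rV[R]_d => r^-1 * t ord0 i); last first.
  by apply/funext => t; rewrite mxE.
by apply: measurable_funM => //; exact: measurable_coord.
Qed.

(** Induction on d: the rescaled image measure agrees with the product measure on rectangles, and
    these determine it. *)
Lemma lebesgue_rV_scale d (A : set 'rV[R]_d) : measurable A ->
  lebesgue_rV d [set x : 'rV[R]_d | A (r^-1 *: x)] = ((r ^+ d)%:E * lebesgue_rV d A)%E.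
Proof.
elim: d A => [|d IH] A mA.
  rewrite expr0 mul1e; congr (lebesgue_rV 0 _); apply/seteqP.
  by split=> x; rewrite /= (_ : r^-1 *: x = x)//; apply/rowP => -[].
pose m := lebesgue_rV (R := R) d.
pose B := @rV_cons R d @^-1` A.
have mB : measurable B by rewrite -[B]setTI; apply: measurable_rV_cons.
pose D (xv : measurableTypeR R * 'rV[R]_d) : measurableTypeR R * 'rV[R]_d :=
  (r^-1 * xv.1, r^-1 *: xv.2).
have mD : measurable_fun setT D.
  apply: measurable_fun_pair.
    apply: (measurableT_comp (mulrl_measurable r^-1)) => //.
  apply: (measurableT_comp (@measurable_scale d)) => //.
have rd0 : 0 <= r^-1 ^+ d.+1 by rewrite exprn_ge0.
pose mu : {measure set (measurableTypeR R * 'rV[R]_d) -> \bar R} := mscale (NngNum rd0)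
  (measure_function_pushforward__canonical__measure_function_Measure
    (lebesgue_measure \x m)%E mD).
have muE : (lebesgue_measure \x m)%E B = mu B.
  apply: product_measure_unique => // A1 A2 mA1 mA2.
  rewrite /mu /= /mscale /= /pushforward.
  have -> : D @^-1` (A1 `*` A2) = [set x | A1 (r^-1 * x)] `*` [set v | A2 (r^-1 *: v)] by [].
  have m1 : measurable [set x : measurableTypeR R | A1 (r^-1 * x)].
    exact: (measurable_preimage (mulrl_measurable r^-1)).
  have m2 : measurable [set v : 'rV[R]_d | A2 (r^-1 *: v)].
    exact: (measurable_preimage (@measurable_scale d)).
  rewrite product_measure1E//.
  rewrite [X in (_ * (X * _))%E](lebesgue_measure_scale mA1) [X in (_ * (_ * X))%E](IH _ mA2).
  exact: mule_expVK.
have consD x v : r^-1 *: rV_cons (x, v) = rV_cons (r^-1 * x, r^-1 *: v) :> 'rV[R]_d.+1.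
  by apply/rowP => i; rewrite !mxE; case: (unliftP ord0 i) => [j|] _ //=; rewrite mxE.
transitivity ((lebesgue_measure \x m)%E (D @^-1` B)).
  congr (product_measure1 _ _ _); apply/seteqP.
  by split=> -[x v]; rewrite /B /D /= consD.
rewrite [X in (_ * X)%E](_ : _ = mu B) //.
rewrite /mu /= /mscale /= /pushforward muleA -EFinM -exprMn divff ?gt_eqF// expr1n mul1e.
by [].
Qed.

Lemma dilationE d (A : set 'rV[R]_d) : dilation r A = [set x | A (r^-1 *: x)].
Proof.
apply/seteqP; split=> x /=; first by move=> [y Ay <-]; rewrite scalerK// gt_eqF.
by exists (r^-1 *: x) => //; rewrite scalerKV// gt_eqF.
Qed.

Lemma measurable_dilation d (A : set 'rV[R]_d) : measurable A -> measurable (dilation r A).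
Proof. by rewrite dilationE; apply: measurable_preimage; exact: measurable_scale. Qed.

Lemma lebesgue_rV_dilation d (A : set 'rV[R]_d) : measurable A ->
  lebesgue_rV d (dilation r A) = ((r ^+ d)%:E * lebesgue_rV d A)%E.
Proof. by rewrite dilationE; exact: lebesgue_rV_scale. Qed.

End lebesgue_scaling.

Section balls.
Context {R : realType} {d : nat}.

Lemma measurable_eball (z : 'rV[R]_d) (r : R) : measurable (eball z r).
Proof.
apply: (measurable_bool_set (b := fun y : 'rV[R]_d => enorm (y - z) <= r)).
by apply: measurable_fun_ler => //; exact: measurable_enorm_dist.
Qed.

(** The ball lies in a cube of side 2 r. A crude bound is enough, as the volume only has to fit
    below the index of the mixing coefficient. *)
Lemma lebesgue_eball_le (z : 'rV[R]_d) (r : R) : 0 <= r ->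
  (lebesgue_rV d (eball z r) <= ((2 * r) ^+ d)%:E)%E.
Proof.
move=> r0; pose A (i : 'I_d) : set R := `[z ord0 i - r, z ord0 i + r]%classic.
have mA i : measurable (A i) by exact: measurable_itv.
have mB : measurable [set v : 'rV[R]_d | forall i, A i (v ord0 i)].
  rewrite (_ : mkset _ = \bigcap_(i in [set: 'I_d]) [set v : 'rV[R]_d | A i (v ord0 i)]).
    apply: fin_bigcap_measurable => // i _.
    exact: (measurable_preimage (measurable_coord i)).
  by apply/seteqP; split=> v H i; [move=> _|]; exact: H.
apply: (@le_trans _ _ (lebesgue_rV d [set v : 'rV[R]_d | forall i, A i (v ord0 i)])).
  apply: le_measure; rewrite ?inE//; first exact: measurable_eball.
  move=> v; rewrite /eball /= => vz i; rewrite /A /= in_itv /= -ler_distl.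
  by have := coord_le_enorm (v - z) i; rewrite !mxE => /le_trans; apply.
rewrite (lebesgue_rV_box mA) (eq_bigr (fun=> (2 * r)%:E)) => [|i _]; last first.
  rewrite lebesgue_measure_itv /= lte_fin; case: ltP => [_|rr].
    by rewrite -EFinB; congr EFin; lra.
  congr EFin; lra.
by rewrite prodEFin prodr_const card_ord.
Qed.

End balls.

(** * Covariances of events *)

Section event_covariance.
Context {R : realType} {disp : measure_display} {Omega : measurableType disp}
  (P : probability Omega R).
Implicit Types A B : set Omega.

Definition prob A : R := fine (P A).
Definition ecov A B : R := prob (A `&` B) - prob A * prob B.

Lemma probE A : measurable A -> P A = (prob A)%:E.
Proof. by move=> mA; rewrite /prob fineK// fin_num_measure. Qed.

Lemma prob_ge0 A : 0 <= prob A.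
Proof. exact: fine_ge0. Qed.

Lemma prob_le1 A : measurable A -> prob A <= 1.
Proof. by move=> mA; rewrite -lee_fin -probE// probability_le1. Qed.

Lemma le_prob A B : measurable A -> measurable B -> A `<=` B -> prob A <= prob B.
Proof. by move=> mA mB AB; rewrite -lee_fin -!probE// le_measure ?inE. Qed.

Lemma prob_setD A B : measurable A -> measurable B -> B `<=` A ->
  prob (A `\` B) = prob A - prob B.
Proof.
move=> mA mB BA; apply/EFin_inj; rewrite EFinB -!probE//; last exact: measurableD.
by rewrite measureD ?setIidr// ltey_eq fin_num_measure.
Qed.

Lemma ecovC A B : ecov A B = ecov B A.
Proof. by rewrite /ecov setIC mulrC. Qed.

Lemma ecov_le_prob A B : measurable A -> measurable B -> `|ecov A B| <= prob A.
Proof.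
move=> mA mB; rewrite ler_norml; apply/andP; split.
  rewrite lerNl opprB lerBlDr (le_trans (_ : _ <= prob A))//.
    by rewrite ler_piMr ?prob_ge0// prob_le1.
  by rewrite lerDl prob_ge0.
rewrite lerBlDr (le_trans (_ : _ <= prob A))//.
  by apply: le_prob => //; exact: measurableI.
by rewrite lerDl mulr_ge0 ?prob_ge0.
Qed.

Lemma ecov_subl A A1 B : measurable A -> measurable A1 -> measurable B ->
  A1 `<=` A -> ecov A B = ecov A1 B + ecov (A `\` A1) B.
Proof.
move=> mA mA1 mB A1A; rewrite /ecov.
have -> : (A `\` A1) `&` B = (A `&` B) `\` (A1 `&` B).
  by apply/seteqP; split=> x /=; tauto.
rewrite !prob_setD//; [lra|exact: measurableI|exact: measurableI|exact: setSI].
Qed.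

Lemma ecov_setC A B : measurable A -> measurable B -> ecov (~` A) B = - ecov A B.
Proof.
move=> mA mB; have := @ecov_subl setT A B measurableT mA mB (@subsetT _ _).
rewrite setTD {1}/ecov setTI {2}/prob probability_setT mul1r subrr.
by move/eqP; rewrite eq_sym addr_eq0 => /eqP ->; rewrite opprK.
Qed.

Lemma ecov_le_probC A B : measurable A -> measurable B -> `|ecov A B| <= prob (~` A).
Proof.
by move=> mA mB; rewrite -normrN -ecov_setC// ecov_le_prob//; exact: measurableC.
Qed.

Lemma ecov_approx A A1 B B1 : measurable A -> measurable A1 -> measurable B ->
  measurable B1 -> A1 `<=` A -> B1 `<=` B ->
  `|ecov A B| <= `|ecov A1 B1| + prob (A `\` A1) + prob (B `\` B1).
Proof.
move=> mA mA1 mB mB1 A1A B1B.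
rewrite (ecov_subl mA mA1 mB A1A) (ecovC A1 B) (ecov_subl mB mB1 mA1 B1B) (ecovC B1 A1).
apply: le_trans (ler_normD _ _) _; rewrite [leRHS]addrAC; apply: lerD; last first.
  by apply: ecov_le_prob => //; exact: measurableD.
apply: le_trans (ler_normD _ _) _; apply: lerD => //.
by apply: ecov_le_prob => //; exact: measurableD.
Qed.

Lemma covariance_indic A B : measurable A -> measurable B ->
  covariance P \1_A \1_B = (ecov A B)%:E.
Proof.
move=> mA mB; have L1 C : measurable C -> (\1_C : Omega -> R) \in Lfun P 1.
  by move=> mC; apply/Lfun1_integrable; exact: integrable_indic.
have AB : (\1_A : Omega -> R) * \1_B = \1_(A `&` B) :> (Omega -> R).
  by apply/funext => t; rewrite indicI.
have mAB : measurable (A `&` B) by exact: measurableI.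
rewrite covarianceE ?AB ?L1// !expectation_indic//.
by rewrite /ecov EFinB EFinM -!probE.
Qed.

(** The sum is the expected number of z in s for which A z occurs; this number vanishes off E and is
    at most C on E. *)
Lemma sum_prob_le (I : eqType) (s : seq I) (A : I -> set Omega) (E : set Omega) (C : R) :
  (forall z, z \in s -> measurable (A z)) -> measurable E -> 0 <= C ->
  (forall z t, z \in s -> A z t -> E t) ->
  (forall t, E t -> (count (fun z => `[< A z t >]) s)%:R <= C) ->
  \sum_(z <- s) prob (A z) <= C * prob E.
Proof.
move=> mA mE C0 AE AC.
(* Exchanging sum and integral asks for measurability at every index, whereas A is known to be
   measurable only on s. *)
pose A' z := if z \in s then A z else set0.
have mA' z : measurable (A' z) by rewrite /A'; case: ifP => // /mA.
have -> : \sum_(z <- s) prob (A z) = \sum_(z <- s) prob (A' z).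
  by apply: eq_big_seq => z zs; rewrite /A' zs.
rewrite -lee_fin -sumEFin EFinM.
have PE (B : set Omega) : measurable B -> (prob B)%:E = (\int[P]_t (\1_B t)%:E)%E.
  by move=> mB; rewrite integral_indic// setIT -probE.
rewrite (eq_bigr (fun z => \int[P]_t (\1_(A' z) t)%:E)%E) => [|z _]; last exact: PE.
have mind (B : set Omega) : measurable B -> measurable_fun setT (fun t => (\1_B t)%:E : \bar R).
  by move=> mB; apply/measurable_EFinP; exact: measurable_indic.
rewrite -ge0_integral_sum//; last by move=> z; exact: mind.
rewrite PE// -ge0_integralZl//; last exact: mind.
apply: ge0_le_integral => //.
- by move=> t _; apply: sume_ge0 => z _; rewrite lee_fin.
- by apply: emeasurable_sum => z; exact: mind.
- by apply: emeasurable_funM => //; exact: mind.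
move=> t _; rewrite sumEFin lee_fin.
have sE : \sum_(z <- s) \1_(A' z) t = (count (fun z => `[< A z t >]) s)%:R :> R.
  rewrite -sum1_count natr_sum [RHS]big_mkcond /=; apply: eq_big_seq => z zs.
  rewrite indicE /A' zs; case: asboolP => H; [rewrite mem_set|rewrite memNset] => //.
rewrite sE indicE; have [Et|nEt] := boolP (t \in E).
  by rewrite mulr1; apply: AC; rewrite inE in Et.
rewrite mulr0 lern0 eqn0Ngt -has_count; apply/hasP => -[z zs /asboolP Azt].
by move: nEt; rewrite (mem_set (AE _ _ zs Azt)).
Qed.

Let cindic A (t : Omega) : R := \1_A t - prob A.

Let measurable_cindic A : measurable A -> measurable_fun setT (cindic A).
Proof. by move=> mA; apply: measurable_funB => //; exact: measurable_indic. Qed.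

Let cindic_le1 A t : measurable A -> `|cindic A t| <= 1.
Proof.
move=> mA; have p0 := prob_ge0 A; have p1 := prob_le1 mA.
by rewrite /cindic indicE ler_norml; case: (t \in A); apply/andP; split => /=; lra.
Qed.

Let integrable_cindicM A B : measurable A -> measurable B ->
  P.-integrable setT (EFin \o (cindic A \* cindic B)).
Proof.
move=> mA mB; apply: measurable_bounded_integrable => //.
- by rewrite ltey_eq fin_num_measure.
- by apply: measurable_funM; exact: measurable_cindic.
- exists 1; split=> // M M1 t _ /=; rewrite normrM (le_trans _ (ltW M1))//.
  by rewrite mulr_ile1 ?normr_ge0 ?cindic_le1.
Qed.

Let integral_cindicM A B : measurable A -> measurable B ->
  (\int[P]_t (cindic A t * cindic B t)%:E = (ecov A B)%:E)%E.
Proof.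
move=> mA mB; rewrite -covariance_indic// unlock !expectation_indic// unlock.
by [].
Qed.

Lemma integral_sqr_count (I : Type) (s : seq I) (A : I -> set Omega) :
  (forall z, measurable (A z)) ->
  (\int[P]_t ((\sum_(z <- s) \1_(A z) t - \sum_(z <- s) prob (A z)) ^+ 2)%:E =
   (\sum_(z <- s) \sum_(w <- s) ecov (A z) (A w))%:E)%E.
Proof.
move=> mA.
have E t : ((\sum_(z <- s) \1_(A z) t - \sum_(z <- s) prob (A z)) ^+ 2)%:E =
    (\sum_(z <- s) \sum_(w <- s) (cindic (A z) t * cindic (A w) t)%:E)%E.
  rewrite -sumrB expr2 big_distrlr /= -sumEFin.
  by apply: eq_bigr => z _; rewrite sumEFin.
under eq_integral do rewrite E.
rewrite integral_sum//; last first.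
  by move=> z; apply: integrable_sum => // w _; exact: integrable_cindicM.
rewrite -sumEFin; apply: eq_bigr => z _.
rewrite integral_sum//; last by move=> w; exact: integrable_cindicM.
by rewrite -sumEFin; apply: eq_bigr => w _; exact: integral_cindicM.
Qed.

(* Fatou's lemma passes the variance bound to the limit. *)
Lemma variance_count_le (I : Type) (u : nat -> seq I) (A : I -> set Omega)
    (X : Omega -> R) (C V : R) :
  (forall z, measurable (A z)) -> measurable_fun setT X ->
  (forall t, nondecreasing_seq (fun n => \sum_(z <- u n) \1_(A z) t : R)) ->
  (forall t, \forall n \near \oo, \sum_(z <- u n) \1_(A z) t = X t) ->
  (forall n, \sum_(z <- u n) prob (A z) <= C) ->
  (forall n, \sum_(z <- u n) \sum_(w <- u n) `|ecov (A z) (A w)| <= V) ->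
  ('V_P[X] <= V%:E)%E.
Proof.
move=> mA mX ndS SX meanC varV.
pose S n t : R := \sum_(z <- u n) \1_(A z) t.
pose m n : R := \sum_(z <- u n) prob (A z).
have mS n : measurable_fun setT (S n).
  by apply: measurable_sum => z; exact: measurable_indic.
have cvgS t : (S ^~ t) @ \oo --> X t.
  by apply: cvg_near_cst; exact: SX.
have S0 n t : 0 <= S n t by apply: sumr_ge0 => z _.
have X0 t : 0 <= X t by have [n _ /(_ n (leqnn n)) <-] := SX t; exact: S0.
have ES n : (\int[P]_t (S n t)%:E = (m n)%:E)%E.
  under eq_integral do rewrite -sumEFin.
  rewrite ge0_integral_sum//; last by move=> z; apply/measurable_EFinP; exact: measurable_indic.
  rewrite -sumEFin; apply: eq_bigr => z _.
  by rewrite integral_indic// setIT -probE.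
(* The centring constants must converge as well, by monotone convergence; the bound C serves to make
   their limit finite. *)
have cvgm : ((m n)%:E @[n --> \oo] --> 'E_P[X])%E.
  under eq_fun do rewrite -ES.
  rewrite unlock (eq_integral (fun t => limn (fun n => (S n t)%:E))) => [|t _].
    apply: cvg_monotone_convergence => //.
    - by move=> n; exact/measurable_EFinP.
    - by move=> n t _; rewrite lee_fin.
    - by move=> t _ a b ab; rewrite lee_fin; exact: ndS.
  by apply/esym/cvg_lim => //; apply/cvg_EFin => //; [exact: nearW|exact: cvgS].
have Xfin : ('E_P[X] \is a fin_num)%E.
  rewrite ge0_fin_numE ?expectation_ge0// (le_lt_trans _ (ltry C))//.
  rewrite -(cvg_lim _ cvgm)//; apply: lime_le; first by apply/cvg_ex; exists 'E_P[X]%E.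
  by apply: nearW => n; rewrite lee_fin; exact: meanC.
set mu := fine 'E_P[X]%E.
have cvgmu : m @ \oo --> mu by move: cvgm; rewrite -(fineK Xfin) => /fine_cvg.
have cvgD t : (((S n t - m n) ^+ 2)%:E @[n --> \oo] --> ((X t - mu) ^+ 2)%:E)%E.
  apply/cvg_EFin; first exact: nearW.
  rewrite (_ : fine \o _ = fun n => (S n t - m n) * (S n t - m n)); last first.
    by apply/funext => n /=; rewrite expr2.
  by rewrite expr2; apply: cvgM; (apply: cvgB; [exact: cvgS|exact: cvgmu]).
have -> : ('V_P[X] = \int[P]_t ((X t - mu) ^+ 2)%:E)%E.
  rewrite /variance unlock {1}expectation.unlock; apply: eq_integral => t _.
  by rewrite expr2.
rewrite (eq_integral (fun t => limn_einf (fun n => ((S n t - m n) ^+ 2)%:E))); last first.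
  by move=> t _; rewrite (cvg_limn_einf_sup (cvgD t)).
apply: le_trans (fatou _ _ _ _) _ => //.
- by move=> n; apply/measurable_EFinP; apply: measurable_funX; exact: measurable_funB.
- by move=> n t _; rewrite lee_fin sqr_ge0.
rewrite limn_einf_lim; apply: lime_le; first exact: is_cvg_einfs.
apply: nearW => n; apply: (@le_trans _ _ (\int[P]_t ((S n t - m n) ^+ 2)%:E)%E).
  by apply: ereal_inf_lbound; exists n => //=.
rewrite /S /m integral_sqr_count// lee_fin (le_trans _ (varV n))//.
by apply: ler_sum => z _; apply: ler_sum => w _; exact: ler_norm.
Qed.

End event_covariance.

Lemma sub_in_count (T : eqType) (p q : pred T) (s : seq T) :
  (forall z, z \in s -> p z -> q z) -> (count p s <= count q s)%N.
Proof.
elim: s => //= x s IH pq; apply: leq_add; last first.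
  by apply: IH => z zs; apply: pq; rewrite inE zs orbT.
by case: (boolP (p x)) => // /(pq _ (mem_head _ _)) ->.
Qed.

(** * Lattice points matched into a set *)

Section lattice_partner_events.
Context {R : realType} {d : nat} {disp : measure_display}
  {Omega : measurableType disp} (P : probability Omega R)
  (Psi : Omega -> configuration R d).
Hypotheses (d_gt0 : (0 < d)%N) (mPsi : point_process Psi) (stPsi : stationary P Psi).
Notation L := (integer_lattice R d).
Notation N := (configuration R d).
Implicit Types (z : 'rV[R]_d) (K : set 'rV[R]_d).

Lemma shifted_lattice z : L z -> shifted z L L.
Proof.
move=> Lz x; split=> [Lxz|Lx]; last exact: latticeD.
by rewrite -(addrK z x); apply: latticeD => //; exact: latticeN.
Qed.

Lemma shifted_translation (phi : N) z : shifted z phi (translation phi z).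
Proof.
by move=> x; split=> [[y phiy /addIr <-]//|phix]; exists x.
Qed.

Lemma shifted_eball z r : shifted z (eball 0 r) (eball z r).
Proof. by move=> x; rewrite /eball /= addrK subr0. Qed.

Lemma partner_in_shift z K (phi : N) : L z ->
  partner_in z K (translation phi z) <-> partner_in 0 [set x | K (x + z)] phi.
Proof.
move=> Lz; have sh p x : matched L (translation phi z) (p + z) (x + z) <-> matched L phi p x.
  exact: (matched_shift (shifted_lattice Lz) (shifted_translation _ _)).
split=> -[x zx Kx].
  exists (x - z); last by rewrite /= subrK.
  by apply/sh; rewrite add0r subrK.
by exists (x + z) => //; have /sh := zx; rewrite add0r.
Qed.

Lemma partner_flower_in_shift z K r (phi : N) : L z ->
  partner_flower_in z K r (translation phi z) <->
  partner_flower_in 0 [set x | K (x + z)] r phi.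
Proof.
move=> Lz; have sh p x : matched L (translation phi z) (p + z) (x + z) <-> matched L phi p x.
  exact: (matched_shift (shifted_lattice Lz) (shifted_translation _ _)).
have sL := shifted_lattice Lz; have sphi := shifted_translation phi z.
split=> -[x zx [Kx F]].
  exists (x - z); first by apply/sh; rewrite add0r subrK.
  split; first by rewrite /= subrK.
  have := flower_within_shift (shiftedN sL) (shiftedN sphi) (shiftedN (@shifted_eball z r)) F.
  by rewrite subrr.
exists (x + z); first by have /sh := zx; rewrite add0r.
split=> //; have := flower_within_shift sL sphi (@shifted_eball z r) F.
by rewrite add0r.
Qed.

Definition partner_event K z : set Omega :=
  [set t | L z /\ partner_in z K (Psi t)].

Definition local_partner_event K r z : set Omega :=
  [set t | L z /\ partner_flower_in z K r (Psi t)].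

Definition flower_exceeds r : set Omega :=
  [set t | ~ matching_flower L (Psi t) 0 `<=` eball 0 r].

Lemma flower_exceedsP r t : flower_exceeds r t <-> ~ partner_flower_in 0 setT r (Psi t).
Proof.
(* A ball of larger radius is not contained in this one, because d > 0; so [matching_flowerP] is
   applicable. *)
have bN : eball (0 : 'rV[R]_d) r <> setT.
  move=> bT; have : eball (0 : 'rV[R]_d) (`|r| + 1) `<=` eball 0 r by rewrite bT.
  move=> /eball_subP; rewrite subrr enorm0 add0r => /(_ d_gt0).
  rewrite addr_ge0// => /(_ isT); have := ler_norm r; lra.
rewrite /flower_exceeds /= (matching_flowerP _ (@lattice0 _ _) bN).
by split; apply: contra_not => -[x zx]; [case=> _|]; exists x.
Qed.

Lemma measurable_partner_event K z : measurable K -> measurable (partner_event K z).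
Proof.
move=> mK; have [Lz|nLz] := pselect (L z); last first.
  by rewrite (_ : partner_event K z = set0)//; apply/seteqP; split=> t // [].
rewrite (_ : partner_event K z = [set t | partner_in z K (Psi t)]).
  by apply: (measurable_preimage mPsi); exact: measurable_partner_in.
by apply/seteqP; split=> t // [].
Qed.

Lemma measurable_local_partner_event K r z : measurable K ->
  measurable (local_partner_event K r z).
Proof.
move=> mK; have [Lz|nLz] := pselect (L z); last first.
  by rewrite (_ : local_partner_event K r z = set0)//; apply/seteqP; split=> t // [].
rewrite (_ : local_partner_event K r z = [set t | partner_flower_in z K r (Psi t)]).
  by apply: (measurable_preimage mPsi); exact: measurable_partner_flower_in.
by apply/seteqP; split=> t // [].
Qed.

Lemma measurable_flower_exceeds r : measurable (flower_exceeds r).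
Proof.
rewrite (_ : flower_exceeds r = [set t | ~ partner_flower_in 0 setT r (Psi t)]).
  apply: measurable_not; apply: (measurable_preimage mPsi).
  by apply: measurable_partner_flower_in => //; exact: lattice0.
by apply/seteqP; split=> t /flower_exceedsP.
Qed.

Lemma local_partner_sub K r z : local_partner_event K r z `<=` partner_event K z.
Proof. by move=> t [Lz [x zx [Kx _]]]; split=> //; exists x. Qed.

Lemma flower_exceeds_anti r s : r <= s -> flower_exceeds s `<=` flower_exceeds r.
Proof.
by move=> rs t /=; apply: contra_not => Fr; apply: subset_trans Fr (le_eball rs).
Qed.

Lemma partner_flower_dist z K r (phi : N) : partner_flower_in z K r phi ->
  exists2 x, matched L phi z x & K x /\ enorm (x - z) <= r.
Proof.
move=> [x zx [Kx F]]; exists x => //; split=> //.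
have /eball_subP := flower_sub_region (matched_psi zx) F.
by rewrite subrr enorm0 add0r enorm_distC; apply => //; exact: enorm_ge0.
Qed.

Lemma prob_stationary z (E E0 : set N) : measurable E -> 
  (forall phi, E (translation phi z) <-> E0 phi) ->
  prob P [set t | E (Psi t)] = prob P [set t | E0 (Psi t)].
Proof.
move=> mE EE0; rewrite /prob -(stPsi z mE); congr (fine (P _)).
by apply/seteqP; split=> t /EE0.
Qed.

Lemma prob_setT : prob P setT = 1.
Proof. by rewrite /prob probability_setT. Qed.

Lemma prob_setU_le (A B : set Omega) : measurable A -> measurable B ->
  prob P (A `|` B) <= prob P A + prob P B.
Proof.
move=> mA mB; rewrite -lee_fin EFinD -!probE//; last exact: measurableU.
exact: measureU2.
Qed.

Section sums.
Variables (K : set 'rV[R]_d) (Q : R) (s : seq 'rV[R]_d).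
Hypotheses (mK : measurable K) (KQ : K `<=` box Q) (Q0 : 0 <= Q).
Hypotheses (us : uniq s) (sL : forall z, z \in s -> L z).

Let measurable_preshift z : measurable [set x | K (x + z)].
Proof.
apply: (measurable_preimage (f := fun x : 'rV[R]_d => x + z)) => //.
apply: measurable_fun_rV => i.
rewrite (_ : (fun t => _) = fun t : 'rV[R]_d => t ord0 i + z ord0 i); last first.
  by apply/funext => t; rewrite mxE.
by apply: measurable_funD => //; exact: measurable_coord.
Qed.

Let count_partner (phi : N) (f : 'rV[R]_d -> bool) :
  (forall z, z \in s -> f z -> partner_in 0 [set x | K (x + z)] phi) ->
  (count f s)%:R <= (2 * Q + 1) ^+ d.
Proof.
move=> fP.
have [[x zx]|no] := pselect (exists x, matched L phi 0 x); last first.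
  rewrite (_ : count f s = 0%N) ?exprn_ge0 ?addr_ge0 ?mulr_ge0//.
  apply/eqP; rewrite eqn0Ngt -has_count; apply/hasP => -[z zs /fP].
  by move=> /(_ zs)[x zx _]; apply: no; exists x.
apply: le_trans (box_lattice_count x d_gt0 Q0 us sL).
rewrite ler_nat; apply: sub_in_count => z zs fz; apply/asboolP/KQ.
by have [x' /(matched_fun zx) <-] := fP z zs fz; rewrite /= addrC.
Qed.

Lemma prob_partner_event z : L z -> prob P (partner_event K z) =
  prob P [set t | partner_in 0 [set x | K (x + z)] (Psi t)].
Proof.
move=> Lz; rewrite (_ : partner_event K z = [set t | partner_in z K (Psi t)]).
  apply: prob_stationary => [|phi]; first exact: measurable_partner_in.
  exact: partner_in_shift.
by apply/seteqP; split=> t // [].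
Qed.

Let measurable_origin z :
  measurable [set t | partner_in 0 [set x | K (x + z)] (Psi t)].
Proof.
apply: (measurable_preimage mPsi); apply: measurable_partner_in => //.
exact: lattice0.
Qed.

(* Mass transport: by stationarity z may be moved to the origin, where at most
   one partner x of 0 satisfies x + z in K. *)
Lemma sum_partner_event :
  \sum_(z <- s) prob P (partner_event K z) <= (2 * Q + 1) ^+ d.
Proof.
rewrite (eq_big_seq (fun z => prob P [set t | partner_in 0 [set x | K (x + z)] (Psi t)])).
  rewrite -[leRHS]mulr1 -[X in _ <= _ * X]prob_setT.
  apply: sum_prob_le => //.
  - by rewrite exprn_ge0 ?addr_ge0 ?mulr_ge0.
  - by move=> t _; apply: (@count_partner (Psi t)) => z zs /asboolP.
by move=> z zs; apply: prob_partner_event; exact: sL.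
Qed.

(** Mass transport again. After moving z to the origin, a partner without a small flower means that
    F(0) leaves the ball, an event independent of z; on it at most (2Q + 1)^d points z
    contribute. *)
Lemma sum_partner_event_local r :
  \sum_(z <- s) prob P (partner_event K z `\` local_partner_event K r z) <=
    (2 * Q + 1) ^+ d * prob P (flower_exceeds r).
Proof.
pose E z := partner_in 0 [set x | K (x + z)] `\`
  partner_flower_in 0 [set x | K (x + z)] r : set N.
have mE z : measurable (E z).
  apply: measurableD; first by apply: measurable_partner_in => //; exact: lattice0.
  by apply: measurable_partner_flower_in => //; exact: lattice0.
rewrite (eq_big_seq (fun z => prob P [set t | E z (Psi t)])); last first.
  move=> z zs; have Lz := sL zs.
  rewrite (_ : _ `\` _ = [set t | (partner_in z K `\` partner_flower_in z K r) (Psi t)]).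
    apply: prob_stationary => [|phi].
      apply: measurableD; first exact: measurable_partner_in.
      exact: measurable_partner_flower_in.
    have e1 := partner_in_shift K phi Lz; have e2 := partner_flower_in_shift K r phi Lz.
    by split=> -[/e1 ? n2]; split=> // /e2.
  apply/seteqP; split=> t [].
    by move=> [_ zt] nt; split=> // ?; apply: nt.
  by move=> zt nt; split=> // -[].
apply: sum_prob_le.
- by move=> z zs; apply: (measurable_preimage mPsi).
- exact: measurable_flower_exceeds.
- by rewrite exprn_ge0 ?addr_ge0 ?mulr_ge0.
- move=> z t zs [[x zx Kx] nF]; apply/flower_exceedsP => -[x' zx' [_ F]].
  by apply: nF; exists x' => //; split=> //; rewrite -(matched_fun zx zx').
- by move=> t _; apply: (@count_partner (Psi t)) => z zs /asboolP[].
Qed.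

Lemma local_partner_event_box r z t : local_partner_event K r z t -> box (Q + r) z.
Proof.
move=> [Lz /partner_flower_dist [x zx [/KQ Kx xz]]] i.
have := coord_le_enorm (x - z) i; rewrite !mxE => xzi.
have := ler_normB (x ord0 i) (x ord0 i - z ord0 i); rewrite subKr.
by move=> /le_trans; apply; apply: lerD => //; exact: le_trans xz.
Qed.

(** The event that the indicator of [partner_event K z] differs from 1(z in K). *)
Let defect z := if `[< K z >] then ~` partner_event K z else partner_event K z.

(** After transport to the origin, z counts if membership in K is not the same for z as for z +
    tau(0), an infinite tau(0) counting as outside. If F(0) stays in the ball of radius r, then
    [symdiff_lattice_count] gives a number of surface order. Otherwise z or z + tau(0) is in K, each
    for at most (2Q + 1)^d points, whence the 2 in the last term. *)
Lemma sum_partner_defect r : segment_closed K -> 0 <= r ->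
  \sum_(z <- s) prob P (defect z) <=
    d%:R * (2 * ((2 * Q + 1) ^+ d.-1 * (r + 1))) +
    2 * (2 * Q + 1) ^+ d * prob P (flower_exceeds r).
Proof.
move=> cK r0.
pose D z : set N := if `[< K z >] then ~` partner_in 0 [set x | K (x + z)]
  else partner_in 0 [set x | K (x + z)].
have mD0 z : measurable (partner_in 0 [set x | K (x + z)]).
  by apply: measurable_partner_in => //; exact: lattice0.
have mD z : measurable (D z) by rewrite /D; case: ifP => // _; exact: measurableC.
have mPD z : measurable [set t | D z (Psi t)] by exact: (measurable_preimage mPsi).
have mB := measurable_flower_exceeds r.
have PD z : z \in s -> prob P (defect z) = prob P [set t | D z (Psi t)].
  move=> zs; have Lz := sL zs; rewrite /defect /D.
  rewrite (_ : partner_event K z = [set t | partner_in z K (Psi t)]); last first.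
    by apply/seteqP; split=> t // [].
  case: ifP => _.
    apply: (@prob_stationary z (~` partner_in z K)) => [|phi].
      by apply: measurableC; exact: measurable_partner_in.
    by have e1 := partner_in_shift K phi Lz; split=> n1 /e1.
  apply: prob_stationary => [|phi]; first exact: measurable_partner_in.
  exact: partner_in_shift.
rewrite (eq_big_seq _ PD).
apply: (@le_trans _ _ (\sum_(z <- s) prob P ([set t | D z (Psi t)] `&` ~` flower_exceeds r) +
    \sum_(z <- s) prob P ([set t | D z (Psi t)] `&` flower_exceeds r))).
  rewrite -big_split /=; apply: ler_sum => z _.
  rewrite addrC; apply: le_trans (prob_setU_le _ _).
  - by rewrite -setIUr setUv setIT.
  - exact: measurableI.
  - by apply: measurableI => //; exact: measurableC.
have q0 : 0 <= 2 * Q + 1 by rewrite addr_ge0 ?mulr_ge0.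
have c0 : 0 <= d%:R * (2 * ((2 * Q + 1) ^+ d.-1 * (r + 1))).
  by do 3 ?apply: mulr_ge0 => //; [exact: exprn_ge0|exact: addr_ge0].
apply: lerD.
  rewrite -[leRHS]mulr1 -[X in _ <= _ * X]prob_setT.
  apply: sum_prob_le => //.
  - by move=> z zs; apply: measurableI => //; exact: measurableC.
  move=> t _; have [tB|/flower_exceedsP/contrapT ntB] := pselect (flower_exceeds r t).
    rewrite (_ : count _ _ = 0%N); last first.
      by apply/eqP; rewrite eqn0Ngt -has_count; apply/hasP => -[z zs /asboolP[_]].
    exact: c0.
  have [x zx [_ xr]] := partner_flower_dist ntB.
  have xbox : box r x.
    by move=> i; have := coord_le_enorm x i; rewrite subr0 in xr => /le_trans; apply.
  apply: le_trans (symdiff_lattice_count cK KQ Q0 xbox us sL).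
  rewrite ler_nat; apply: sub_in_count => z zs /asboolP[+ _].
  have pE : partner_in 0 [set x | K (x + z)] (Psi t) <-> K (z + x).
    split=> [[x' /(matched_fun zx) <-]|Kzx]; first by rewrite /= addrC.
    by exists x => //=; rewrite addrC.
  rewrite /D /=; case: (asboolP (K z)) => Kz; rewrite /setC /= pE.
    by move/asboolPn => /negPf ->.
  by move/asboolP => ->.
apply: sum_prob_le => //.
- by move=> z zs; apply: measurableI.
- by rewrite mulr_ge0 ?exprn_ge0.
- by move=> z t zs [].
move=> t _.
have sub : (count (fun z => `[< ([set t | D z (Psi t)] `&` flower_exceeds r) t >]) s <=
   count (fun z => `[< box Q (z + 0)%R >]) s +
   count (fun z => `[< partner_in 0%R [set x | K (x + z)%R] (Psi t) >]) s)%N.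
  rewrite -count_predUI (leq_trans _ (leq_addr _ _))//; apply: sub_count => z /asboolP[+ _].
  rewrite /D /=; case: (asboolP (K z)) => Kz.
    by move=> _; apply/orP; left; apply/asboolP; rewrite addr0; exact: KQ.
  by move=> pz; apply/orP; right; apply/asboolP.
move: sub; rewrite -(ler_nat R) natrD => /le_trans; apply.
rewrite mulr_natl mulr2n; apply: lerD; first exact: box_lattice_count.
by apply: (@count_partner (Psi t)) => z zs /asboolP.
Qed.

Lemma ecov_partner_defect z A : measurable A ->
  `|ecov P (partner_event K z) A| <= prob P (defect z).
Proof.
move=> mA; have mz := measurable_partner_event z mK.
by rewrite /defect; case: ifP => _; [exact: ecov_le_probC|exact: ecov_le_prob].
Qed.

End sums.

End lattice_partner_events.

(** * Shifted covariance sums and the mixing coefficient *)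

Section mixing.
Context {R : realType} {d : nat} {disp : measure_display}
  {Omega : measurableType disp} (P : probability Omega R)
  (Psi : Omega -> configuration R d).
Hypotheses (d_gt0 : (0 < d)%N) (mPsi : point_process Psi) (stPsi : stationary P Psi).
Notation L := (integer_lattice R d).
Notation N := (configuration R d).

(** [matched_local] is used in both directions, with the configuration and its restriction
    exchanging roles: they agree on the ball that contains the flower. *)
Lemma partner_flower_in_restriction z K r (phi : N) :
  partner_flower_in z K r (restriction phi (eball z r)) <-> partner_flower_in z K r phi.
Proof.
have lfL : locally_finite L := lattice_locally_finite d_gt0.
split=> -[x zx [Kx F]].
  have agree y : eball z r y -> points (restriction phi (eball z r)) y <-> points phi y.
    by move=> zy; split=> [[]|].
  exists x; first exact: (matched_local lfL (points_locally_finite phi) agree zx F).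
  by split=> //; exact: (@flower_within_local _ _ L _ _ _ agree _ _ (matched_psi zx) F).
have agree y : eball z r y -> points phi y <-> points (restriction phi (eball z r)) y.
  by move=> zy; split=> [|[]].
exists x; first exact: (matched_local lfL (points_locally_finite (restriction phi _)) agree zx F).
by split=> //; exact: (@flower_within_local _ _ L _ _ _ agree _ _ (matched_psi zx) F).
Qed.

Lemma ecov_local_le_mixing K z z' r p s : measurable K -> L z -> L z' -> 0 <= r ->
  (2 * r) ^+ d <= p -> s <= enorm (z - z') - 2 * r ->
  ((`|ecov P (local_partner_event Psi K r z) (local_partner_event Psi K r z')|)%:E
     <= mixing_coefficient P Psi p p s)%E.
Proof.
move=> mK Lz Lz' r0 rp szz'.
pose f x : N -> R := \1_(partner_flower_in x K r).
have fE x : L x -> (fun w => f x (restriction (Psi w) (eball x r))) =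
    \1_(local_partner_event Psi K r x) :> (Omega -> R).
  move=> Lx; apply/funext => w; rewrite /f !indicE; congr ((_ : bool)%:R).
  apply/idP/idP; rewrite !inE.
    by move/partner_flower_in_restriction.
  by move=> [_ /partner_flower_in_restriction].
have fP x : L x -> measurable_fun setT (f x) /\ range (f x) `<=` [set 0; 1].
  move=> Lx; split; first by apply: measurable_indic; exact: measurable_partner_flower_in.
  by move=> _ [phi _ <-]; rewrite /f indicE; case: (_ \in _); [right|left].
apply: ereal_sup_ubound; exists (f z), (f z'), (eball z r), (eball z' r).
split; try exact: fP.
- split; first exact: measurable_eball.
  by apply: le_trans (lebesgue_eball_le _ r0) _; rewrite lee_fin.
- split; first exact: measurable_eball.
  by apply: le_trans (lebesgue_eball_le _ r0) _; rewrite lee_fin.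
split; last first.
  rewrite !fE// covariance_indic//; exact: measurable_local_partner_event.
apply: le_ereal_inf_tmp => _ [x xz [y yz' <-]]; rewrite lee_fin (le_trans szz')//.
rewrite /eball /= in xz yz'; rewrite lerBlDr.
have := enorm_tri z x z'; have := enorm_tri x y z'; rewrite (enorm_distC z x).
by move: xz yz'; lra.
Qed.

Lemma mixing_coefficient_ge0 (p q s : R) : 0 <= p -> 0 <= q ->
  (0 <= mixing_coefficient P Psi p q s)%E.
Proof.
move=> p0 q0; apply: ereal_sup_ubound.
(* The distance of empty sets is +oo, so the separation condition holds for every s. *)
exists (cst 0), (cst 0), set0, set0; split.
- by split=> // _ [phi _ <-]; left.
- by split=> // _ [phi _ <-]; left.
- by rewrite measure0 lee_fin.
- by rewrite measure0 lee_fin.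
split; last by rewrite covariance_cst_l abse0.
by apply: le_ereal_inf_tmp => _ [x []].
Qed.

Section shifted_sums.
Variables (K : set 'rV[R]_d) (Q : R) (s : seq 'rV[R]_d).
Hypotheses (mK : measurable K) (KQ : K `<=` box Q) (Q0 : 0 <= Q).
Hypotheses (us : uniq s) (sL : forall z, z \in s -> L z).

(** [ecov_approx] passes to the local events. Their covariance is at most the mixing coefficient and
    vanishes unless z lies in the box of size Q + r; the errors at z and at z + u are each summed by
    [sum_partner_event_local]. *)
Lemma sum_ecov_shift_mixing u r p sigma : L u -> 0 <= r ->
  (2 * r) ^+ d <= p -> sigma <= enorm u - 2 * r ->
  ((\sum_(z <- s) `|ecov P (partner_event Psi K z) (partner_event Psi K (z + u))|)%:E <=
   ((2 * Q + 1 + 2 * r) ^+ d)%:E * mixing_coefficient P Psi p p sigma +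
   (2 * (2 * Q + 1) ^+ d * prob P (flower_exceeds Psi r))%:E)%E.
Proof.
move=> Lu r0 rp su.
have mA z : measurable (partner_event Psi K z) by exact: measurable_partner_event.
have mB z : measurable (local_partner_event Psi K r z).
  exact: measurable_local_partner_event.
pose a z := `|ecov P (local_partner_event Psi K r z) (local_partner_event Psi K r (z + u))|.
pose b z := prob P (partner_event Psi K z `\` local_partner_event Psi K r z).
have le1 : \sum_(z <- s) `|ecov P (partner_event Psi K z) (partner_event Psi K (z + u))| <=
    \sum_(z <- s) a z + (\sum_(z <- s) b z + \sum_(z <- s) b (z + u)).
  rewrite -!big_split /=; apply: ler_sum => z _; rewrite addrA.
  by apply: ecov_approx => //; exact: local_partner_sub.
have le2 : \sum_(z <- s) b z + \sum_(z <- s) b (z + u) <=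
    2 * (2 * Q + 1) ^+ d * prob P (flower_exceeds Psi r).
  rewrite -mulrA mulr_natl mulr2n; apply: lerD; first exact: sum_partner_event_local.
  (* The errors at z + u are those of the translated list, which again consists of distinct lattice
     points. *)
  rewrite -(big_map (fun z => z + u) xpredT b).
  apply: sum_partner_event_local => //.
    by rewrite map_inj_uniq// => x y /addIr.
  by move=> _ /mapP[z zs ->]; apply: latticeD => //; exact: sL.
have alpha0 : (0 <= mixing_coefficient P Psi p p sigma)%E.
  have p0 : 0 <= p by apply: le_trans rp; rewrite exprn_ge0// mulr_ge0.
  exact: mixing_coefficient_ge0.
have le3 : ((\sum_(z <- s) a z)%:E <=
    ((2 * Q + 1 + 2 * r) ^+ d)%:E * mixing_coefficient P Psi p p sigma)%E.
  rewrite -sumEFin.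
  apply: (@le_trans _ _ (\sum_(z <- s) (if `[< box (Q + r)%R (z + 0)%R >]
      then mixing_coefficient P Psi p p sigma else 0))%E).
    rewrite big_seq [leRHS]big_seq; apply: lee_sum => z zs; case: asboolP => zbox.
      apply: ecov_local_le_mixing => //; first exact: sL.
        by apply: latticeD => //; exact: sL.
      by rewrite opprD addNKr enormN.
    rewrite /a (_ : local_partner_event Psi K r z = set0); last first.
      apply/seteqP; split=> t // /(local_partner_event_box d_gt0 KQ).
      by rewrite addr0 in zbox.
    by rewrite /ecov set0I /prob measure0 mul0r subrr normr0.
  rewrite -big_mkcond big_const_seq /=.
  have -> k (x : \bar R) : (iter k (+%E x) 0 = k%:R%:E * x)%E.
    elim: k => [|k IH] /=; first by rewrite mul0e.
    by rewrite IH -nat1r EFinD ge0_muleDl ?lee_fin// mul1e.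
  apply: lee_wpmul2r => //; rewrite lee_fin.
  apply: le_trans (box_lattice_count 0 d_gt0 _ us sL) _; first exact: addr_ge0.
  by rewrite (_ : 2 * (Q + r) + 1 = 2 * Q + 1 + 2 * r)//; ring.
apply: (le_trans (y := ((\sum_(z <- s) a z)%:E +
  (\sum_(z <- s) b z + \sum_(z <- s) b (z + u))%:E)%E)).
  by rewrite -EFinD lee_fin.
by apply: leeD => //; rewrite lee_fin.
Qed.

(** A crude bound for the finitely many u that [round_div] sends to 0. *)
Lemma sum_ecov_shift_partner u : L u ->
  \sum_(z <- s) `|ecov P (partner_event Psi K z) (partner_event Psi K (z + u))| <=
  (2 * Q + 1) ^+ d.
Proof.
move=> Lu; apply: le_trans (sum_partner_event d_gt0 mPsi stPsi mK KQ Q0 us sL).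
by apply: ler_sum => z _; apply: ecov_le_prob; exact: measurable_partner_event.
Qed.

Lemma sum_ecov_shift_defect u r : segment_closed K -> L u -> 0 <= r ->
  \sum_(z <- s) `|ecov P (partner_event Psi K z) (partner_event Psi K (z + u))| <=
    d%:R * (2 * ((2 * Q + 1) ^+ d.-1 * (r + 1))) +
    2 * (2 * Q + 1) ^+ d * prob P (flower_exceeds Psi r).
Proof.
move=> cK Lu r0.
apply: le_trans (sum_partner_defect d_gt0 mPsi stPsi mK KQ Q0 us sL cK r0).
by apply: ler_sum => z _; apply: ecov_partner_defect => //; exact: measurable_partner_event.
Qed.

End shifted_sums.

End mixing.

(** * Tails of unordered sums, and rounding to a coarser lattice *)

Section esum_lists.
Context {R : realType} {T : choiceType}.
Implicit Types (S : set T) (f : T -> \bar R) (s : seq T).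

Lemma sum_seq_le_esum S f s : uniq s -> (forall u, u \in s -> S u) ->
  (\sum_(u <- s) f u <= \esum_(u in S) f u)%E.
Proof.
move=> us sS; apply: ereal_sup_ubound; exists [set` s]; last by rewrite -fsbig_seq.
by split=> [|u /= /sS]; first exact: finite_seq.
Qed.

Lemma esum_subset S S' f : S `<=` S' -> (\esum_(u in S) f u <= \esum_(u in S') f u)%E.
Proof.
move=> SS'; apply: le_ereal_sup => _ [X [finX XS] <-]; exists X => //.
by split=> //; exact: subset_trans SS'.
Qed.

(** s0 enumerates a finite set whose partial sum is within e of the total; a list disjoint from it
    can add at most e. *)
Lemma esum_tail S f (e : R) : (forall u, S u -> 0 <= f u)%E ->
  (\esum_(u in S) f u < +oo)%E -> 0 < e ->
  exists s0, forall s, uniq s -> (forall u, u \in s -> S u /\ u \notin s0) ->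
    (\sum_(u <- s) f u <= e%:E)%E.
Proof.
move=> f0 foo e0; have fin : \esum_(u in S) f u \is a fin_num.
  by rewrite ge0_fin_numE// esum_ge0.
have : (\esum_(u in S) f u - e%:E < \esum_(u in S) f u)%E.
  by rewrite lteBlDr// lteDl// lte_fin.
move=> /ereal_sup_gt[_ [X [finX XS] <-]]; rewrite fsbig_finite// => tail.
set s0 := finmap.enum_fset (fset_set X) in tail; exists s0 => s us sS.
have s0S u : u \in s0 -> S u by rewrite /s0 in_fset_set// inE => /XS.
have us0 : uniq (s0 ++ s).
  rewrite cat_uniq us finmap.fset_uniq andbT /=; apply/hasPn => u /sS[_].
  by [].
have := @sum_seq_le_esum S f _ us0; rewrite big_cat /= => le.
have {}le : (\sum_(u <- s0) f u + \sum_(u <- s) f u <= \esum_(u in S) f u)%E.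
  by apply: le => u; rewrite mem_cat => /orP[/s0S//|/sS[]].
have s00 : (0 <= \sum_(u <- s0) f u)%E.
  by rewrite big_seq; apply: sume_ge0 => u /s0S/f0.
have s0fin : (\sum_(u <- s0) f u)%E \is a fin_num.
  rewrite ge0_fin_numE//; apply: le_lt_trans foo.
  by apply: le_trans le; rewrite leeDl// big_seq; apply: sume_ge0 => u /sS[/f0].
apply: (@le_trans _ _ (\esum_(u in S) f u - \sum_(u <- s0) f u)%E).
  by rewrite leeBrDl.
by rewrite leeBlDl//; move: tail; rewrite lteBlDr// addeC => /ltW.
Qed.

Lemma ler_sum_uniq_sub (s s' : seq T) (f : T -> R) : uniq s -> uniq s' ->
  {subset s <= s'} -> (forall u, u \in s' -> 0 <= f u) ->
  \sum_(u <- s) f u <= \sum_(u <- s') f u.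
Proof.
move=> us us' ss' f0; rewrite [leRHS](bigID (mem s)) /= -[X in _ <= X + _]big_filter.
have /(perm_big _) <- : perm_eq s [seq u <- s' | u \in s].
  apply: uniq_perm => //; first exact: filter_uniq.
  by move=> u; rewrite mem_filter; case: (boolP (u \in s)) => // /ss' ->.
by rewrite lerDl big_seq_cond; apply: sumr_ge0 => u /andP[/f0].
Qed.

End esum_lists.

Section rounding.
Context {R : realType} {d : nat}.
Notation L := (integer_lattice R d).
Variable k : nat.
Hypothesis k_gt0 : (0 < k)%N.
Implicit Types u v : 'rV[R]_d.

(* M = 4k, so that rounding u / M to a lattice point v leaves 2k|v| <= |u| *)
Let M : R := 4 * k%:R.
Let M_gt0 : 0 < M. Proof. by rewrite mulr_gt0 ?ltr0n. Qed.

Definition round_div u : 'rV[R]_d := \row_i (Num.floor (u ord0 i / M + 2^-1))%:~R.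

Lemma round_div_lattice u : L (round_div u).
Proof. by move=> i; rewrite mxE intr_int. Qed.

Let round_itv u i : M * round_div u ord0 i - M / 2 <= u ord0 i <
  M * round_div u ord0 i + M / 2.
Proof.
rewrite mxE; have /andP[] := floor_itv (u ord0 i / M + 2^-1); rewrite intrD.
set f := (Num.floor _)%:~R; move=> l r; have -> : u ord0 i = M * (u ord0 i / M).
  by field; rewrite gt_eqF.
set x := u ord0 i / M in l r *.
have := ler_wpM2l (ltW M_gt0) l; have : M * (x + 2^-1) < M * (f + 1) by rewrite ltr_pM2l.
by rewrite !mulrDr => r' l'; apply/andP; split; lra.
Qed.

(** Coordinatewise, |u_i| >= M |v_i| - M/2. A nonzero integer v_i has |v_i| >= 1, so this is at
    least M |v_i| / 2 = 2k |v_i|. *)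
Lemma enorm_round_div u : 2 * k%:R * enorm (round_div u) <= enorm u.
Proof.
have k0 : 0 <= 2 * k%:R :> R by rewrite mulr_ge0.
rewrite -enormZ//; apply: le_enorm => i; rewrite mxE normrM (ger0_norm k0).
have /andP[l r] := round_itv u i; have := round_div_lattice u i.
set v := round_div u ord0 i in l r *; move=> vZ.
have [->|v0] := eqVneq v 0; first by rewrite normr0 mulr0.
have M2 : M = 2 * (2 * k%:R) by rewrite /M; ring.
have := norm_intr_ge1 vZ v0; have kk : 0 < k%:R :> R by rewrite ltr0n.
have [v1|v1] := leP 0 v => v11.
  have v1' : 1 <= v by rewrite ger0_norm in v11.
  have := ler_wpM2l (ltW M_gt0) v1'; rewrite mulr1 => Mv.
  have kv : 2 * k%:R * v = M * v / 2 by rewrite /M; field.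
  by rewrite !ger0_norm//; lra.
have v1' : 1 <= - v by rewrite ltr0_norm in v11.
have := ler_wpM2l (ltW M_gt0) v1'; rewrite mulr1 mulrN => Mv.
have kv : 2 * k%:R * v = M * v / 2 by rewrite /M; field.
by rewrite (ltr0_norm v1) ltr0_norm ?mulrN; lra.
Qed.

(** Each fibre of [round_div] on the lattice is M v + S, with S the finite set of lattice points in
    a half-open cube. The sum is therefore card(S) times the sum of g. *)
Lemma esum_round_div (g : 'rV[R]_d -> \bar R) : (0 < d)%N ->
  (forall v, L v -> 0 <= g v)%E -> (\esum_(v in L) g v < +oo)%E ->
  (\esum_(u in L) g (round_div u) < +oo)%E.
Proof.
move=> d0 g0 goo.
pose S : set 'rV[R]_d := L `&` [set x | forall i, - (M / 2) <= x ord0 i < M / 2].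
have finS : finite_set S.
  apply: sub_finite_set (finite_lattice_bounded d0 (box_bounded (M / 2))).
  move=> x [Lx xM]; split=> // i; rewrite ler_norml.
  by have /andP[-> /ltW] := xM i.
pose e (sv : 'rV[R]_d * 'rV[R]_d) := M *: sv.2 + sv.1.
have LM v : L v -> L (M *: v).
  by move=> Lv; rewrite /M -natrM; exact: latticeMn.
have eK s v : S s -> L v -> round_div (e (s, v)) = v.
  move=> [_ sM] Lv; apply/rowP => i; rewrite !mxE /=.
  have /intrP[m vm] := Lv i.
  have -> : (M * v ord0 i + s ord0 i) / M + 2^-1 = v ord0 i + (s ord0 i / M + 2^-1).
    by field; rewrite gt_eqF.
  rewrite vm; congr (_%:~R); apply: floor_def; rewrite intrD.
  have /andP[l r] := sM i.
  have lM : - 2^-1 <= s ord0 i / M by rewrite ler_pdivlMr//; lra.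
  have rM : s ord0 i / M < 2^-1 by rewrite ltr_pdivrMr//; lra.
  apply/andP; split; lra.
have bij : set_bij (S `*` L) L e.
  split.
  - by move=> [s v] /= [[Ls _] Lv]; apply: latticeD => //; exact: LM.
  - move=> [s v] [s' v'] /=; rewrite !inE => -[Ss Lv] [Ss' Lv'] ee.
    have vv : v = v' by rewrite -(eK s v Ss Lv) -(eK s' v' Ss' Lv') ee.
    by congr (_, _) => //; move: ee; rewrite /e /= vv => /addrI.
  - move=> u Lu; exists (u - M *: round_div u, round_div u); last by rewrite /e /= addrC subrK.
    split; last exact: round_div_lattice.
    split; first by apply: latticeD => //; apply/latticeN/LM/round_div_lattice.
    move=> i; have /andP[l r] := round_itv u i; rewrite /= 3!mxE.
    by apply/andP; split; lra.
rewrite (reindex_esum (S `*` L) L e _ bij).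
rewrite (eq_esum (b := fun sv => g sv.2)) => [|[s v] [Ss Lv]]; last by rewrite eK.
rewrite -(esum_esum (J := fun=> L) (a := fun _ v => g v)) => [|s v _]; last exact: g0.
rewrite esum_fset//; last by move=> s _; exact: esum_ge0.
rewrite fsbig_finite//; apply: lte_sum_pinfty => s _.
exact: goo.
Qed.

End rounding.

(** * A summable majorant for the covariance sums *)

Section shift_majorant.
Context {R : realType} {d : nat} {disp : measure_display}
  {Omega : measurableType disp} (P : probability Omega R)
  (Psi : Omega -> configuration R d).
Hypotheses (d_gt0 : (0 < d)%N) (mPsi : point_process Psi) (stPsi : stationary P Psi).
Notation L := (integer_lattice R d).
Variable gamma : R.
Hypotheses (gamma_gt0 : 0 < gamma) (gamma_le1 : gamma <= 1).

Let beta r := prob P (flower_exceeds Psi r).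

Let mixing_term (w : 'rV[R]_d) : \bar R :=
  ((enorm w `^ (gamma * d%:R))%:E *
     mixing_coefficient P Psi (enorm w `^ (gamma * d%:R))
            (enorm w `^ (gamma * d%:R)) (enorm w))%E.

Hypothesis mixing_summable : (\esum_(w in L) mixing_term w < +oo)%E.
Hypothesis flower_summable :
  (\esum_(w in L) P (flower_exceeds Psi (enorm w `^ gamma)) < +oo)%E.

Let mixing_term_ge0 w : (0 <= mixing_term w)%E.
Proof.
by apply: mule_ge0; [rewrite lee_fin powR_ge0|apply: mixing_coefficient_ge0; exact: powR_ge0].
Qed.

Lemma exists_powR_ge2 : exists2 k, (0 < k)%N & 2 <= k%:R `^ gamma :> R.
Proof.
exists (Num.truncn (2 `^ gamma^-1 : R)).+1 => //.
have E : 2 = (2 `^ gamma^-1) `^ gamma :> R.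
  by rewrite -powRrM mulVf ?gt_eqF// powRr1.
rewrite {1}E; apply: ge0_ler_powR; rewrite ?nnegrE ?powR_ge0 ?(ltW gamma_gt0)//.
exact/ltW/truncnS_gt.
Qed.

Section majorant.
Variable k : nat.
Hypotheses (k_gt0 : (0 < k)%N) (k_ge2 : 2 <= k%:R `^ gamma :> R).

(* Let w = k v and r = |w|^gamma / 2.  If |u| >= 2|w| then the balls of radius r
   around z and z + u have volume at most |w|^(gamma d) and distance at least
   |w|, and k^gamma >= 2 gives r >= |v|^gamma.  The weight in mixing_term counts
   the lattice points z whose ball meets K. *)
Definition shift_majorant (v : 'rV[R]_d) : \bar R :=
  ((v == 0)%:R%:E + ((2 ^+ d)%:E * mixing_term (k%:R *: v) +
     (2 * beta (enorm v `^ gamma))%:E))%E.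

Lemma shift_majorant_ge0 v : (0 <= shift_majorant v)%E.
Proof.
apply: adde_ge0; first by rewrite lee_fin.
by apply: adde_ge0; [apply: mule_ge0|rewrite lee_fin mulr_ge0// prob_ge0].
Qed.

Lemma esum_shift_majorant : (\esum_(v in L) shift_majorant v < +oo)%E.
Proof.
have b0 v : (0 <= (2 * beta (enorm v `^ gamma))%:E)%E by rewrite lee_fin mulr_ge0// prob_ge0.
have m0 v : (0 <= (2 ^+ d)%:E * mixing_term (k%:R *: v))%E by apply: mule_ge0.
rewrite esumD => [|v _|v _]; [|by rewrite lee_fin|by apply: adde_ge0].
rewrite esumD => [|v _|v _]; [|exact: m0|exact: b0].
apply: lte_add_pinfty; last apply: lte_add_pinfty.
- rewrite (eq_esum (b := fun v => if v \in [set 0] then 1%E else 0%E)); last first.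
    by move=> v _; case: eqVneq => [->|/eqP v0]; [rewrite mem_set|rewrite memNset].
  rewrite -esum_mkcondr; apply: (@le_lt_trans _ _ (\esum_(v in [set (0 : 'rV[R]_d)]) 1%E)).
    by apply: esum_subset => v [].
  by rewrite esum_set1 // ltry.
(* The factor 2^d is written as a sum of ones, so that it comes out as a finite sum of copies of the
   series. *)
- have pow2 : (2 ^+ d)%:E = (\sum_(i < 2 ^ d) 1)%E :> \bar R.
    by rewrite sumEFin sumr_const card_ord natrX.
  rewrite (eq_esum (b := fun v => (\sum_(i < 2 ^ d) mixing_term (k%:R *: v))%E)); last first.
    by move=> v _; rewrite pow2 ge0_sume_distrl//; apply: eq_bigr => i _; rewrite mul1e.
  rewrite esum_sum//; apply: lte_sum_pinfty => i _.
  have inj : set_inj L (fun v : 'rV[R]_d => k%:R *: v).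
    move=> x y _ _ /= /(congr1 (fun v => k%:R^-1 *: v)).
    by rewrite !scalerA mulVf ?scale1r// pnatr_eq0 -lt0n.
  (* The multiples k v are distinct lattice points, so this is a subseries of the given mixing
     series. *)
  rewrite -(@esum_image R _ _ L _ mixing_term inj).
  apply: le_lt_trans mixing_summable; apply: esum_subset => _ [v Lv <-].
  exact: latticeMn.
rewrite (eq_esum (b := fun v => (P (flower_exceeds Psi (enorm v `^ gamma)) +
   P (flower_exceeds Psi (enorm v `^ gamma)))%E)); last first.
  by move=> v _; rewrite probE ?mulr_natl ?mulr2n//; exact: measurable_flower_exceeds.
by rewrite esumD//; apply: lte_add_pinfty.
Qed.

Lemma sum_ecov_shift_majorant (K : set 'rV[R]_d) (Q : R) (s : seq 'rV[R]_d) u :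
  measurable K -> K `<=` box Q -> 0 <= Q -> uniq s -> (forall z, z \in s -> L z) -> L u ->
  ((\sum_(z <- s) `|ecov P (partner_event Psi K z) (partner_event Psi K (z + u))|)%:E <=
    ((2 * Q + 1) ^+ d)%:E * shift_majorant (round_div k u))%E.
Proof.
move=> mK KQ Q0 us sL Lu; set v := round_div k u.
have q1 : 1 <= 2 * Q + 1 by rewrite lerDr mulr_ge0.
have q0 : 0 <= 2 * Q + 1 by exact: le_trans q1.
(* For v = 0 the crude bound is used; the indicator term of the majorant is there for this case. *)
have [v0|v0] := eqVneq v 0.
  apply: (@le_trans _ _ ((2 * Q + 1) ^+ d)%:E).
    by rewrite lee_fin; exact: (sum_ecov_shift_partner d_gt0 mPsi stPsi mK KQ Q0 us sL Lu).
  rewrite -[leLHS]mule1; apply: lee_wpmul2l; first by rewrite lee_fin exprn_ge0.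
  rewrite /shift_majorant v0 eqxx leeDl//.
  by apply: adde_ge0; [apply: mule_ge0|rewrite lee_fin mulr_ge0// prob_ge0].
pose w := k%:R *: v; pose r := enorm w `^ gamma / 2.
have r2 : 2 * r = enorm w `^ gamma by rewrite /r; field.
have Lv : L v by exact: round_div_lattice.
have wE : enorm w = k%:R * enorm v by rewrite /w enormZ.
(* A nonzero lattice vector has norm at least 1. Hence |w| >= 1 and |w|^gamma <= |w|, so that |u| >=
   2|w| leaves a separation of at least |w|. *)
have v1 : 1 <= enorm v.
  have [i vi] : exists i, v ord0 i != 0.
    apply/existsP; rewrite -negb_forall; apply: contra v0 => /forallP vi.
    by apply/eqP/rowP => i; rewrite [RHS]mxE; apply/eqP; exact: vi.
  exact: le_trans (norm_intr_ge1 (Lv i) vi) (coord_le_enorm v i).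
have w1 : 1 <= enorm w by rewrite wE mulr_ege1// ler1n.
have wg1 : 1 <= enorm w `^ gamma by rewrite -(powRr0 (enorm w)) ler_powR// ltW.
have wgw : enorm w `^ gamma <= enorm w.
  by rewrite -[leRHS]powRr1 ?enorm_ge0// ler_powR.
have r0 : 0 <= r by rewrite divr_ge0// powR_ge0.
have rp : (2 * r) ^+ d <= enorm w `^ (gamma * d%:R).
  by rewrite r2 powRrM powR_mulrn// powR_ge0.
have su : enorm w <= enorm u - 2 * r.
  have := enorm_round_div k_gt0 u; rewrite -/v -mulrA -wE r2; lra.
have := sum_ecov_shift_mixing d_gt0 mPsi stPsi mK KQ Q0 us sL Lu r0 rp su.
move/le_trans; apply; rewrite /shift_majorant (negPf v0) add0e.
have m0 : (0 <= mixing_term w)%E := mixing_term_ge0 w.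
rewrite ge0_muleDr; [|exact: mule_ge0|by rewrite lee_fin mulr_ge0// prob_ge0].
apply: leeD; last first.
  rewrite -EFinM lee_fin mulrCA mulrA ler_wpM2l ?mulr_ge0 ?exprn_ge0//.
  apply: le_prob; try exact: measurable_flower_exceeds.
  apply: flower_exceeds_anti; rewrite /r wE powRM ?enorm_ge0// ler_pdivlMr// mulrC.
  by rewrite ler_wpM2r// powR_ge0.
rewrite muleA -EFinM /mixing_term -/w muleA -EFinM.
apply: lee_wpmul2r; first by apply: mixing_coefficient_ge0; exact: powR_ge0.
rewrite lee_fin powRrM powR_mulrn ?powR_ge0// -!exprMn r2.
rewrite lerXn2r ?nnegrE ?addr_ge0 ?mulr_ge0 ?powR_ge0//.
(* For q, x >= 1 one has q + x <= 2 q x; this is the origin of 2^d in the majorant. *)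
move: q1 wg1; set q := 2 * Q + 1; set x := enorm w `^ gamma; nra.
Qed.

End majorant.

(** A summable family on an infinite set has arbitrarily small terms: some multiple n e_0 of the
    first basis vector is a lattice point outside the finite list [s0]. *)
Lemma flower_exceeds_small (e : R) : 0 < e -> exists2 r, 0 <= r & beta r <= e.
Proof.
move=> e0.
have [|s0 tail] := esum_tail _ flower_summable e0; first by move=> w _; exact: measure_ge0.
have : ~ (forall n : nat, n%:R *: delta_mx ord0 (Ordinal d_gt0) \in s0).
  move=> all0.
  pose multiples : seq 'rV[R]_d :=
    [seq n%:R *: delta_mx ord0 (Ordinal d_gt0) | n <- iota 0 (size s0).+1].
  have us : uniq multiples.
    rewrite map_inj_uniq ?iota_uniq// => m n /rowP /(_ (Ordinal d_gt0)).
    by rewrite !mxE !eqxx !mulr1 => /eqP; rewrite eqr_nat => /eqP.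
  have /(uniq_leq_size us) : {subset multiples <= s0}.
    by move=> x /mapP[n _ ->].
  by rewrite size_map size_iota ltnn.
move=> /existsNP[n /negP ns0].
set w := n%:R *: _ in ns0; exists (enorm w `^ gamma); first exact: powR_ge0.
have := tail [:: w]; rewrite big_seq1 probE; last exact: measurable_flower_exceeds.
rewrite lee_fin; apply => // u; rewrite inE => /eqP ->; split=> //.
by apply: latticeMn => i; rewrite mxE; case: (_ && _); rewrite ?rpred1 ?rpred0.
Qed.

End shift_majorant.

(** * Variance of the number of matched points *)

Lemma double_sum_le_shift {R : realType} (T : zmodType) (s : seq T) (a : T -> T -> R) :
  uniq s -> (forall z w, 0 <= a z w) ->
  \sum_(z <- s) \sum_(w <- s) a z w <=
    \sum_(u <- undup [seq w - z | z <- s, w <- s]) \sum_(z <- s) a z (z + u).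
Proof.
move=> us a0; rewrite [leRHS]exchange_big /= big_seq [leRHS]big_seq.
apply: ler_sum => z zs.
(* Substitution u = w - z. On the right there are also pairs with z + u outside s, so only an
   inequality results, by nonnegativity of a. *)
rewrite (eq_bigr (fun w => a z (z + (w - z)))) => [|w _]; last by rewrite addrC subrK.
rewrite -(big_map (fun w => w - z) xpredT (fun u => a z (z + u))).
apply: ler_sum_uniq_sub => //.
- by rewrite map_inj_uniq// => x y /addIr.
- exact: undup_uniq.
- by move=> _ /mapP[w ws ->]; rewrite mem_undup; apply/allpairsP; exists (z, w).
Qed.

Section variance_bound.
Context {R : realType} {d : nat} {disp : measure_display}
  {Omega : measurableType disp} (P : probability Omega R)
  (Psi : Omega -> configuration R d).
Hypotheses (d_gt0 : (0 < d)%N) (mPsi : point_process Psi) (stPsi : stationary P Psi).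
Notation L := (integer_lattice R d).
Variables (K : set 'rV[R]_d) (Q : R).
Hypotheses (mK : measurable K) (KQ : K `<=` box Q) (Q0 : 0 <= Q).

Let X t : R := fine (npoints (matched_points L (Psi t)) K).

Let lattice_box n : seq 'rV[R]_d := finmap.enum_fset (fset_set (L `&` box n%:R)).

Let mem_lattice_box n z : z \in lattice_box n <-> L z /\ box n%:R z.
Proof.
rewrite in_fset_set; first by rewrite inE.
exact: finite_lattice_bounded d_gt0 (box_bounded _).
Qed.

Let uniq_lattice_box n : uniq (lattice_box n).
Proof. exact: finmap.fset_uniq. Qed.

Let measurable_X : measurable_fun setT X.
Proof.
apply: (measurableT_comp (fine_measurable measurableT)).
apply: (measurableT_comp (measurable_npoints mK)).
exact: (measurableT_comp (measurable_matched_points d_gt0) mPsi).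
Qed.

(* z |-> tau(z) is a bijection from the lattice points with partner in K onto
   the matched points of Psi in K. *)
Let count_eventually t :
  \forall n \near \oo, \sum_(z <- lattice_box n) \1_(partner_event Psi K z) t = X t.
Proof.
pose Y := matched_points L (Psi t) `&` K.
have finY : finite_set Y.
  apply: sub_finite_set (points_locally_finite (matched_points L (Psi t)) (box_bounded Q)).
  exact: setIS.
pose ys := finmap.enum_fset (fset_set Y).
have ysP y : y \in ys <-> Y y by rewrite in_fset_set// inE.
have tauP y : exists p, y \in ys -> matched L (Psi t) p y.
  have [yY|] := boolP (y \in ys); last by exists 0.
  have [[psiy my] _] := (ysP y).1 yY.
  by have [p py] := (matching_rP _ psiy).1 my; exists p.
have [tau tauE] := choice tauP.
have utau : uniq (map tau ys).
  rewrite map_inj_in_uniq ?finmap.fset_uniq// => y y' yY yY' e.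
  by apply: matched_fun (tauE y yY) _; rewrite e; exact: tauE.
have tau_event z : z \in map tau ys <-> partner_event Psi K z t.
  split=> [/mapP[y yY ->]|[Lz [y zy Ky]]].
    split; first exact: matched_phi (tauE y yY).
    by exists y; [exact: tauE|case/ysP : yY].
  have yY : y \in ys.
    apply/ysP; split=> //; split; first exact: matched_psi zy.
    by apply/(matching_rP _ (matched_psi zy)); exists z.
  by apply/mapP; exists y => //; apply: matched_inj zy _; exact: tauE.
have [n nbox] : exists n : nat, forall z, z \in map tau ys -> box n%:R z.
  exists (\max_(z <- map tau ys) (Num.truncn `|z|).+1)%N => z zs i.
  apply: le_trans (coord_le_norm z i) _; apply: le_trans (ltW (truncnS_gt _)) _.
  by rewrite ler_nat; exact: leq_bigmax_seq.
exists n => // m /= nm.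
rewrite (eq_bigr (fun z => if z \in map tau ys then 1 else 0)) => [|z _]; last first.
  rewrite indicE; case: ifPn => [/tau_event zt|zt]; first by rewrite mem_set.
  by rewrite memNset// => /tau_event zt'; rewrite zt' in zt.
rewrite -big_mkcond /= -big_filter.
have /(perm_big _) -> : perm_eq [seq z <- lattice_box m | z \in map tau ys] (map tau ys).
  apply: uniq_perm => //; first exact: filter_uniq.
  move=> z; rewrite mem_filter; case: (boolP (z \in _)) => //= zs.
  apply/mem_lattice_box; split; first by have [] := (tau_event z).1 zs.
  by apply: sub_box (nbox z zs); rewrite ler_nat.
by rewrite big_const_seq count_predT size_map iter_addr_0 /X /npoints /counting asboolT.
Qed.

Let nondecreasing_count t :
  nondecreasing_seq (fun n => \sum_(z <- lattice_box n) \1_(partner_event Psi K z) t : R).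
Proof.
move=> m n mn; apply: ler_sum_uniq_sub => // z /mem_lattice_box[Lz zm].
by apply/mem_lattice_box; split=> //; apply: sub_box zm; rewrite ler_nat.
Qed.

(** The differences are split at the list U: those in U get the surface-order bound, the others the
    majorant. The radius r occurs only in the former, so it can still be chosen after U. *)
Lemma variance_matched_le (k : nat) (gamma r e : R) (U : seq 'rV[R]_d) :
  (0 < k)%N -> 0 < gamma -> gamma <= 1 -> 2 <= k%:R `^ gamma ->
  segment_closed K -> 0 <= r ->
  (forall s, uniq s -> (forall u, u \in s -> L u /\ u \notin U) ->
    (\sum_(u <- s) shift_majorant P Psi gamma k (round_div k u) <= e%:E)%E) ->
  ('V_P[X] <= ((size U)%:R * (d%:R * (2 * ((2 * Q + 1) ^+ d.-1 * (r + 1))) +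
    2 * (2 * Q + 1) ^+ d * prob P (flower_exceeds Psi r)) +
    (2 * Q + 1) ^+ d * e)%:E)%E.
Proof.
move=> k0 gamma0 gamma1 k2 cK r0 tail.
have q0 : 0 <= 2 * Q + 1 by rewrite addr_ge0 ?mulr_ge0.
apply: (variance_count_le (u := lattice_box) (A := partner_event Psi K)
  (C := (2 * Q + 1) ^+ d)) => //.
- by move=> z; exact: measurable_partner_event.
- by move=> n; apply: sum_partner_event => // z /mem_lattice_box[].
move=> n; set s := lattice_box n.
have sL z : z \in s -> L z by move=> /mem_lattice_box[].
apply: le_trans (double_sum_le_shift (a := fun z w =>
  `|ecov P (partner_event Psi K z) (partner_event Psi K w)|) (uniq_lattice_box n) _) _ => //.
set D := undup _; pose S u :=
  \sum_(z <- s) `|ecov P (partner_event Psi K z) (partner_event Psi K (z + u))|.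
have DL u : u \in D -> L u.
  rewrite mem_undup => /allpairsP[[z w] [/sL Lz /sL Lw ->]].
  by apply: latticeD => //; exact: latticeN.
rewrite -/(S _) (bigID (mem U)) /=; apply: lerD.
  set T := (X in _ * X).
  have T0 : 0 <= T.
    have qd m : 0 <= (2 * Q + 1) ^+ m by exact: exprn_ge0.
    by apply: addr_ge0; rewrite ?mulr_ge0 ?qd ?prob_ge0 ?addr_ge0.
  rewrite -big_filter; apply: (@le_trans _ _ (\sum_(u <- [seq u <- D | u \in U]) T)).
    rewrite big_seq [leRHS]big_seq; apply: ler_sum => u.
    rewrite mem_filter => /andP[_ /DL Lu].
    exact: (sum_ecov_shift_defect d_gt0 mPsi stPsi mK KQ Q0 (uniq_lattice_box n) sL cK Lu r0).
  (* Each difference in U occurs at most once, so their number is at most the length of U. *)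
  rewrite big_const_seq count_predT iter_addr_0 -[leLHS]mulr_natl ler_wpM2r// ler_nat.
  apply: uniq_leq_size; first by rewrite filter_uniq// undup_uniq.
  by move=> u; rewrite mem_filter => /andP[].
rewrite -big_filter -lee_fin -sumEFin.
set s' := [seq u <- D | u \notin U].
have s'P u : u \in s' -> L u /\ u \notin U.
  by rewrite mem_filter => /andP[uU /DL].
apply: (@le_trans _ _ (\sum_(u <- s') (((2 * Q + 1) ^+ d)%:E *
    shift_majorant P Psi gamma k (round_div k u)))%E).
  rewrite big_seq [leRHS]big_seq; apply: lee_sum => u /s'P[Lu _].
  exact: (sum_ecov_shift_majorant d_gt0 mPsi stPsi gamma0 gamma1 k0 k2 mK KQ Q0
    (uniq_lattice_box n) sL Lu).
rewrite -ge0_sume_distrr => [|u _]; last exact: shift_majorant_ge0.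
rewrite EFinM; apply: lee_wpmul2l; first by rewrite lee_fin exprn_ge0.
by apply: tail => //; rewrite filter_uniq// undup_uniq.
Qed.

End variance_bound.

(** * Dilations of a convex body and the limit *)

Lemma cvge0_eventually_le {R : realType} (T : Type) (F : set_system T) (FF : Filter F)
    (f : T -> \bar R) :
  (forall e : R, 0 < e -> \forall x \near F, (0 <= f x <= e%:E)%E) -> f @ F --> 0%E.
Proof.
move=> f0; apply/fine_cvgP; split.
  by apply: filterS (f0 1 ltr01) => x /andP[l u]; rewrite ge0_fin_numE// (le_lt_trans u)// ltry.
apply/cvgrPdist_le => e e0; apply: filterS (f0 e e0) => x /andP[l u] /=.
have ffin : f x \is a fin_num by rewrite ge0_fin_numE// (le_lt_trans u)// ltry.
by rewrite sub0r normrN ger0_norm ?fine_ge0// -lee_fin fineK.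
Qed.

Lemma lebesgue_box_fin {R : realType} {d : nat} (A : set 'rV[R]_d) (Q : R) :
  measurable A -> A `<=` box Q -> (lebesgue_rV d A < +oo)%E.
Proof.
move=> mA AQ; have mI (i : 'I_d) : measurable `[- Q, Q]%classic by exact: measurable_itv.
have boxE : box Q = [set v : 'rV[R]_d | forall i, `[- Q, Q]%classic (v ord0 i)].
  by apply/seteqP; split=> v vQ i; have := vQ i; rewrite /= in_itv /= ler_norml.
apply: (@le_lt_trans _ _ (lebesgue_rV d (box Q))).
  by apply: le_measure; rewrite ?inE//; exact: measurable_box.
rewrite boxE (lebesgue_rV_box (A := fun=> `[- Q, Q]%classic) mI).
rewrite (eq_bigr (fun=> (fine (lebesgue_measure `[- Q, Q]%classic))%:E)) => [|i _].
  by rewrite prodEFin ltry.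
rewrite fineK// lebesgue_measure_itv; case: ifP => // _.
Qed.

Lemma convex_set_segment_closed {R : realType} {d : nat} (W : set 'rV[R]_d) (r : R) :
  convex_set (W : set (convex_lmodType 'rV[R]_d)) -> segment_closed (dilation r W).
Proof.
move=> cW _ _ t /andP[t0 t1] [x Wx <-] [y Wy <-].
exists (t *: x + (1 - t) *: y).
  by have := cW x y (Itv01 t0 t1); rewrite !inE; apply.
by rewrite scalerDr !scalerA mulrC [r * (1 - t)]mulrC.
Qed.

Theorem theorem6p1 (R : realType) (d : nat) (hd : (0 < d)%N)
    (disp : measure_display) (Omega : measurableType disp)
    (P : probability Omega R) (Psi : Omega -> configuration R d)
    (hPsi : point_process Psi) (hstat : stationary P Psi)
    (hint : (1 <= intensity P Psi)%E)
    (gamma : R) (hgamma0 : 0 < gamma) (hgamma1 : gamma <= 1)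
    (hmix : (\esum_(w in integer_lattice R d)
        ((enorm w `^ (gamma * d%:R))%:E *
          mixing_coefficient P Psi (enorm w `^ (gamma * d%:R))
            (enorm w `^ (gamma * d%:R)) (enorm w)) < +oo)%E)
    (hflower : (\esum_(w in integer_lattice R d)
        P [set t | ~ (matching_flower (integer_lattice R d) (Psi t) 0
                        `<=` eball 0 (enorm w `^ gamma))] < +oo)%E) :
  let Psi_tau := fun t => matched_points (integer_lattice R d) (Psi t) in
  point_process Psi_tau /\ hyperuniform P Psi_tau.
Proof.
move=> Psi_tau; split; first exact: (measurableT_comp (measurable_matched_points hd) hPsi).
move=> W cW compW W0.
have [Q Q0 WQ] := bounded_sub_box (compact_bounded compW).
have mW : measurable W.
  rewrite -[W]setCK; apply: measurableC; apply: open_measurable_rV.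
  by apply: closed_openC; apply: compact_closed compW; exact: norm_hausdorff.
pose lam := fine (lebesgue_rV d W).
have lamE : lebesgue_rV d W = lam%:E.
  by rewrite fineK// ge0_fin_numE ?(ltW W0)//; exact: lebesgue_box_fin mW WQ.
have lam0 : 0 < lam by rewrite -lte_fin -lamE.
have [k k0 k2] := exists_powR_ge2 hgamma0.
have sumg : (\esum_(u in integer_lattice R d)
    shift_majorant P Psi gamma k (round_div k u) < +oo)%E.
  apply: esum_round_div => // [v _|]; first exact: shift_majorant_ge0.
  exact: esum_shift_majorant.
apply: cvge0_eventually_le => e e0.
(* With this q, 2 (r Q) + 1 <= r q for r >= 1, so powers of the box size are at most r^n q^n. Each
   of the three contributions to the variance is allowed e lam r^d / 3. *)
pose q := 2 * Q + 1; have q0 : 0 < q by rewrite addr_gt0// mulr_gt0.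
have q1 : 1 <= q by rewrite lerDr mulr_ge0// ltW.
have qd0 : 0 < q ^+ d by rewrite exprn_gt0.
have el0 : 0 < e * lam / 3 by rewrite divr_gt0// mulr_gt0.
have [|U tail] := esum_tail _ sumg (divr_gt0 el0 qd0).
  by move=> u _; exact: shift_majorant_ge0.
pose nU : R := (size U)%:R.
(* rho is chosen after U, since the flower probability is multiplied by the length of U. The summand
   1 keeps the denominator positive when U is empty. *)
have [|rho rho0 small] := flower_exceeds_small (P := P) (Psi := Psi) hd hPsi hflower
  (e := e * lam / 3 / (nU * (2 * q ^+ d) + 1)).
  by rewrite divr_gt0// ltr_wpDl// !mulr_ge0// ltW.
(* The surface contribution is at most A r^(d-1), which is within its share as soon as r >= A / (e
   lam / 3). *)
pose A := nU * (d%:R * (2 * (q ^+ d.-1 * (rho + 1)))).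
have := nbhs_pinfty_ge (num_real (Num.max 1 (A / (e * lam / 3)))).
apply: filterS => r; rewrite ge_max ler_pdivrMr// => /andP[r1].
rewrite mulrC => rA; have r0 : 0 < r by exact: lt_le_trans r1.
have mK : measurable (dilation r W) by exact: measurable_dilation.
have KQ : dilation r W `<=` box (r * Q).
  move=> _ [x /WQ xQ <-] i; rewrite mxE normrM (gtr0_norm r0).
  by rewrite ler_wpM2l// ltW.
rewrite lebesgue_rV_dilation// lamE -EFinM inver gt_eqF ?mulr_gt0 ?exprn_gt0//.
have rl0 : 0 < r ^+ d * lam by rewrite mulr_gt0 ?exprn_gt0.
apply/andP; split.
  by apply: mule_ge0; [exact: variance_ge0|rewrite lee_fin invr_ge0 ltW].
rewrite lee_pdivrMr// -EFinM.
have rQ0 : 0 <= r * Q by rewrite mulr_ge0// ltW.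
have := variance_matched_le hd hPsi hstat mK KQ rQ0 k0 hgamma0 hgamma1 k2
  (convex_set_segment_closed (r := r) cW) rho0 tail.
move=> /le_trans; apply.
rewrite lee_fin -/nU.
have qr n : (2 * (r * Q) + 1) ^+ n <= r ^+ n * q ^+ n.
  rewrite -exprMn lerXn2r ?nnegrE ?addr_ge0 ?mulr_ge0 ?(ltW r0) ?(ltW q0) ?(ltW Q0)//.
  by rewrite /q; nra.
set qq := 2 * (r * Q) + 1 in qr *; set b := prob _ _ in small *.
have b0 : 0 <= b by exact: prob_ge0.
have nU0 : 0 <= nU by [].
have rho1 : 0 <= rho + 1 by rewrite addr_ge0.
have t1 : nU * (d%:R * (2 * (qq ^+ d.-1 * (rho + 1)))) <= (e * lam / 3) * r ^+ d.
  apply: (@le_trans _ _ (A * r ^+ d.-1)).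
    have -> : A * r ^+ d.-1 = nU * (d%:R * (2 * (r ^+ d.-1 * q ^+ d.-1 * (rho + 1)))).
      by rewrite /A; ring.
    do 3 (apply: ler_wpM2l => //); exact: ler_wpM2r.
  rewrite -[X in _ <= _ * r ^+ X](prednK hd) exprS mulrA ler_wpM2r//.
  by rewrite exprn_ge0// ltW.
have t2 : nU * (2 * qq ^+ d * b) <= (e * lam / 3) * r ^+ d.
  apply: (@le_trans _ _ ((nU * (2 * q ^+ d) + 1) * b * r ^+ d)).
    apply: (@le_trans _ _ (nU * (2 * (r ^+ d * q ^+ d) * b))).
      by rewrite ler_wpM2l// ler_wpM2r// ler_wpM2l.
    have : 0 <= b * r ^+ d by rewrite mulr_ge0// exprn_ge0// ltW.
    by set y := r ^+ d; set x := q ^+ d; lra.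
  rewrite ler_wpM2r ?exprn_ge0 ?(ltW r0)//.
  rewrite -ler_pdivlMl; first by rewrite mulrC.
  by rewrite ltr_wpDl// !mulr_ge0// ltW.
have t3 : qq ^+ d * (e * lam / 3 / q ^+ d) <= (e * lam / 3) * r ^+ d.
  set a := e * lam / 3; rewrite mulrA ler_pdivrMr// [leLHS]mulrC -[leRHS]mulrA.
  by apply: ler_wpM2l; [exact: ltW|exact: qr].
have -> : e * (r ^+ d * lam) = e * lam / 3 * r ^+ d + e * lam / 3 * r ^+ d + e * lam / 3 * r ^+ d.
  by field.
by rewrite mulrDr; apply: lerD; [apply: lerD|].
Qed.
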